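(* Let $d\ge2$, $\varepsilon\in(0,\tfrac12]$, and let $M$ be a Riemannian manifold isometric to $\mathbb{S}^d/\Gamma$, $\mathbb{E}^d/\Gamma$ or $\mathbb{H}^d/\Gamma$ for some finite group $\Gamma$ of isometries. For any set $P$ of $n$ points of $M$ there is a Steiner $(1+\varepsilon)$-spanner for $P$ (with respect to the geodesic distance of $M$) with $d^{O(d)}\,\varepsilon^{(1-d)/2}\log\frac1\varepsilon\cdot n|\Gamma|$ edges.
   Context: A Steiner $t$-spanner for finite $P$ in a metric space is a geometric graph (edges weighted by the distance between endpoints) on $P\cup S$ for a finite set $S$ of further points of the space, with shortest-path distance at most $t$ times the true distance for every pair of points of $P$. $O(\cdot)$ constants absolute. *)

(* Defs.v *)
From Stdlib Require Import Reals List.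
Open Scope R_scope.

Fixpoint rsum (n : nat) (f : nat -> R) : R :=
  match n with O => 0 | S k => rsum k f + f k end.

Definition vanish_from (m : nat) (x : nat -> R) : Prop :=
  forall i, (m <= i)%nat -> x i = 0.

Inductive geometry := Spherical | Euclidean | Hyperbolic.

(* E^d = R^d (coordinates 0..d-1);
   S^d = unit sphere in R^{d+1} (coordinates 0..d);
   H^d = upper sheet of the hyperboloid x_0^2 - x_1^2 - ... - x_d^2 = 1, x_0 > 0. *)
Definition model_pt (g : geometry) (d : nat) (x : nat -> R) : Prop :=
  match g with
  | Euclidean => vanish_from d x
  | Spherical => vanish_from (S d) x /\ rsum (S d) (fun i => x i ^ 2) = 1
  | Hyperbolic => vanish_from (S d) x /\ 0 < x 0%nat /\
                  x 0%nat ^ 2 - rsum d (fun i => x (S i) ^ 2) = 1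
  end.

Definition model_space (g : geometry) (d : nat) : Type :=
  { x : nat -> R | model_pt g d x }.

Definition arcosh (t : R) : R := ln (t + sqrt (t ^ 2 - 1)).

Definition model_dist_raw (g : geometry) (d : nat) (x y : nat -> R) : R :=
  match g with
  | Euclidean => sqrt (rsum d (fun i => (x i - y i) ^ 2))
  | Spherical => acos (rsum (S d) (fun i => x i * y i))
  | Hyperbolic => arcosh (x 0%nat * y 0%nat - rsum d (fun i => x (S i) * y (S i)))
  end.

Definition model_dist (g : geometry) (d : nat) (p q : model_space g d) : R :=
  model_dist_raw g d (proj1_sig p) (proj1_sig q).

Definition is_isometry {X : Type} (dist : X -> X -> R) (f : X -> X) : Prop :=
  (forall x y, dist (f x) (f y) = dist x y) /\ (forall y, exists x, f x = y).

Definition finite_isometry_group {X : Type} (dist : X -> X -> R)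
  (G : list (X -> X)) : Prop :=
  NoDup G /\
  In (fun x => x) G /\
  (forall f, In f G -> is_isometry dist f) /\
  (forall f h, In f G -> In h G -> In (fun x => f (h x)) G) /\
  (forall f, In f G -> exists h, In h G /\ forall x, h (f x) = x).

(* The quotient X/G is a manifold: G acts freely. *)
Definition acts_freely {X : Type} (G : list (X -> X)) : Prop :=
  forall f, In f G -> forall x, f x = x -> forall y, f y = y.

(* Distance in X/G between the orbits of x and y:  min_{f in G} dist x (f y). *)
Definition quot_dist {X : Type} (dist : X -> X -> R) (G : list (X -> X))
  (x y : X) : R :=
  fold_right (fun f acc => Rmin (dist x (f y)) acc) (dist x y) G.

Fixpoint is_walk {X : Type} (E : list (X * X)) (u : X) (l : list X) (v : X) : Prop :=
  match l with
  | nil => u = v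
  | w :: l' => (In (u, w) E \/ In (w, u) E) /\ is_walk E w l' v
  end.

Fixpoint walk_weight {X : Type} (dist : X -> X -> R) (u : X) (l : list X) : R :=
  match l with
  | nil => 0
  | w :: l' => dist u w + walk_weight dist w l'
  end.

Definition is_steiner_spanner {X : Type} (dist : X -> X -> R) (t : R)
  (P S : list X) (E : list (X * X)) : Prop :=
  (forall e, In e E -> In (fst e) (P ++ S) /\ In (snd e) (P ++ S)) /\
  (forall p q, In p P -> In q P ->
     exists w, is_walk E p w q /\ walk_weight dist p w <= t * dist p q).

(* Main.v *)
(* A pair of points at distance D is connected by a path with one bend at a Steiner point close to
   the middle part of the geodesic. A point at distance h from the geodesic costs only O(h^2 / D), so
   spacing sqrt(eps) D suffices, and the Steiner points may be confined to grids on hypersurfaces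
   that the geodesic must cross (coordinate hyperplanes in Euclidean, gnomonic or half-space
   coordinates), which gives eps^((1-d)/2) points per net point and scale. Pairs are first
   rounded to net points at distance O(eps D). A pair (net point, level) needs edges only if another net
   point is at most O(log(1/eps)) levels away from it; charging such a pair to whichever of the two dies
   first bounds their number by O(n log(1/eps)), whatever the metric. At distances above a
   constant in hyperbolic space this fails, and points instead climb vertically in the half-space
   model towards the top of the geodesic, their horizontal positions being rounded to nets of spacing
   sqrt(eps) times the height. A quotient is handled by spanning the n|G| points of all orbits. *)
Require Import Defs.
From Stdlib Require Import Reals Ranalysis5 List Arith ZArith Lra Lia Classical ClassicalEpsilon.
Open Scope R_scope.

(** The counting treats the geometry as a black box: for a scale [r] and a point [p], a list of at
    most [K] Steiner points such that two points at distance comparable with [r] share a good bend.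
    Supplying it rests on linear algebra. Points of the sphere and the hyperboloid are vectors, and
    a point dividing a geodesic is a linear combination of its ends; pairing it with an arbitrary
    [z] gives a linear relation between [cos] or [cosh] of three distances (Stewart's theorem), and
    a tangent bound turns that into a quadratic excess. Only continuity of the coordinates is used
    to make a geodesic meet a hyperplane, so it need not be straight in the chart. In hyperbolic
    space climbing is cheap because [exp] of a long distance is nearly
    [(hx^2 + y^2 + y'^2) / (y y')]: raising an end lowers the distance by the logarithm of the
    height ratio, up to an additive [O(eps)], which is a relative error once the distance is at
    least [1 / 2]. Horizontal positions are rounded in the pseudo-metric [hx], so the bound on
    active pairs is applied to [hx] and not to the hyperbolic distance. *)

(** * Walks, nets and the local spanner *)

(** Zero distance between distinct points is allowed because nets are also built for the horizontal
    distance of the half-space, which vanishes on vertical lines. *)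
Definition pseudo_metric {X : Type} (dist : X -> X -> R) : Prop :=
  (forall x, dist x x = 0) /\ (forall x y, dist x y = dist y x) /\
  (forall x y, 0 <= dist x y) /\
  (forall x y z, dist x z <= dist x y + dist y z).

Definition conn {X : Type} (dist : X -> X -> R) (E : list (X * X)) (u v : X) (c : R)
  : Prop :=
  exists w, is_walk E u w v /\ walk_weight dist u w <= c.

Lemma conn_refl {X} (dist : X -> X -> R) E u c : 0 <= c -> conn dist E u u c.
Proof. exists nil; simpl; split; auto. Qed.

Lemma conn_edge {X} (dist : X -> X -> R) E u v c :
  In (u, v) E -> dist u v <= c -> conn dist E u v c.
Proof. exists (v :: nil); simpl; split; auto. lra. Qed.

Lemma conn_trans {X} (dist : X -> X -> R) E u v w a b :
  conn dist E u v a -> conn dist E v w b -> conn dist E u w (a + b).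
Proof.
  intros [l [Hl Wl]] [m [Hm Wm]]. exists (l ++ m).
  revert u a Hl Wl; induction l as [|x l IH]; simpl; intros u a Hl Wl.
  - subst; split; auto; lra.
  - destruct Hl as [Hx Hl].
    destruct (IH x (a - dist u x) Hl) as [H1 H2]; [lra|].
    split; auto; lra.
Qed.

Lemma conn_mono {X} (dist : X -> X -> R) E u v a b :
  conn dist E u v a -> a <= b -> conn dist E u v b.
Proof. intros [l [Hl Wl]] Hab. exists l; split; auto; lra. Qed.

Lemma conn_sym {X} (dist : X -> X -> R) E u v a :
  pseudo_metric dist -> conn dist E u v a -> conn dist E v u a.
Proof.
  intros (_ & Hs & _ & _) [l [Hl Wl]].
  revert u a Hl Wl; induction l as [|x l IH]; simpl; intros u a Hl Wl.
  - subst; exists nil; simpl; auto.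
  - destruct Hl as [Hx Hl].
    replace a with ((a - dist u x) + dist u x) by ring.
    apply conn_trans with x; [apply IH; auto; lra|].
    exists (u :: nil); simpl; rewrite (Hs x u).
    split; [tauto | lra].
Qed.

Lemma conn_incl {X} (dist : X -> X -> R) E E' u v a :
  incl E E' -> conn dist E u v a -> conn dist E' u v a.
Proof.
  intros Hi [l [Hl Wl]]. exists l; split; auto. clear Wl.
  revert u Hl; induction l as [|x l IH]; simpl; auto.
  intros u [Hx Hl]; split; auto. destruct Hx; auto.
Qed.

Lemma greedy_net {X} (dist : X -> X -> R) (A : list X) (delta : R) :
  pseudo_metric dist -> 0 <= delta ->
  exists B, incl B A /\
    (forall x y, In x B -> In y B -> x <> y -> delta < dist x y) /\
    (forall x, In x A -> exists y, In y B /\ dist x y <= delta).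
Proof.
  intros (H0 & Hs & _ & _) Hd. induction A as [|a A (B & HB & Hsep & Hcov)].
  - exists nil; split; [easy|split; easy].
  - destruct (classic (exists y, In y B /\ dist a y <= delta)) as [Hy|Hy].
    + exists B; repeat split; auto.
      * intros x Hx; right; auto.
      * intros x [->|Hx]; auto.
    + assert (Hfar : forall y, In y B -> delta < dist a y).
      { intros y HyB. apply Rnot_le_lt; intro; apply Hy; eauto. }
      exists (a :: B); repeat split.
      * intros x [->|Hx]; [left|right]; auto.
      * intros x y [->|Hx] [->|Hy'] Hxy; auto; try easy. rewrite Hs; auto.
      * intros x [->|Hx].
        -- exists x; split; [left; auto | rewrite H0; auto].
        -- destruct (Hcov x Hx) as (y & ? & ?); exists y; split; [right|]; auto.
Qed.

(* [life w] is the last level at which [w] is a net point; level 0 contains all of [Q]. *)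
Definition net_hierarchy {X : Type} (rho : X -> X -> R) (s : R) (Q : list X) (H : nat)
  (life : X -> nat) (par : X -> X) : Prop :=
  (forall w, In w Q -> (life w <= H)%nat) /\
  (forall w w' k, In w Q -> In w' Q -> w <> w' -> (1 <= k)%nat ->
     (k <= life w)%nat -> (k <= life w')%nat -> s * 2 ^ k < rho w w') /\
  (forall w, In w Q -> (life w < H)%nat ->
     In (par w) Q /\ (life w < life (par w))%nat /\
     rho w (par w) <= s * 2 ^ S (life w)).

(** Induction on [H]: a greedy net of spacing [s * 2 ^ S H] among the points alive at level [H] is
    promoted, and every other such point takes a covering net point as its parent. Separation starts
    at level 1 because [Q] may contain points at distance zero. *)
Lemma net_hierarchy_exists {X} (rho : X -> X -> R) (s : R) (Q : list X) (H : nat) :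
  pseudo_metric rho -> 0 < s ->
  exists life par, net_hierarchy rho s Q H life par.
Proof.
  intros Hm Hs. induction H as [|H (life & par & Hle & Hsep & Hpar)].
  - exists (fun _ => 0%nat), (fun w => w). repeat split; intros; try lia.
  - set (top := filter (fun w => Nat.eqb (life w) H) Q).
    assert (Htop : forall w, In w top <-> In w Q /\ life w = H).
    { intro w; unfold top; rewrite filter_In, Nat.eqb_eq; tauto. }
    assert (Hpos : forall k, 0 < s * 2 ^ k).
    { intro k; apply Rmult_lt_0_compat; auto; apply pow_lt; lra. }
    destruct (greedy_net rho top (s * 2 ^ S H) Hm) as (B & HB & HBsep & HBcov).
    { left; auto. }
    set (life' := fun w => if excluded_middle_informative (In w B) then S H else life w).
    assert (Hin : forall w, In w B -> life' w = S H /\ life w = H /\ In w Q).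
    { intros w Hw. unfold life'. destruct excluded_middle_informative; try easy.
      split; auto. specialize (HB _ Hw). rewrite Htop in HB. tauto. }
    assert (Hout : forall w, ~ In w B -> life' w = life w).
    { intros w Hw. unfold life'. destruct excluded_middle_informative; easy. }
    assert (Hge : forall w, (life w <= life' w)%nat).
    { intro w; destruct (classic (In w B)) as [Hw|Hw].
      - destruct (Hin w Hw) as (E1 & E2 & _); lia.
      - rewrite Hout; auto. }
    assert (Hchoice : forall w, exists v, In w top -> In v B /\ rho w v <= s * 2 ^ S H).
    { intro w. destruct (classic (In w top)) as [Hw|Hw].
      - destruct (HBcov w Hw) as (v & Hv); exists v; auto.
      - exists w; tauto. }
    apply choice in Hchoice. destruct Hchoice as [cov Hcov'].
    exists life', (fun w => if Nat.eqb (life w) H then cov w else par w).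
    repeat split.
    + intros w Hw. destruct (classic (In w B)) as [Hb|Hb].
      * destruct (Hin w Hb) as (E1 & _); lia.
      * rewrite Hout; auto; specialize (Hle w Hw); lia.
    + intros w w' k Hw Hw' Hne Hk H1 H2.
      destruct (Nat.eq_dec k (S H)) as [->|Hk'].
      * apply HBsep; auto; apply NNPP; intro Hb; rewrite Hout in * by auto.
        -- specialize (Hle w Hw); lia.
        -- specialize (Hle w' Hw'); lia.
      * assert (Hk2 : (k <= H)%nat).
        { assert (life' w <= S H)%nat; [|lia].
          destruct (classic (In w B)) as [Hb|Hb].
          - destruct (Hin w Hb) as (E1 & _); lia.
          - rewrite Hout; auto; specialize (Hle w Hw); lia. }
        assert (Hlow : forall v, (k <= life' v)%nat -> (k <= life v)%nat).
        { intros v Hv. destruct (classic (In v B)) as [Hb|Hb].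
          - destruct (Hin v Hb) as (_ & E2 & _); lia.
          - rewrite Hout in Hv; auto. }
        apply Hsep; auto.
    + destruct (Nat.eqb_spec (life w) H) as [E|E].
      * assert (Hw : In w top) by (apply Htop; auto).
        destruct (Hcov' w Hw) as [Hv _]. apply Hin in Hv; tauto.
      * apply Hpar; auto. specialize (Hle w H0); lia.
    + assert (Hw : ~ In w B) by (intro Hb; apply Hin in Hb; lia).
      rewrite (Hout w Hw) in *.
      destruct (Nat.eqb_spec (life w) H) as [E|E].
      * assert (Hw' : In w top) by (apply Htop; auto).
        destruct (Hcov' w Hw') as [Hv _]. apply Hin in Hv; lia.
      * destruct (Hpar w H0) as (_ & E1 & _); [specialize (Hle w H0); lia|].
        specialize (Hge (par w)); lia.
    + assert (Hw : ~ In w B) by (intro Hb; apply Hin in Hb; lia).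
      rewrite (Hout w Hw) in *.
      destruct (Nat.eqb_spec (life w) H) as [E|E].
      * assert (Hw' : In w top) by (apply Htop; auto).
        destruct (Hcov' w Hw') as [_ Hv]. rewrite E; auto.
      * apply Hpar; auto. specialize (Hle w H0); lia.
Qed.

(** Parent steps double in length, so their total is a geometric series: [2 * (s * 2 ^ k)] plus one
    step of [s * 2 ^ S k] is exactly [2 * (s * 2 ^ S k)]. *)
Lemma net_ancestor {X} (rho : X -> X -> R) s Q H life par :
  pseudo_metric rho -> 0 < s -> net_hierarchy rho s Q H life par ->
  forall E, (forall w, In w Q -> In (w, par w) E) ->
  forall p k, In p Q -> (k <= H)%nat ->
  exists w, In w Q /\ (k <= life w)%nat /\ rho p w <= 2 * (s * 2 ^ k) /\
    conn rho E p w (2 * (s * 2 ^ k)).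
Proof.
  intros Hm Hs (Hle & _ & Hpar) E HE p k Hp. induction k as [|k IH]; intro Hk.
  - exists p; repeat split; auto; [lia| |apply conn_refl; simpl; lra].
    destruct Hm as (H0 & _). rewrite H0; simpl; lra.
  - destruct IH as (w & Hw & Hkw & Hd & Hc); [lia|].
    assert (0 < 2 ^ k) by (apply pow_lt; lra).
    assert (0 < s * 2 ^ k) by (apply Rmult_lt_0_compat; auto).
    destruct (Nat.eq_dec (life w) k) as [Ek|Ek].
    + destruct (Hpar w Hw) as (P1 & P2 & P3); [lia|].
      rewrite Ek in *. simpl in *.
      exists (par w); repeat split; auto.
      * destruct Hm as (_ & _ & _ & Ht). specialize (Ht p w (par w)). lra.
      * eapply conn_mono.
        { eapply conn_trans; [exact Hc|]. apply conn_edge; auto. apply P3. }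
        lra.
    + exists w; repeat split; auto; [lia| |eapply conn_mono; [exact Hc|]]; simpl; lra.
Qed.

Lemma length_flat_map_const {A B} (f : A -> list B) (c : nat) (l : list A) :
  (forall a, In a l -> length (f a) = c) -> length (flat_map f l) = (length l * c)%nat.
Proof.
  induction l as [|a l IH]; simpl; intro Hf; auto.
  rewrite length_app, Hf, IH; auto.
Qed.

Lemma length_flat_map_le {A B} (f : A -> list B) (c : R) (l : list A) :
  (forall a, In a l -> INR (length (f a)) <= c) ->
  INR (length (flat_map f l)) <= INR (length l) * c.
Proof.
  induction l as [|a l IH]; cbn [flat_map length]; intro Hf; [simpl; lra|].
  rewrite length_app, plus_INR, S_INR.
  assert (INR (length (f a)) <= c) by (apply Hf; left; auto).
  assert (INR (length (flat_map f l)) <= INR (length l) * c)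
    by (apply IH; intros; apply Hf; right; auto).
  lra.
Qed.

(* If [w] is not about to die, then separation at level [k + L + 1] makes [w] the only surviving
   point close to [w'], and [w'] is about to die: the pair [(w, k)] is charged to [w']. *)
Lemma active_nodes {X} (rho : X -> X -> R) s Q H life par (L : nat) :
  pseudo_metric rho -> 0 < s -> net_hierarchy rho s Q H life par ->
  exists Act : list (X * nat),
    length Act = (length Q * (2 * S L))%nat /\
    (forall w k, In (w, k) Act -> In w Q) /\
    forall w w' k, In w Q -> In w' Q -> w <> w' ->
      (k <= life w)%nat -> (k <= life w')%nat -> rho w w' <= s * 2 ^ (k + L) ->
      In (w, k) Act.
Proof.
  intros (H0 & Hsym & Hpos & Htri) Hs (Hle & Hsep & Hpar).
  (* [u (q, k)] is a point close to [q] that outlives level [k + L], if there is one; otherwise only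
     its membership in [Q] matters. *)
  assert (Hu : forall qk : X * nat, exists u, In (fst qk) Q -> In u Q /\
     ((exists w, In w Q /\ (snd qk + L < life w)%nat /\
        rho w (fst qk) <= s * 2 ^ (snd qk + L)) ->
      (snd qk + L < life u)%nat /\ rho u (fst qk) <= s * 2 ^ (snd qk + L))).
  { intros [q k]; simpl.
    destruct (classic (exists w, In w Q /\ (k + L < life w)%nat /\
        rho w q <= s * 2 ^ (k + L))) as [(w & Hw)|Hn].
    - exists w; tauto.
    - exists q; tauto. }
  apply choice in Hu. destruct Hu as [u Hu].
  (* The levels from [life q - L] to [life q]. Truncated subtraction may repeat level 0, which keeps
     the length at exactly [S L]. *)
  set (ks := fun q => map (fun i => (life q - i)%nat) (seq 0 (S L))).
  assert (Hks : forall q k, (k <= life q)%nat -> (life q <= k + L)%nat -> In k (ks q)).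
  { intros q k H1 H2. unfold ks. apply in_map_iff.
    exists (life q - k)%nat. rewrite in_seq. lia. }
  exists (flat_map (fun q => map (fun k => (q, k)) (ks q) ++
                             map (fun k => (u (q, k), k)) (ks q)) Q).
  split; [|split].
  - apply length_flat_map_const. intros q _. unfold ks.
    rewrite length_app, !length_map, length_seq. lia.
  - intros w k Hin. apply in_flat_map in Hin. destruct Hin as (q & Hq & Hin).
    apply in_app_iff in Hin. rewrite !in_map_iff in Hin.
    destruct Hin as [(k' & [=] & _)|(k' & [=] & _)]; subst; auto.
    apply (Hu (q, k)); auto.
  - intros w w' k Hw Hw' Hne H1 H2 Hd. apply in_flat_map.
    destruct (le_lt_dec (life w) (k + L)) as [Hl|Hl].
    + exists w; split; auto. apply in_app_iff; left. apply in_map; auto.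
    + exists w'; split; auto. apply in_app_iff; right. apply in_map_iff.
      exists k. destruct (Hu (w', k) Hw') as [Hu1 Hu2]. simpl in *.
      destruct Hu2 as [Hu2 Hu3]; [exists w; auto|].
      assert (Hpw : s * 2 ^ S (k + L) = 2 * (s * 2 ^ (k + L))) by (simpl; ring).
      assert (0 < s * 2 ^ (k + L)) by (apply Rmult_lt_0_compat; auto; apply pow_lt; lra).
      split.
      * f_equal. apply NNPP; intro Hn.
        assert (s * 2 ^ S (k + L) < rho (u (w', k)) w) by (apply Hsep; auto; lia).
        specialize (Htri (u (w', k)) w' w). rewrite (Hsym w' w) in Htri. lra.
      * apply Hks; auto. destruct (le_lt_dec (life w') (k + L)) as [|Hl']; auto.
        assert (s * 2 ^ S (k + L) < rho w w') by (apply Hsep; auto; lia). lra.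
Qed.

Lemma exists_pow2_ge (x : R) : exists n : nat, x <= 2 ^ n.
Proof.
  destruct (Pow_x_infinity 2) with (b := x) as [n Hn].
  - rewrite Rabs_right; lra.
  - exists n. specialize (Hn n (Nat.le_refl n)).
    rewrite Rabs_right in Hn; [lra|]. apply Rle_ge, pow_le; lra.
Qed.

Lemma dyadic_level (s x : R) (H : nat) :
  0 < s -> s <= x < s * 2 ^ H ->
  exists k, (k < H)%nat /\ s * 2 ^ k <= x < s * 2 ^ S k.
Proof.
  intros Hs. induction H as [|H IH]; simpl; intros [H1 H2]; [lra|].
  destruct (Rlt_le_dec x (s * 2 ^ H)) as [Hlt|Hge].
  - destruct IH as (k & Hk & Hx); auto. exists k; split; [lia|auto].
  - exists H; split; [lia|]; simpl; lra.
Qed.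

Lemma finite_lower_bound {A} (f : A -> R) (l : list A) :
  (forall a, In a l -> 0 < f a) -> exists m, 0 < m /\ forall a, In a l -> m <= f a.
Proof.
  induction l as [|a l IH]; intro Hf.
  - exists 1; split; [lra|easy].
  - destruct IH as (m & Hm & Hl); [intros; apply Hf; right; auto|].
    exists (Rmin m (f a)); split.
    + apply Rmin_glb_lt; auto. apply Hf; left; auto.
    + intros b [->|Hb]; [apply Rmin_r|]. eapply Rle_trans; [apply Rmin_l|auto].
Qed.

Lemma finite_upper_bound {A} (f : A -> R) (l : list A) :
  exists m, 0 < m /\ forall a, In a l -> f a <= m.
Proof.
  induction l as [|a l (m & Hm & Hl)].
  - exists 1; split; [lra|easy].
  - exists (Rmax m (f a)); split.
    + eapply Rlt_le_trans; [exact Hm|apply Rmax_l].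
    + intros b [->|Hb]; [apply Rmax_r|]. eapply Rle_trans; [apply Hl; auto|apply Rmax_l].
Qed.

(** The window from [r] to [8 * r] absorbs the change of distance when both ends are rounded to net
    points, and [R0] lets the two-hop lists be valid for short distances only. One factor [1 + eps]
    pays for the rounding, the other for the bend. The count is one parent edge per point and [K]
    edges per active pair. *)
Theorem local_spanner {X} (d : X -> X -> R) (eps R0 K : R) (L : nat)
  (Z : R -> X -> list X) :
  pseudo_metric d -> 0 < eps <= 1 -> 24 / eps <= 2 ^ L -> 0 <= K ->
  (forall r p, 0 < r -> INR (length (Z r p)) <= K) ->
  (forall r p q, 0 < r -> r <= R0 -> r <= d p q <= 8 * r -> d p q <= 2 * R0 ->
     exists z, In z (Z r p) /\ In z (Z r q) /\ d p z + d z q <= (1 + eps) * d p q) ->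
  forall Q, exists E,
    INR (length E) <= INR (length Q) * (1 + 2 * (INR L + 1) * K) /\
    forall p q, In p Q -> In q Q -> 0 < d p q <= R0 ->
      conn d E p q ((1 + eps) * (1 + eps) * d p q).
Proof.
  intros Hm He HL HK HZ Hhop Q.
  pose proof Hm as (Hd0 & Hsym & Hpos & Htri).
  (* A pair at distance [D >= M * sk] is rounded at net spacing [sk]; the rounding adds at most
     [8 * sk] before the bend factor, and this is at most [eps * D]. *)
  set (M := 8 / eps).
  assert (HM : 8 <= M).
  { unfold M. apply Rmult_le_reg_r with eps; [lra|]. field_simplify; lra. }
  assert (HMe : M * eps = 8) by (unfold M; field; lra).
  assert (HL' : 3 * M <= 2 ^ L) by (replace (3 * M) with (24 / eps) by (unfold M; field; lra); auto).
  (* Pairs at distance zero are filtered out, so [m] is positive; [s = m / M] then makes level 0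
     fine enough for the closest remaining pair. *)
  destruct (finite_lower_bound (fun e : X * X => d (fst e) (snd e))
    (filter (fun e => if Rlt_dec 0 (d (fst e) (snd e)) then true else false)
       (list_prod Q Q))) as (m & Hm0 & Hmin).
  { intros e He'. apply filter_In in He'. destruct (Rlt_dec 0 _); [auto|easy]. }
  destruct (finite_upper_bound (fun e : X * X => d (fst e) (snd e)) (list_prod Q Q))
    as (mx & Hmx0 & Hmax).
  set (s := m / M).
  assert (Hs : 0 < s) by (unfold s; apply Rdiv_lt_0_compat; lra).
  assert (HsM : s * M = m) by (unfold s; field; lra).
  destruct (exists_pow2_ge (2 * mx / m)) as [H HH].
  destruct (net_hierarchy_exists d s Q H Hm Hs) as (life & par & Hnet).
  destruct (active_nodes d s Q H life par L Hm Hs Hnet) as (Act & HAlen & HAin & HA).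
  set (E1 := map (fun w => (w, par w)) Q).
  set (E2 := flat_map (fun wk : X * nat =>
     map (fun z => (fst wk, z)) (Z (M * (s * 2 ^ snd wk) / 2) (fst wk))) Act).
  exists (E1 ++ E2). split.
  - rewrite length_app, plus_INR. unfold E1 at 1. rewrite length_map.
    assert (INR (length E2) <= INR (length Act) * K).
    { apply length_flat_map_le. intros wk _. rewrite length_map. apply HZ.
      assert (0 < 2 ^ snd wk) by (apply pow_lt; lra).
      assert (0 < s * 2 ^ snd wk) by (apply Rmult_lt_0_compat; auto). nra. }
    rewrite HAlen, !mult_INR, (S_INR L) in H0.
    change (INR 2) with 2 in H0. lra.
  - intros p q Hp Hq [HD0 HDR].
    assert (Hpq : In (p, q) (list_prod Q Q)) by (apply in_prod; auto).
    assert (Hlow : m <= d p q).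
    { apply (Hmin (p, q)). apply filter_In; split; auto. simpl.
      destruct (Rlt_dec 0 (d p q)); auto. }
    assert (Hup : d p q <= mx) by (apply (Hmax (p, q)); auto).
    destruct (dyadic_level m (d p q) H Hm0) as (k & Hk & Hk1 & Hk2).
    { split; auto. apply Rlt_le_trans with (2 * mx); [lra|].
      replace (2 * mx) with (m * (2 * mx / m)) by (field; lra).
      apply Rmult_le_compat_l; lra. }
    set (sk := s * 2 ^ k).
    assert (Hsk : 0 < sk) by (apply Rmult_lt_0_compat; auto; apply pow_lt; lra).
    assert (B1 : M * sk <= d p q) by (unfold sk; rewrite <- HsM in Hk1; lra).
    assert (B2 : d p q < 2 * (M * sk)) by (unfold sk; rewrite <- HsM in Hk2; simpl in Hk2; lra).
    assert (HEi : forall w, In w Q -> In (w, par w) (E1 ++ E2)).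
    { intros w Hw. apply in_app_iff; left. unfold E1.
      apply (in_map (fun w => (w, par w))); auto. }
    destruct (net_ancestor d s Q H life par Hm Hs Hnet _ HEi p k Hp) as (p' & Hp' & Lp & Dp & Cp); [lia|].
    destruct (net_ancestor d s Q H life par Hm Hs Hnet _ HEi q k Hq) as (q' & Hq' & Lq & Dq & Cq); [lia|].
    fold sk in Dp, Cp, Dq, Cq.
    assert (T1 : d p q <= d p' q' + 4 * sk).
    { pose proof (Htri p p' q). pose proof (Htri p' q' q). rewrite (Hsym q' q) in *. lra. }
    assert (T2 : d p' q' <= d p q + 4 * sk).
    { pose proof (Htri p' p q'). pose proof (Htri p q q'). rewrite (Hsym p' p) in *. lra. }
    assert (8 * sk <= M * sk) by (apply Rmult_le_compat_r; lra).
    destruct (Hhop (M * sk / 2) p' q') as (z & Z1 & Z2 & Z3); try lra.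
    assert (Hne : p' <> q') by (intros ->; rewrite Hd0 in T1; lra).
    (* The rounded pair is at distance at most [3 * M * sk]; the hypothesis [24 / eps <= 2 ^ L]
       places this within [L] levels, so both nodes are active. *)
    assert (Hclose : d p' q' <= s * 2 ^ (k + L)).
    { rewrite pow_add, <- Rmult_assoc. fold sk.
      assert (sk * (3 * M) <= sk * 2 ^ L) by (apply Rmult_le_compat_l; lra). lra. }
    assert (A1 : In (p', k) Act) by (apply (HA p' q' k); auto).
    assert (A2 : In (q', k) Act).
    { apply (HA q' p' k); auto. rewrite Hsym; auto. }
    assert (In (p', z) (E1 ++ E2)).
    { apply in_app_iff; right. apply in_flat_map. exists (p', k); split; auto.
      apply (in_map (fun z => (p', z))); auto. }
    assert (In (q', z) (E1 ++ E2)).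
    { apply in_app_iff; right. apply in_flat_map. exists (q', k); split; auto.
      apply (in_map (fun z => (q', z))); auto. }
    eapply conn_mono.
    { eapply conn_trans; [exact Cp|].
      eapply conn_trans; [apply conn_edge; [eassumption|apply Rle_refl]|].
      eapply conn_trans; [|apply conn_sym; [auto|exact Cq]].
      apply conn_sym; auto. apply conn_edge; [eassumption|apply Rle_refl]. }
    rewrite (Hsym q' z).
    assert (8 * sk <= eps * d p q).
    { rewrite <- HMe, Rmult_comm, (Rmult_comm M), <- Rmult_assoc, (Rmult_comm sk).
      rewrite Rmult_assoc. apply Rmult_le_compat_l; lra. }
    assert ((1 + eps) * d p' q' <= (1 + eps) * (d p q + 4 * sk))
      by (apply Rmult_le_compat_l; lra).
    assert (4 * sk <= (1 + eps) * (4 * sk)).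
    { assert (0 <= eps * (4 * sk)) by (apply Rmult_le_pos; lra). lra. }
    assert ((1 + eps) * (8 * sk) <= (1 + eps) * (eps * d p q))
      by (apply Rmult_le_compat_l; lra).
    lra.
Qed.

(** * Hyperbolic functions and the upper half-space *)

Lemma max_of_three a b c :
  exists T, a <= T /\ b <= T /\ c <= T /\ (T = a \/ T = b \/ T = c).
Proof.
  exists (Rmax a (Rmax b c)). unfold Rmax.
  destruct (Rle_dec b c), (Rle_dec a _); repeat split; auto; lra.
Qed.

Lemma cosh_ge_1 x : 1 <= cosh x.
Proof.
  unfold cosh. assert (exp x * exp (- x) = 1) by (rewrite <- exp_plus, Rplus_opp_r; apply exp_0).
  pose proof (exp_pos x). pose proof (exp_pos (- x)).
  pose proof (Rle_0_sqr (exp x - exp (- x))). unfold Rsqr in *.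
  assert (2 <= exp x + exp (- x)); [apply Rnot_lt_le; intro; nra | lra].
Qed.

Lemma sinh_lower x : 0 <= x -> x <= sinh x.
Proof.
  intros [Hx|<-]; [|rewrite sinh_0; lra].
  destruct (MVT_cor2 sinh cosh 0 x Hx) as (c & Hc & _).
  { intros; apply derivable_pt_lim_sinh. }
  rewrite sinh_0 in Hc. pose proof (cosh_ge_1 c). nra.
Qed.

Lemma cosh_opp x : cosh (- x) = cosh x.
Proof. unfold cosh. rewrite Ropp_involutive. lra. Qed.

Lemma sinh_opp x : sinh (- x) = - sinh x.
Proof. unfold sinh. rewrite Ropp_involutive. lra. Qed.

Lemma cosh_plus x y : cosh (x + y) = cosh x * cosh y + sinh x * sinh y.
Proof. unfold cosh, sinh. rewrite Ropp_plus_distr, !exp_plus. field. Qed.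

Lemma sinh_plus x y : sinh (x + y) = sinh x * cosh y + cosh x * sinh y.
Proof. unfold cosh, sinh. rewrite Ropp_plus_distr, !exp_plus. field. Qed.

Lemma cosh_sinh x : cosh x * cosh x - sinh x * sinh x = 1.
Proof.
  unfold cosh, sinh. assert (exp x * exp (- x) = 1) by (rewrite <- exp_plus, Rplus_opp_r; apply exp_0).
  lra.
Qed.

(** Convexity, from [1 + y <= exp y] applied to both exponentials. It converts a bound on [cosh] of
    a distance into a bound on the distance itself. *)
Lemma cosh_tangent a x : cosh a + x * sinh a <= cosh (a + x).
Proof.
  unfold cosh, sinh. rewrite Ropp_plus_distr, !exp_plus.
  pose proof (exp_ineq1_le x). pose proof (exp_ineq1_le (- x)).
  pose proof (exp_pos a). pose proof (exp_pos (- a)). nra.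
Qed.

Lemma cosh_incr x y : 0 <= x <= y -> cosh x <= cosh y.
Proof.
  intros Hx. pose proof (cosh_tangent x (y - x)). pose proof (sinh_lower x).
  replace (x + (y - x)) with y in H by ring. nra.
Qed.

Lemma cosh_strict_incr x y : 0 <= x < y -> cosh x < cosh y.
Proof.
  intros Hx. set (m := (x + y) / 2).
  pose proof (cosh_tangent m (y - m)). pose proof (sinh_lower m).
  assert (cosh x <= cosh m) by (apply cosh_incr; unfold m; lra).
  replace (m + (y - m)) with y in H by ring.
  assert (x < m < y) by (unfold m; lra). nra.
Qed.

Lemma cosh_le_inv x y : 0 <= y -> cosh x <= cosh y -> x <= y.
Proof.
  intros Hy Hc. apply Rnot_lt_le; intro Hlt.
  pose proof (cosh_strict_incr y x). lra.
Qed.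

Lemma cosh_half x : cosh x = 1 + 2 * (sinh (x / 2) * sinh (x / 2)).
Proof.
  replace x with (x / 2 + x / 2) at 1 by field. rewrite cosh_plus.
  pose proof (cosh_sinh (x / 2)). lra.
Qed.

Lemma cosh_lower x : 0 <= x -> 1 + x * x / 2 <= cosh x.
Proof.
  intro Hx. rewrite cosh_half. pose proof (sinh_lower (x / 2)). nra.
Qed.

Lemma cosh_1_bound : cosh 1 <= 7 / 4.
Proof.
  unfold cosh. rewrite exp_Ropp. pose proof exp_le_3. pose proof (exp_ineq1_le 1).
  assert (/ exp 1 <= / 2) by (apply Rinv_le_contravar; lra). lra.
Qed.

Lemma cosh_upper x : 0 <= x <= 1 -> cosh x - 1 <= x * x.
Proof.
  intros [Hx H1]. rewrite cosh_half.
  assert (Hs : 0 <= sinh (x / 2) <= x / 2 * cosh (1 / 2)).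
  { split; [pose proof (sinh_lower (x / 2)); lra|].
    destruct Hx as [Hx|<-].
    - destruct (MVT_cor2 sinh cosh 0 (x / 2)) as (c & Hc & Hc'); [lra| |].
      { intros; apply derivable_pt_lim_sinh. }
      rewrite sinh_0 in Hc. assert (cosh c <= cosh (1 / 2)) by (apply cosh_incr; lra). nra.
    - unfold Rdiv. rewrite !Rmult_0_l, sinh_0; lra. }
  pose proof (cosh_half 1). pose proof (cosh_sinh (1 / 2)). pose proof cosh_1_bound.
  assert (cosh (1/2) * cosh (1/2) <= 2) by lra.
  assert (sinh (x / 2) * sinh (x / 2) <= (x / 2 * cosh (1 / 2)) * (x / 2 * cosh (1 / 2)))
    by (apply Rmult_le_compat; lra).
  nra.
Qed.

Lemma cosh_ln x : 0 < x -> cosh (ln x) = (x + / x) / 2.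
Proof. intro. unfold cosh. rewrite exp_Ropp, exp_ln; auto. Qed.

Lemma sinh_ln x : 0 < x -> sinh (ln x) = (x - / x) / 2.
Proof. intro. unfold sinh. rewrite exp_Ropp, exp_ln; auto. Qed.

Lemma ln_nonneg x : 1 <= x -> 0 <= ln x.
Proof. intros [H| <-]; [left; rewrite <- ln_1; apply ln_increasing; lra|rewrite ln_1; lra]. Qed.

Lemma ln_le_compat x y : 0 < x -> x <= y -> ln x <= ln y.
Proof. intros Hx [H| ->]; [left; apply ln_increasing; auto|lra]. Qed.

Lemma ln_div x y : 0 < x -> 0 < y -> ln (x / y) = ln x - ln y.
Proof.
  intros Hx Hy. unfold Rdiv. rewrite ln_mult, ln_Rinv by (auto using Rinv_0_lt_compat). lra.
Qed.

(* Upper half-space coordinates: [hx] is the horizontal distance, [yy] the height. *)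
Definition half_space {X : Type} (d hx : X -> X -> R) (yy : X -> R) : Prop :=
  pseudo_metric d /\ pseudo_metric hx /\ (forall p, 0 < yy p) /\
  forall p q, cosh (d p q) = (hx p q * hx p q + yy p * yy p + yy q * yy q) / (2 * yy p * yy q).

(** With [r] the height ratio, the horizontal shift adds at most [2 * eps * r] to [cosh (ln r)].
    Since [r >= 2], [6 * eps * sinh (ln r)] covers this, so the tangent bound costs an additive
    [6 * eps]; [ln r >= 1 / 2] makes that relative. *)
Lemma vertical_jump {X} (d hx : X -> X -> R) yy eps p q :
  half_space d hx yy -> 0 < eps -> 2 * yy p <= yy q ->
  hx p q * hx p q <= 4 * eps * (yy q * yy q) ->
  d p q <= (1 + 12 * eps) * ln (yy q / yy p).
Proof.
  intros (_ & _ & Hy & Hd) He H2 Hx.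
  pose proof (Hy p) as Yp. pose proof (Hy q) as Yq.
  set (r := yy q / yy p). assert (Hr : yy q = r * yy p) by (unfold r; field; lra).
  assert (Hr2 : 2 <= r) by (apply Rmult_le_reg_r with (yy p); lra).
  assert (Hl : 1 / 2 <= ln r).
  { pose proof ln_lt_2. pose proof (ln_le_compat 2 r). lra. }
  apply Rle_trans with (ln r + 6 * eps); [|nra].
  apply cosh_le_inv; [lra|].
  eapply Rle_trans; [|apply cosh_tangent].
  rewrite Hd, cosh_ln, sinh_ln by lra.
  assert (Hi : / r <= / 2) by (apply Rinv_le_contravar; lra).
  assert (Hi0 : 0 < / r) by (apply Rinv_0_lt_compat; lra).
  assert (E : (hx p q * hx p q + yy p * yy p + yy q * yy q) / (2 * yy p * yy q) =
     (r + / r) / 2 + hx p q * hx p q / (2 * yy p * yy q)).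
  { rewrite Hr. field. lra. }
  rewrite E. apply Rplus_le_compat_l.
  apply Rle_trans with (4 * eps * (yy q * yy q) / (2 * yy p * yy q)).
  { apply Rmult_le_compat_r; auto. left. apply Rinv_0_lt_compat. nra. }
  replace (4 * eps * (yy q * yy q) / (2 * yy p * yy q)) with (2 * eps * r)
    by (rewrite Hr; field; lra).
  nra.
Qed.

Lemma vertical_distance {X} (d hx : X -> X -> R) yy p q :
  half_space d hx yy -> yy p <= yy q -> hx p q = 0 -> d p q <= ln (yy q / yy p).
Proof.
  intros (_ & _ & Hy & Hd) H2 Hx.
  pose proof (Hy p) as Yp. pose proof (Hy q) as Yq.
  assert (1 <= yy q / yy p) by (apply Rmult_le_reg_r with (yy p); [lra|field_simplify; lra]).
  apply cosh_le_inv; [apply ln_nonneg; auto|].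
  rewrite Hd, Hx, cosh_ln by lra. right. field. lra.
Qed.

(* For points that are far apart, [exp d] is [(hx^2 + y^2 + y'^2) / (y y')] up to a factor
   [1 + O(eps)], so moving an endpoint up to height [gam] costs exactly the vertical distance. *)
Lemma climbed_distance {X} (d hx : X -> X -> R) yy eps gam T p q u v :
  half_space d hx yy -> 0 < eps <= 1 -> 0 < gam -> 64 * gam <= eps * T ->
  hx p q <= T -> yy p <= T -> yy q <= T ->
  T * T <= hx p q * hx p q + yy p * yy p + yy q * yy q ->
  hx u v <= hx p q + 4 * gam ->
  (yy u = yy p \/ yy u = gam) -> (yy v = yy q \/ yy v = gam) ->
  (yy p <= gam \/ yy q <= gam) ->
  ln (yy u / yy p) + ln (yy v / yy q) + d u v <= d p q + 2 * eps.
Proof.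
  intros (Hm & Hmx & Hy & Hd) He Hg HgT HxT HpT HqT HT Hx Hu Hv Hlow.
  pose proof (Hy p) as Yp. pose proof (Hy q) as Yq.
  pose proof (Hy u) as Yu. pose proof (Hy v) as Yv.
  assert (Hx0 : 0 <= hx u v) by (apply Hmx).
  assert (Hxp : 0 <= hx p q) by (apply Hmx).
  assert (Hduv : 0 <= d u v) by (apply Hm).
  assert (Hdpq : 0 <= d p q) by (apply Hm).
  assert (HT0 : 0 < T) by lra.
  set (S := hx p q * hx p q + yy p * yy p + yy q * yy q) in *.
  set (S' := hx u v * hx u v + yy u * yy u + yy v * yy v).
  assert (Hgam : gam <= eps * T / 64) by lra.
  assert (HgT' : gam <= T) by nra.
  (* Raising the ends to [gam] and shifting by [4 * gam] changes the numerator by a bounded multiple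
     of [gam * T], and [gam <= eps * T / 64]. *)
  assert (HSS : S' <= S * (1 + eps)).
  { assert (hx u v * hx u v <= (hx p q + 4 * gam) * (hx p q + 4 * gam))
      by (apply Rmult_le_compat; lra).
    assert (yy u * yy u <= yy p * yy p + gam * gam) by (destruct Hu as [->| ->]; nra).
    assert (yy v * yy v <= yy q * yy q + gam * gam) by (destruct Hv as [->| ->]; nra).
    assert (hx p q * gam <= T * (eps * T / 64)) by (apply Rmult_le_compat; lra).
    assert (gam * gam <= T * (eps * T / 64)) by (apply Rmult_le_compat; lra).
    assert (eps * (T * T) <= eps * S) by (apply Rmult_le_compat_l; lra).
    assert (0 <= eps * (T * T)) by (apply Rmult_le_pos; nra).
    unfold S' in *. unfold S in *. lra. }
  assert (HS : 0 < S) by nra.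
  assert (HS' : 0 < S') by (unfold S'; nra).
  (* [A / 2] is [cosh (d p q)]. One end lies at height at most [gam], which forces [A >= 64 / eps];
     replacing [cosh] by half the exponential then costs at most [eps]. The other [eps] of the
     conclusion comes from [HSS]. *)
  set (A := S / (yy p * yy q)).
  assert (HA : 64 / eps <= A).
  { unfold A. apply Rmult_le_reg_r with (yy p * yy q); [nra|].
    replace (S / (yy p * yy q) * (yy p * yy q)) with S by (field; lra).
    assert (yy p * yy q <= gam * T).
    { destruct Hlow; [apply Rmult_le_compat; lra|rewrite Rmult_comm; apply Rmult_le_compat; lra]. }
    assert (gam * T <= eps * T / 64 * T) by (apply Rmult_le_compat_r; lra).
    apply Rle_trans with (64 / eps * (eps * T / 64 * T)).
    - apply Rmult_le_compat_l; [|lra]. left; apply Rdiv_lt_0_compat; lra.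
    - replace (64 / eps * (eps * T / 64 * T)) with (T * T) by (field; lra). auto. }
  assert (HA64 : 64 <= A).
  { apply Rle_trans with (64 / eps); auto. apply Rmult_le_reg_r with eps; [lra|].
    field_simplify; lra. }
  assert (HcA : cosh (d p q) = A / 2).
  { rewrite Hd. fold S. unfold A. field. lra. }
  assert (L1 : ln A - eps <= d p q).
  { rewrite <- (ln_exp (d p q)). rewrite <- (ln_exp eps) at 1.
    rewrite <- ln_div; [|lra|apply exp_pos].
    apply ln_le_compat; [apply Rdiv_lt_0_compat; [lra|apply exp_pos]|].
    pose proof (exp_ineq1_le eps).
    apply Rmult_le_reg_r with (exp eps); [apply exp_pos|].
    unfold Rdiv. rewrite Rmult_assoc, Rinv_l, Rmult_1_r by (pose proof (exp_pos eps); lra).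
    pose proof (exp_pos (d p q)) as E0.
    unfold cosh in HcA.
    assert (E1 : exp (- d p q) <= 1).
    { rewrite <- exp_0. destruct Hdpq as [Hl|<-]; [left; apply exp_increasing; lra|].
      rewrite Ropp_0; lra. }
    assert (E2 : A - 1 <= exp (d p q)) by lra.
    assert (E3 : 1 <= eps * (A - 1)).
    { assert (eps * (64 / eps) <= eps * A) by (apply Rmult_le_compat_l; lra).
      replace (eps * (64 / eps)) with 64 in * by (field; lra). lra. }
    nra. }
  assert (L2 : d u v <= ln (S' / (yy u * yy v))).
  { rewrite <- (ln_exp (d u v)) at 1. apply ln_le_compat; [apply exp_pos|].
    assert (cosh (d u v) = S' / (yy u * yy v) / 2) by (rewrite Hd; fold S'; field; lra).
    unfold cosh in *. pose proof (exp_pos (- d u v)). lra. }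
  assert (L3 : ln (S' / (yy u * yy v)) + ln (yy u / yy p) + ln (yy v / yy q) <= ln A + eps).
  { unfold A. rewrite !ln_div, !ln_mult by nra.
    assert (ln S' <= ln S + eps); [|lra].
    assert (ln S' <= ln (S * (1 + eps))) by (apply ln_le_compat; auto).
    rewrite ln_mult in * by lra.
    assert (ln (1 + eps) <= ln (exp eps)) by (apply ln_le_compat; [lra|apply exp_ineq1_le]).
    rewrite ln_exp in *. lra. }
  lra.
Qed.

(** * Long distances in hyperbolic space *)

Lemma largest_below (P : nat -> Prop) (k : nat) :
  (exists j, (j < k)%nat /\ P j) ->
  exists j, (j < k)%nat /\ P j /\ forall i, (i < k)%nat -> P i -> (i <= j)%nat.
Proof.
  induction k as [|k IH]; intros (j & Hj & Pj); [lia|].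
  destruct (classic (P k)) as [Pk|Pk].
  - exists k; repeat split; auto; intros; lia.
  - assert (j <> k) by (intros ->; auto).
    destruct IH as (i & Hi & Pi & Hmax); [exists j; split; auto; lia|].
    exists i; repeat split; auto. intros i' Hi' Pi'.
    apply Hmax; auto. assert (i' <> k) by (intros ->; auto). lia.
Qed.

(** Each node is joined to the next lower node of its column, and the costs [f k - f k'] telescope.
    The lowest node of a column gets an arbitrary edge, so the count is exactly one edge per
    node. *)
Lemma vertical_chain {A X} (d : X -> X -> R) (pt : A -> nat -> X)
  (Nodes : list (A * nat)) (f : nat -> R) :
  pseudo_metric d ->
  (forall w k k', (k' <= k)%nat -> d (pt w k') (pt w k) <= f k - f k') ->
  exists E, length E = length Nodes /\
    forall w k k', In (w, k) Nodes -> In (w, k') Nodes -> (k' <= k)%nat ->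
      conn d E (pt w k') (pt w k) (f k - f k').
Proof.
  intros Hm Hd.
  assert (Hpr : forall n : A * nat, exists j,
    (exists i, (i < snd n)%nat /\ In (fst n, i) Nodes) ->
    (j < snd n)%nat /\ In (fst n, j) Nodes /\
    forall i, (i < snd n)%nat -> In (fst n, i) Nodes -> (i <= j)%nat).
  { intros [w k]; simpl.
    destruct (classic (exists i, (i < k)%nat /\ In (w, i) Nodes)) as [He|He].
    - destruct (largest_below (fun i => In (w, i) Nodes) k He) as (j & Hj).
      exists j; intros _; auto.
    - exists 0%nat; tauto. }
  apply choice in Hpr. destruct Hpr as [pr Hpr].
  exists (map (fun n => (pt (fst n) (pr n), pt (fst n) (snd n))) Nodes).
  split; [apply length_map|].
  intros w k. induction k as [k IH] using lt_wf_ind. intros k' Hk Hk' Hle.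
  destruct (Nat.eq_dec k' k) as [->|Hne].
  - apply conn_refl; lra.
  - destruct (Hpr (w, k)) as (H1 & H2 & H3); simpl in *.
    { exists k'; split; auto; lia. }
    assert (k' <= pr (w, k))%nat by (apply H3; auto; lia).
    replace (f k - f k') with ((f (pr (w, k)) - f k') + (f k - f (pr (w, k)))) by ring.
    apply conn_trans with (pt w (pr (w, k))).
    + apply IH; auto.
    + apply conn_edge; [|apply Hd; lia].
      apply in_map_iff. exists (w, k); auto.
Qed.

(* A point climbs until it is [J] levels, that is [O(log (1 / eps))] levels, below the top of the
   geodesic, and a Steiner point of the chart at the top joins the two ends. [Nodes] lists the pairs
   (net point, level) at which a climb starts, changes its net point or stops. *)
Theorem horoball_spanner {X} (d hx : X -> X -> R) (yy : X -> R) (node : X -> R -> X)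
  (eps K : R) (J : nat) (Z : R -> X -> list X) :
  half_space d hx yy ->
  (forall w h, 0 < h -> yy (node w h) = h /\ hx (node w h) w = 0) ->
  0 < eps <= 1 -> 64 / eps <= 2 ^ J -> 0 <= K ->
  (forall h p, 0 < h -> INR (length (Z h p)) <= K) ->
  (forall h p q, 0 < h -> 1 / 2 <= d p q ->
     hx p q <= 4 * h -> yy p <= 4 * h -> yy q <= 4 * h ->
     (h <= 4 * hx p q \/ h <= 4 * yy p \/ h <= 4 * yy q) ->
     exists z, In z (Z h p) /\ In z (Z h q) /\ d p z + d z q <= (1 + eps) * d p q) ->
  forall Q, exists E,
    INR (length E) <= INR (length Q) * (10 * (INR J + 1) * (K + 1)) /\
    forall p q, In p Q -> In q Q -> 1 / 2 <= d p q ->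
      conn d E p q ((1 + 12 * eps) * (1 + 4 * eps) * d p q).
Proof.
  intros HH Hnode He HJ HK HZ Hhop Q.
  pose proof HH as (Hm & Hmx & Hy & Hcosh).
  pose proof Hm as (Hd0 & Hsym & Hpos & Htri).
  pose proof Hmx as (Hx0 & Hxsym & Hxpos & Hxtri).
  assert (HJ64 : 64 <= 2 ^ J).
  { apply Rle_trans with (64 / eps); auto. apply Rmult_le_reg_r with eps; [lra|].
    field_simplify; lra. }
  destruct (finite_lower_bound yy Q) as (m & Hm0 & Hmin); [auto|].
  destruct (finite_upper_bound (fun e : X * X => hx (fst e) (snd e) + yy (fst e) + yy (snd e))
     (list_prod Q Q)) as (mx & Hmx0 & Hmax).
  destruct (exists_pow2_ge (2 * mx / m)) as [H0 HH0].
  (* Every point of [Q] then has height at level [J + 4] or above, so going down by [J] levels is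
     never truncated at 0. *)
  set (h0 := m / 2 ^ (J + 4)). set (g := fun j : nat => h0 * 2 ^ j).
  assert (Hp2 : forall j : nat, 0 < 2 ^ j) by (intro; apply pow_lt; lra).
  assert (Hh0 : 0 < h0) by (apply Rdiv_lt_0_compat; auto).
  assert (Hg0 : forall j, 0 < g j) by (intro; apply Rmult_lt_0_compat; auto).
  assert (HgS : forall j, g (S j) = 2 * g j) by (intro; unfold g; simpl; ring).
  assert (Hgm : forall j, g (j + (J + 4))%nat = m * 2 ^ j).
  { intro j. unfold g, h0. rewrite (pow_add 2 j). field.
    pose proof (Hp2 (J + 4)%nat); lra. }
  assert (Hgmono : forall i j, (i <= j)%nat -> g i <= g j).
  { intros i j Hij. unfold g. apply Rmult_le_compat_l; [lra|]. apply Rle_pow; [lra|auto]. }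
  assert (Hglt : forall i j, g i < g j -> (i < j)%nat).
  { intros i j Hij. destruct (le_lt_dec j i) as [Hc|]; auto.
    specialize (Hgmono _ _ Hc); lra. }
  assert (Hlev : forall x, m <= x -> x <= mx -> exists k, (J + 4 <= k)%nat /\
     (k < H0 + (J + 4))%nat /\ g k <= x < g (S k)).
  { intros x Hx1 Hx2. destruct (dyadic_level m x H0 Hm0) as (k & Hk & Hk').
    - split; auto. apply Rlt_le_trans with (2 * mx); [lra|].
      replace (2 * mx) with (m * (2 * mx / m)) by (field; lra).
      apply Rmult_le_compat_l; lra.
    - exists (k + (J + 4))%nat. rewrite HgS, Hgm. simpl in Hk'.
      split; [lia|]. split; [lia|lra]. }
  set (rt := sqrt eps). assert (Hrt : rt * rt = eps) by (apply sqrt_def; lra).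
  assert (Hrt0 : 0 < rt) by (apply sqrt_lt_R0; lra).
  assert (Hrt1 : rt <= 1) by nra.
  (* This scale gives level [k] of the horizontal nets the spacing [sqrt eps * g k], which is what
     [vertical_jump] tolerates at height [g k]. *)
  set (s := rt * h0). assert (Hs : 0 < s) by (apply Rmult_lt_0_compat; auto).
  assert (Hsg : forall k, s * 2 ^ k = rt * g k) by (intro; unfold s, g; ring).
  set (H := (H0 + (J + 8))%nat).
  destruct (net_hierarchy_exists hx s Q H Hmx Hs) as (life & par & Hnet).
  pose proof Hnet as (Nle & _ & Npar).
  (* One [J] accounts for stopping [J] levels below the top of the geodesic, the other for the net
     spacing being smaller than the height by [sqrt eps]. *)
  destruct (active_nodes hx s Q H life par (J + J) Hmx Hs Hnet) as (Act & HAlen & _ & HA).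
  assert (Hanc : forall n : X * nat, exists w, In (fst n) Q -> (snd n <= H)%nat ->
     In w Q /\ (snd n <= life w)%nat /\ hx (fst n) w <= 2 * (rt * g (snd n))).
  { intros [p k]; simpl. destruct (classic (In p Q /\ (k <= H)%nat)) as [[Hp Hk]|Hn].
    - destruct (net_ancestor hx s Q H life par Hmx Hs Hnet (map (fun w => (w, par w)) Q))
        with (p := p) (k := k) as (w & W1 & W2 & W3 & _); auto.
      + intros w Hw; apply (in_map (fun w => (w, par w))); auto.
      + rewrite Hsg in W3. exists w; auto.
    - exists p; tauto. }
  apply choice in Hanc. destruct Hanc as [anc Hanc].
  assert (Hb : forall p, exists b, In p Q -> (J + 4 <= b)%nat /\ (b < H0 + (J + 4))%nat /\
     g b <= yy p < g (S b)).
  { intro p. destruct (classic (In p Q)) as [Hp|Hp]; [|exists 0%nat; tauto].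
    destruct (Hlev (yy p)) as (k & Hk); [auto| |exists k; auto].
    assert (Hpp : In (p, p) (list_prod Q Q)) by (apply in_prod; auto).
    specialize (Hmax _ Hpp); simpl in Hmax. rewrite Hx0 in Hmax. specialize (Hy p). lra. }
  apply choice in Hb. destruct Hb as [b Hb].
  set (pt := fun w k => node w (g k)).
  assert (Ypt : forall w k, yy (pt w k) = g k) by (intros; apply Hnode; auto).
  assert (Xpt0 : forall w k, hx (pt w k) w = 0) by (intros; apply Hnode; auto).
  assert (Xpt : forall w k v, hx (pt w k) v = hx w v).
  { intros w k v. pose proof (Hxtri (pt w k) w v). pose proof (Hxtri w (pt w k) v).
    rewrite (Hxsym w (pt w k)), Xpt0 in *. lra. }
  assert (Xpt' : forall w k v, hx v (pt w k) = hx v w).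
  { intros. rewrite Hxsym, Xpt, Hxsym; auto. }
  (* The last family holds the ancestors of a point from [J] levels below its own height to two
     above: the start of its climb, and the nodes attached to it when it does not climb. *)
  set (Nodes := Act ++ map (fun w => (w, life w)) Q ++ map (fun w => (par w, S (life w))) Q ++
     flat_map (fun q => map (fun i => (anc (q, b q - J + i), b q - J + i))%nat
       (seq 0 (J + 3))) Q).
  assert (HNlen : INR (length Nodes) = INR (length Q) * (5 * INR J + 7)).
  { unfold Nodes. rewrite !length_app, !length_map, HAlen.
    rewrite (length_flat_map_const _ (J + 3)).
    - rewrite !plus_INR, !mult_INR, (S_INR (J + J)), !plus_INR.
      change (INR 2) with 2. replace (INR 3) with 3 by (simpl; ring). ring.
    - intros; rewrite length_map, length_seq; auto. }
  destruct (vertical_chain d pt Nodes (fun k => ln (g k)) Hm) as (E3 & L3 & HE3).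
  { intros w k k' Hk. rewrite <- ln_div by auto.
    rewrite <- (Ypt w k), <- (Ypt w k') at 1.
    apply (vertical_distance d hx yy); auto.
    - rewrite !Ypt; auto.
    - rewrite Xpt, Xpt'; apply Hx0. }
  (* A point that need not climb is joined directly to the charts at its own level and the next
     [J + 1] levels. *)
  set (E1 := flat_map (fun p => flat_map (fun i => map (fun z => (p, z)) (Z (g (b p + i)%nat) p))
     (seq 0 (J + 2))) Q).
  set (E2 := flat_map (fun n : X * nat => map (fun z => (pt (fst n) (snd n), z))
     (Z (g (snd n + J)%nat) (pt (fst n) (snd n)))) Nodes).
  set (E4 := map (fun w => (pt w (life w), pt (par w) (S (life w)))) Q).
  set (E5 := map (fun p => (p, pt (anc (p, S (S (b p)))) (S (S (b p))))) Q).
  set (E := E1 ++ E2 ++ E3 ++ E4 ++ E5).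
  assert (I1 : forall p i z, In p Q -> (i < J + 2)%nat -> In z (Z (g (b p + i)%nat) p) ->
     In (p, z) E).
  { intros p i z Hp Hi Hz. apply in_app_iff; left. apply in_flat_map. exists p; split; auto.
    apply in_flat_map. exists i; split; [apply in_seq; lia|].
    apply (in_map (fun z => (p, z))); auto. }
  assert (I2 : forall w k z, In (w, k) Nodes -> In z (Z (g (k + J)%nat) (pt w k)) ->
     In (pt w k, z) E).
  { intros w k z Hw Hz. apply in_app_iff; right. apply in_app_iff; left. apply in_flat_map.
    exists (w, k); split; auto. apply (in_map (fun z => (pt w k, z))); auto. }
  assert (I3 : incl E3 E).
  { intros e He'. unfold E. rewrite !in_app_iff; auto. }
  assert (I4 : forall w, In w Q -> In (pt w (life w), pt (par w) (S (life w))) E).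
  { intros w Hw. unfold E. rewrite !in_app_iff. do 3 right; left.
    apply (in_map (fun w => (pt w (life w), pt (par w) (S (life w))))); auto. }
  assert (I5 : forall p, In p Q -> In (p, pt (anc (p, S (S (b p)))) (S (S (b p)))) E).
  { intros w Hw. unfold E. rewrite !in_app_iff. do 4 right.
    apply (in_map (fun p => (p, pt (anc (p, S (S (b p)))) (S (S (b p)))))); auto. }
  assert (Njump : forall w, In w Q -> In (w, life w) Nodes /\ In (par w, S (life w)) Nodes).
  { intros w Hw. unfold Nodes. rewrite !in_app_iff. split.
    - right; left. apply (in_map (fun w => (w, life w))); auto.
    - right; right; left. apply (in_map (fun w => (par w, S (life w)))); auto. }
  assert (Nanc : forall q k, In q Q -> (b q - J <= k)%nat -> (k <= b q + 2)%nat ->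
     In (anc (q, k), k) Nodes).
  { intros q k Hq Hk1 Hk2. unfold Nodes. rewrite !in_app_iff. do 3 right.
    apply in_flat_map. exists q; split; auto. apply in_map_iff.
    exists (k - (b q - J))%nat. rewrite in_seq. destruct (Hb q Hq).
    replace (b q - J + (k - (b q - J)))%nat with k by lia. split; [auto|lia]. }
  exists E. split.
  { unfold E. rewrite !length_app, !plus_INR, L3. unfold E4, E5. rewrite !length_map.
    assert (A1 : INR (length E1) <= INR (length Q) * ((INR J + 2) * K)).
    { apply length_flat_map_le. intros p _.
      eapply Rle_trans; [apply (length_flat_map_le _ K)|].
      - intros i _. rewrite length_map. apply HZ; auto.
      - rewrite length_seq, plus_INR. simpl. lra. }
    assert (A2 : INR (length E2) <= INR (length Nodes) * K).
    { apply length_flat_map_le. intros n _. rewrite length_map. apply HZ; auto. }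
    rewrite HNlen in *. pose proof (pos_INR (length Q)) as PQ. pose proof (pos_INR J) as PJ.
    assert (B1 : 0 <= INR (length Q) * (INR J * K))
      by (apply Rmult_le_pos; auto; apply Rmult_le_pos; auto).
    assert (B2 : 0 <= INR (length Q) * K) by (apply Rmult_le_pos; auto).
    assert (B3 : 0 <= INR (length Q) * INR J) by (apply Rmult_le_pos; auto).
    lra. }
  (* The first stop is two levels above [b p], so that the height at least doubles. Later [(w, k)]
     need not be a node; the invariant therefore stops at a node [(w, k0)] of the column of [w] and
     postpones the rise from [k0] to [k] until [w] dies or the climb ends. *)
  assert (Hclimb : forall p k, In p Q -> (S (S (b p)) <= k)%nat -> (k <= H)%nat ->
    exists w k0, In w Q /\ (k <= life w)%nat /\ hx p w <= 2 * (rt * g k) /\ (k0 <= k)%nat /\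
      In (w, k0) Nodes /\ conn d E p (pt w k0) ((1 + 12 * eps) * (ln (g k0) - ln (yy p)))).
  { intros p k Hp Hk. destruct (Hb p Hp) as (Hb1 & Hb2 & Hb3).
    induction k as [|k IH]; [lia|]. intro HkH.
    destruct (Nat.eq_dec (S k) (S (S (b p)))) as [Ek|Ek].
    - rewrite Ek in *. set (k0 := S (S (b p))) in *.
      destruct (Hanc (p, k0) Hp HkH) as (W1 & W2 & W3); simpl in *.
      exists (anc (p, k0)), k0. repeat split; auto.
      + apply Nanc; auto; unfold k0; lia.
      + apply conn_edge; [apply I5; auto|]. rewrite <- ln_div by auto.
        rewrite <- (Ypt (anc (p, k0)) k0).
        apply (vertical_jump d hx yy); auto; try lra; rewrite Ypt.
        * unfold k0. rewrite HgS. lra.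
        * rewrite Xpt'. rewrite <- Hrt.
          apply Rle_trans with ((2 * (rt * g k0)) * (2 * (rt * g k0))); [|lra].
          apply Rmult_le_compat; auto.
    - destruct IH as (w & k0 & W1 & W2 & W3 & W4 & W5 & W6); [lia|lia|].
      destruct (Nat.eq_dec (life w) k) as [El|El].
      + destruct (Npar w W1) as (P1 & P2 & P3); [lia|].
        rewrite Hsg in P3. destruct (Njump w W1) as (N1 & N2). rewrite El in *.
        exists (par w), (S k). repeat split; auto.
        * pose proof (Hxtri p w (par w)). rewrite HgS in *. lra.
        * replace ((1 + 12 * eps) * (ln (g (S k)) - ln (yy p))) with
            ((1 + 12 * eps) * (ln (g k0) - ln (yy p)) + ((1 + 12 * eps) * (ln (g k) - ln (g k0)) +
             (1 + 12 * eps) * (ln (g (S k)) - ln (g k)))) by ring.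
          eapply conn_trans; [exact W6|]. eapply conn_trans.
          -- eapply conn_mono; [eapply conn_incl; [exact I3|apply HE3; eauto]|].
             assert (ln (g k0) <= ln (g k)) by (apply ln_le_compat; auto).
             assert (0 <= eps * (ln (g k) - ln (g k0))) by (apply Rmult_le_pos; lra). lra.
          -- apply conn_edge; [rewrite <- El; apply I4; auto|]. rewrite <- ln_div by auto.
             rewrite <- (Ypt w k), <- (Ypt (par w) (S k)) at 1.
             apply (vertical_jump d hx yy); auto; try lra; rewrite !Ypt.
             ++ rewrite HgS. lra.
             ++ rewrite Xpt, Xpt'. rewrite <- Hrt.
                apply Rle_trans with ((rt * g (S k)) * (rt * g (S k))).
                ** apply Rmult_le_compat; auto.
                ** assert (0 <= (rt * g (S k)) * (rt * g (S k))); [|lra].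
                   apply Rmult_le_pos; left; apply Rmult_lt_0_compat; auto.
      + exists w, k0. repeat split; auto; try lia.
        rewrite HgS. assert (0 < rt * g k) by (apply Rmult_lt_0_compat; auto). lra. }
  set (good := fun kap p u =>
    conn d E p u ((1 + 12 * eps) * ln (yy u / yy p)) /\
    (forall z, In z (Z (g (kap + J)%nat) u) -> In (u, z) E) /\
    hx p u <= 2 * (rt * g kap) /\ (u = p \/ (yy u = g kap /\ yy p <= g kap))).
  (* If [kap <= S (b p)] the point stays where it is, and its ancestor is a node by construction.
     Otherwise it climbs, and [(w, kap)] is a node only if the other end of the pair makes it
     active, hence the conditional form. *)
  assert (Hsel : forall p kap, In p Q -> (kap <= H)%nat -> yy p < g (S (kap + J)) ->
    exists w, In w Q /\ (kap <= life w)%nat /\ hx p w <= 2 * (rt * g kap) /\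
      (In (w, kap) Nodes -> exists u, good kap p u) /\
      (In (w, kap) Nodes \/ yy p <= g kap)).
  { intros p kap Hp Hk HyT. destruct (Hb p Hp) as (Hb1 & Hb2 & Hb3).
    assert (Hbk : (b p < S (kap + J))%nat) by (apply Hglt; lra).
    destruct (le_lt_dec kap (S (b p))) as [Hc|Hc].
    - destruct (Hanc (p, kap) Hp Hk) as (W1 & W2 & W3); simpl in *.
      exists (anc (p, kap)). split; [auto|]. split; [auto|]. split; [auto|]. split.
      + intros _. exists p. split; [|split; [|split; [|auto]]].
        * apply conn_refl. unfold Rdiv. rewrite Rinv_r by (specialize (Hy p); lra).
          rewrite ln_1; lra.
        * intros z Hz. apply I1 with (kap + J - b p)%nat; auto; [lia|].
          replace (b p + (kap + J - b p))%nat with (kap + J)%nat by lia. auto.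
        * rewrite Hx0. assert (0 < rt * g kap) by (apply Rmult_lt_0_compat; auto). lra.
      + left. apply Nanc; auto; lia.
    - destruct (Hclimb p kap) as (w & k0 & W1 & W2 & W3 & W4 & W5 & W6); auto.
      assert (Hyk : yy p <= g kap).
      { assert (g (S (b p)) <= g kap) by (apply Hgmono; lia). lra. }
      exists w. split; [auto|]. split; [auto|]. split; [auto|]. split; [|auto].
      intro N. exists (pt w kap). split; [|split; [|split; [|auto]]].
      + rewrite Ypt, ln_div by auto.
        replace ((1 + 12 * eps) * (ln (g kap) - ln (yy p))) with
          ((1 + 12 * eps) * (ln (g k0) - ln (yy p)) + (1 + 12 * eps) * (ln (g kap) - ln (g k0)))
          by ring.
        eapply conn_trans; [exact W6|].
        eapply conn_mono; [eapply conn_incl; [exact I3|apply HE3; eauto]|].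
        assert (ln (g k0) <= ln (g kap)) by (apply ln_le_compat; auto).
        assert (0 <= eps * (ln (g kap) - ln (g k0))) by (apply Rmult_le_pos; lra). lra.
      + intros z Hz. apply I2; auto.
      + rewrite Xpt'; auto. }
  intros p q Hp Hq Hdpq.
  destruct (max_of_three (hx p q) (yy p) (yy q)) as (T & T1 & T2 & T3 & T4).
  destruct (Hlev T) as (k & K1 & K2 & K3).
  { specialize (Hmin p Hp). lra. }
  { assert (Hpq : In (p, q) (list_prod Q Q)) by (apply in_prod; auto).
    specialize (Hmax _ Hpq); simpl in Hmax.
    pose proof (Hxpos p q). pose proof (Hy p). pose proof (Hy q). destruct T4 as [->|[->| ->]]; lra. }
  (* The climb ends at height [gam = g kap], where [64 / eps <= 2 ^ J] gives [64 * gam <= eps * T]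
     as [climbed_distance] requires. *)
  set (kap := (k - J)%nat). assert (Ek : k = (kap + J)%nat) by (unfold kap; lia).
  set (gam := g kap).
  assert (Hgam : 0 < gam) by apply Hg0.
  assert (HgJ : g k = gam * 2 ^ J) by (rewrite Ek; unfold gam, g; rewrite pow_add; ring).
  assert (HgT : 64 * gam <= eps * T).
  { assert (gam * (64 / eps) <= gam * 2 ^ J) by (apply Rmult_le_compat_l; lra).
    assert (eps * (gam * (64 / eps)) <= eps * T) by (apply Rmult_le_compat_l; lra).
    replace (eps * (gam * (64 / eps))) with (64 * gam) in * by (field; lra). auto. }
  assert (HgT1 : 64 * gam <= T).
  { assert (gam * 64 <= gam * 2 ^ J) by (apply Rmult_le_compat_l; lra). lra. }
  assert (Hrg : rt * gam <= gam) by nra.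
  rewrite HgS in K3.
  assert (HkH : (kap <= H)%nat) by (unfold H; lia).
  destruct (Hsel p kap Hp HkH) as (w1 & U1 & U2 & U3 & U4 & U5).
  { rewrite <- Ek, HgS; lra. }
  destruct (Hsel q kap Hq HkH) as (w2 & V1 & V2 & V3 & V4 & V5).
  { rewrite <- Ek, HgS; lra. }
  fold gam in U3, U5, V3, V5.
  (* If both ends climbed to one net point, all of [hx p q], [yy p] and [yy q] would be at most
     [4 * gam], contradicting the size of [T]. Two different net points are close enough to be
     active. *)
  assert (HN : In (w1, kap) Nodes /\ In (w2, kap) Nodes).
  { destruct (classic (w1 = w2)) as [<-|Hne].
    - destruct U5 as [|U5]; auto. destruct V5 as [|V5]; auto. exfalso.
      pose proof (Hxtri p w1 q). rewrite (Hxsym w1 q) in *.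
      destruct T4 as [E4'|[E4'|E4']]; lra.
    - assert (Hw : hx w1 w2 <= s * 2 ^ (kap + (J + J))).
      { assert (Hw : hx w1 w2 <= T + 4 * gam).
        { pose proof (Hxtri w1 p w2). pose proof (Hxtri p q w2). rewrite (Hxsym w1 p) in *. lra. }
        rewrite Hsg. unfold g. rewrite !pow_add, <- !Rmult_assoc.
        replace (rt * h0 * 2 ^ kap * 2 ^ J * 2 ^ J) with ((rt * 2 ^ J) * (gam * 2 ^ J))
          by (unfold gam, g; ring).
        assert (64 <= rt * 2 ^ J).
        { assert (rt * (64 / eps) <= rt * 2 ^ J) by (apply Rmult_le_compat_l; lra).
          assert (rt * (64 / eps) = 64 / rt) by (rewrite <- Hrt; field; lra).
          assert (64 <= 64 / rt); [|lra].
          apply Rmult_le_reg_r with rt; auto. field_simplify; lra. }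
        assert (64 * (gam * 2 ^ J) <= (rt * 2 ^ J) * (gam * 2 ^ J))
          by (apply Rmult_le_compat_r; [rewrite <- HgJ; left; auto|lra]).
        lra. }
      unfold Nodes. rewrite !in_app_iff. split; left.
      + apply (HA w1 w2); auto.
      + apply (HA w2 w1); auto. rewrite Hxsym; auto. }
  destruct HN as [N1 N2].
  destruct (U4 N1) as (u & G1 & G2 & G3 & G4).
  destruct (V4 N2) as (v & F1 & F2 & F3 & F4).
  rewrite <- Ek in G2, F2. fold gam in G3, G4, F3, F4.
  assert (X1 : hx u v <= hx p q + 4 * gam).
  { pose proof (Hxtri u p v). pose proof (Hxtri p q v). rewrite (Hxsym u p) in *. lra. }
  assert (X2 : hx p q <= hx u v + 4 * gam).
  { pose proof (Hxtri p u q). pose proof (Hxtri u v q). rewrite (Hxsym v q) in *. lra. }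
  assert (Yp := Hy p). assert (Yq := Hy q). assert (Yu := Hy u). assert (Yv := Hy v).
  assert (Yu' : yy u <= T) by (destruct G4 as [->|[-> _]]; lra).
  assert (Yv' : yy v <= T) by (destruct F4 as [->|[-> _]]; lra).
  assert (Hbig : T <= 2 * hx u v \/ T <= 2 * yy u \/ T <= 2 * yy v).
  { destruct T4 as [E4'|[E4'|E4']].
    - left; lra.
    - destruct G4 as [->|[_ ?]]; [right; left; lra|lra].
    - destruct F4 as [->|[_ ?]]; [right; right; lra|lra]. }
  assert (HT2 : T * T <= hx p q * hx p q + yy p * yy p + yy q * yy q).
  { pose proof (Hxpos p q). destruct T4 as [->|[->| ->]]; nra. }
  (* If an end has moved, its height is [gam <= T / 64], while one of [hx u v], [yy u], [yy v] is
     still at least [T / 2]; so [cosh (d u v)] is far above [7 / 4]. *)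
  assert (Hfin : 1 / 2 <= d u v /\
    ln (yy u / yy p) + ln (yy v / yy q) + d u v <= d p q + 2 * eps).
  { destruct (classic (u = p /\ v = q)) as [[-> ->]|Hnt].
    - split; auto. unfold Rdiv. rewrite !Rinv_r by lra. rewrite ln_1; lra.
    - assert (Hlow : (yy u = gam /\ yy p <= gam) \/ (yy v = gam /\ yy q <= gam)).
      { destruct G4; auto. destruct F4; auto. exfalso; auto. }
      split.
      + apply Rnot_lt_le; intro Hlt.
        assert (C1 : cosh (d u v) <= 7 / 4).
        { eapply Rle_trans; [|apply cosh_1_bound]. apply cosh_incr. split; auto. lra. }
        rewrite Hcosh in C1.
        assert (C2 : hx u v * hx u v + yy u * yy u + yy v * yy v <= 7 / 2 * (yy u * yy v)).
        { apply Rmult_le_compat_r with (r := 2 * yy u * yy v) in C1; [|nra].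
          unfold Rdiv in C1 at 1. rewrite Rmult_assoc, Rinv_l in C1 by nra. lra. }
        pose proof (Hxpos u v).
        assert (C3 : yy u * yy v <= gam * T).
        { destruct Hlow as [[-> _]|[-> _]]; [|rewrite Rmult_comm]; apply Rmult_le_compat_l; lra. }
        assert (C4 : T * T <= 4 * (hx u v * hx u v + yy u * yy u + yy v * yy v)).
        { destruct Hbig as [B|[B|B]]; nra. }
        nra.
      + apply climbed_distance with (hx := hx) (yy := yy) (gam := gam) (T := T); auto.
        * destruct G4 as [->|[? _]]; auto.
        * destruct F4 as [->|[? _]]; auto.
        * destruct Hlow as [[_ ?]|[_ ?]]; auto. }
  destruct Hfin as [D1 D2].
  destruct (Hhop (g k) u v) as (z & Z1 & Z2 & Z3); auto; try lra.
  eapply conn_mono.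
  { eapply conn_trans; [exact G1|].
    eapply conn_trans; [apply (conn_edge _ _ u z); [apply G2; auto|apply Rle_refl]|].
    eapply conn_trans; [|apply conn_sym; [auto|exact F1]].
    apply conn_sym; auto. apply (conn_edge _ _ v z); [apply F2; auto|apply Rle_refl]. }
  rewrite (Hsym v z).
  assert ((1 + 12 * eps) * (ln (yy u / yy p) + ln (yy v / yy q) + d u v) <=
    (1 + 12 * eps) * (d p q + 2 * eps)) by (apply Rmult_le_compat_l; lra).
  (* The additive error becomes relative because [d p q >= 1 / 2]; this is the origin of the factor
     [1 + 4 * eps]. *)
  assert ((1 + 12 * eps) * (d p q + 2 * eps) <= (1 + 12 * eps) * (d p q + 4 * eps * d p q)).
  { apply Rmult_le_compat_l; [lra|].
    assert (eps * (1 / 2) <= eps * d p q) by (apply Rmult_le_compat_l; lra). lra. }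
  assert (0 <= eps * d u v) by (apply Rmult_le_pos; lra).
  lra.
Qed.

(** * Euclidean vectors and grids *)

Lemma Rabs_le_inv x a : Rabs x <= a -> - a <= x <= a.
Proof. unfold Rabs. destruct Rcase_abs; lra. Qed.

Lemma rsum_ext n f g : (forall i, (i < n)%nat -> f i = g i) -> rsum n f = rsum n g.
Proof. induction n; simpl; intro H; auto. rewrite IHn, H; auto. Qed.

Lemma rsum_le n f g : (forall i, (i < n)%nat -> f i <= g i) -> rsum n f <= rsum n g.
Proof.
  induction n; simpl; intro H; [lra|].
  apply Rplus_le_compat; [apply IHn|]; auto.
Qed.

Lemma rsum_const n c : rsum n (fun _ => c) = INR n * c.
Proof. induction n; [simpl; lra|]. rewrite S_INR; simpl. rewrite IHn; lra. Qed.

Lemma rsum_plus n f g : rsum n (fun i => f i + g i) = rsum n f + rsum n g.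
Proof. induction n; simpl; [lra|]. rewrite IHn; lra. Qed.

Lemma rsum_scal n c f : rsum n (fun i => c * f i) = c * rsum n f.
Proof. induction n; simpl; [lra|]. rewrite IHn; lra. Qed.

Lemma rsum_nonneg n f : (forall i, (i < n)%nat -> 0 <= f i) -> 0 <= rsum n f.
Proof.
  intro H. rewrite <- (Rmult_0_r (INR n)), <- (rsum_const n 0). apply rsum_le; auto.
Qed.

Lemma rsum_term n f i : (forall i, (i < n)%nat -> 0 <= f i) -> (i < n)%nat -> f i <= rsum n f.
Proof.
  induction n; simpl; intros H Hi; [lia|].
  destruct (Nat.eq_dec i n) as [->|].
  - assert (0 <= rsum n f) by (apply rsum_nonneg; auto). lra.
  - assert (f i <= rsum n f) by (apply IHn; auto; lia). assert (0 <= f n) by auto. lra.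
Qed.

Lemma rsum_large_term n f c :
  (0 < n)%nat -> INR n * c <= rsum n f -> exists i, (i < n)%nat /\ c <= f i.
Proof.
  intros Hn Hc. apply NNPP; intro H.
  assert (Hlt : forall i, (i < n)%nat -> f i < c).
  { intros i Hi. apply Rnot_le_lt; intro; apply H; eauto. }
  assert (Hs : forall m, (0 < m <= n)%nat -> rsum m f < INR m * c).
  { induction m as [|m IH]; intro Hm; [lia|]. rewrite S_INR; simpl.
    specialize (Hlt m ltac:(lia)). destruct m; [simpl; lra|].
    specialize (IH ltac:(lia)). lra. }
  specialize (Hs n ltac:(lia)). lra.
Qed.

Definition dot (n : nat) (x y : nat -> R) : R := rsum n (fun i => x i * y i).

Lemma dot_sym n x y : dot n x y = dot n y x.
Proof. apply rsum_ext; intros; ring. Qed.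

Lemma dot_comb n a b x y z :
  dot n (fun i => a * x i + b * y i) z = a * dot n x z + b * dot n y z.
Proof.
  unfold dot. rewrite <- !rsum_scal, <- rsum_plus. apply rsum_ext; intros; ring.
Qed.

Lemma dot_comb_r n a b x y z :
  dot n z (fun i => a * x i + b * y i) = a * dot n z x + b * dot n z y.
Proof. rewrite dot_sym, dot_comb, !(dot_sym n z); auto. Qed.

Lemma dot_self n x : 0 <= dot n x x.
Proof. apply rsum_nonneg; intros; nra. Qed.

(** One quadratic argument serves Cauchy-Schwarz and the triangle inequalities of the sphere and the
    hyperboloid. For [Y = 0] the polynomial is affine and is made negative explicitly. *)
Lemma discriminant_bound X A Y :
  0 <= Y -> (forall t, 0 <= X - 2 * t * A + t * t * Y) -> A * A <= X * Y.
Proof.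
  intros [HY|<-] H.
  - specialize (H (A / Y)).
    apply Rmult_le_compat_r with (r := Y) in H; [|lra].
    replace ((X - 2 * (A / Y) * A + A / Y * (A / Y) * Y) * Y) with (X * Y - A * A) in H
      by (field; lra). lra.
  - apply Rnot_lt_le; intro HA. assert (HA0 : A <> 0) by (intros ->; lra).
    specialize (H ((X + 1) / (2 * A))).
    replace (X - 2 * ((X + 1) / (2 * A)) * A + (X + 1) / (2 * A) * ((X + 1) / (2 * A)) * 0)
      with (-1) in H by (field; auto). lra.
Qed.

Lemma cauchy_schwarz n x y : dot n x y * dot n x y <= dot n x x * dot n y y.
Proof.
  apply discriminant_bound; [apply dot_self|]. intro t.
  pose proof (dot_self n (fun i => 1 * x i + (- t) * y i)) as H.
  rewrite dot_comb, !dot_comb_r, (dot_sym n y x) in H. lra.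
Qed.

Definition edist (n : nat) (x y : nat -> R) : R := sqrt (rsum n (fun i => (x i - y i) ^ 2)).

Lemma edist_dot n x y :
  rsum n (fun i => (x i - y i) ^ 2) =
  dot n (fun i => 1 * x i + (-1) * y i) (fun i => 1 * x i + (-1) * y i).
Proof. apply rsum_ext; intros; ring. Qed.

Lemma edist_sqr n x y : edist n x y * edist n x y = rsum n (fun i => (x i - y i) ^ 2).
Proof. apply sqrt_def. rewrite edist_dot. apply dot_self. Qed.

Lemma edist_nonneg n x y : 0 <= edist n x y.
Proof. apply sqrt_pos. Qed.

Lemma Rsqr_le_inv a b : 0 <= b -> a * a <= b * b -> a <= b.
Proof. intros Hb H. apply Rnot_lt_le; intro. nra. Qed.

Lemma edist_expand n x y :
  edist n x y * edist n x y = dot n x x + dot n y y - 2 * dot n x y.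
Proof.
  rewrite edist_sqr, edist_dot, dot_comb, !dot_comb_r, (dot_sym n y x). ring.
Qed.

Lemma le_Rabs_of_sqr a x : a * a <= x * x -> a <= Rabs x.
Proof.
  intro H. apply Rsqr_le_inv; [apply Rabs_pos|].
  rewrite <- Rabs_mult, Rabs_right by apply Rle_ge, Rle_0_sqr. auto.
Qed.

Lemma edist_metric n : pseudo_metric (edist n).
Proof.
  split; [|split; [|split]].
  - intro x. unfold edist. rewrite (rsum_ext n _ (fun _ => 0)), rsum_const by (intros; ring).
    rewrite Rmult_0_r. apply sqrt_0.
  - intros x y. unfold edist. f_equal. apply rsum_ext; intros; ring.
  - apply edist_nonneg.
  - intros x y z. pose proof (edist_nonneg n x y). pose proof (edist_nonneg n y z).
    apply Rsqr_le_inv; [lra|].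
    set (u := fun i => 1 * x i + (-1) * y i). set (v := fun i => 1 * y i + (-1) * z i).
    assert (E : rsum n (fun i => (x i - z i) ^ 2) =
      dot n (fun i => 1 * u i + 1 * v i) (fun i => 1 * u i + 1 * v i)).
    { apply rsum_ext; intros; unfold u, v; ring. }
    assert (Hc : dot n u v <= edist n x y * edist n y z).
    { apply Rsqr_le_inv; [nra|].
      replace (edist n x y * edist n y z * (edist n x y * edist n y z)) with
        ((edist n x y * edist n x y) * (edist n y z * edist n y z)) by ring.
      rewrite !edist_sqr, !edist_dot. apply cauchy_schwarz. }
    rewrite edist_sqr, E, dot_comb, !dot_comb_r, (dot_sym n v u).
    assert (E1 := edist_sqr n x y). assert (E2 := edist_sqr n y z).
    rewrite edist_dot in E1, E2. fold u in E1. fold v in E2. lra.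
Qed.

Lemma edist_coord n x y i : (i < n)%nat -> Rabs (x i - y i) <= edist n x y.
Proof.
  intro Hi. apply Rsqr_le_inv; [apply edist_nonneg|]. rewrite edist_sqr.
  rewrite <- Rabs_mult, Rabs_right by apply Rle_ge, Rle_0_sqr.
  replace ((x i - y i) * (x i - y i)) with ((x i - y i) ^ 2) by ring.
  apply (rsum_term n (fun i => (x i - y i) ^ 2)); auto. intros; apply pow2_ge_0.
Qed.

Lemma edist_sup_bound n x y c :
  (forall i, (i < n)%nat -> Rabs (x i - y i) <= c) ->
  edist n x y * edist n x y <= INR n * (c * c).
Proof.
  intro H. rewrite edist_sqr, <- rsum_const. apply rsum_le. intros i Hi.
  specialize (H i Hi). pose proof (Rabs_pos (x i - y i)).
  replace ((x i - y i) ^ 2) with (Rabs (x i - y i) * Rabs (x i - y i)).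
  - apply Rmult_le_compat; auto.
  - rewrite <- Rabs_mult, Rabs_right by apply Rle_ge, Rle_0_sqr. ring.
Qed.

Lemma pseudo_metric_pullback {X Y} (f : X -> Y) (d : Y -> Y -> R) :
  pseudo_metric d -> pseudo_metric (fun x y => d (f x) (f y)).
Proof. intros (H1 & H2 & H3 & H4). repeat split; auto. Qed.

(** * Grids on hyperplanes: counting their points and meeting a curve *)

Fixpoint rprod (n : nat) (f : nat -> R) : R :=
  match n with O => 1 | S k => rprod k f * f k end.

Lemma rprod_ext n f g : (forall i, (i < n)%nat -> f i = g i) -> rprod n f = rprod n g.
Proof. induction n; simpl; intro H; auto. rewrite IHn, H; auto. Qed.

Lemma rprod_nonneg n f : (forall i, (i < n)%nat -> 0 <= f i) -> 0 <= rprod n f.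
Proof. induction n; simpl; intro H; [lra|]. apply Rmult_le_pos; auto. Qed.

Lemma rprod_pow_bound n f c :
  (forall i, (i < n)%nat -> 0 <= f i <= c) -> rprod n f <= c ^ n.
Proof.
  induction n; cbn [rprod pow]; intro H; [lra|]. rewrite Rmult_comm. apply Rmult_le_compat.
  - apply H; lia.
  - apply rprod_nonneg; intros; apply H; lia.
  - apply H; lia.
  - apply IHn; intros; apply H; lia.
Qed.

(** Allows one exceptional factor to be exchanged for a uniform one without dividing by a factor
    that may vanish. *)
Lemma rprod_update n f i a : (i < n)%nat ->
  rprod n f * a = f i * rprod n (fun k => if Nat.eqb k i then a else f k).
Proof.
  induction n; intro Hi; [lia|]. simpl.
  destruct (Nat.eqb_spec n i) as [->|Hne].
  - rewrite (rprod_ext i (fun k => if Nat.eqb k i then a else f k) f); [ring|].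
    intros k Hk. destruct (Nat.eqb_spec k i); [lia|auto].
  - replace (rprod n f * f n * a) with (rprod n f * a * f n) by ring.
    rewrite IHn by lia. ring.
Qed.

Definition zrange (x y : R) : list Z :=
  map (fun n => (up x - 1 + Z.of_nat n)%Z) (seq 0 (Z.to_nat (up y - up x + 1))).

Lemma in_zrange x y m : x <= IZR m <= y -> In m (zrange x y).
Proof.
  intros [H1 H2]. destruct (archimed x), (archimed y).
  assert (up x - 1 <= m)%Z by (apply le_IZR; rewrite minus_IZR; lra).
  assert (m < up y)%Z by (apply lt_IZR; lra).
  apply in_map_iff. exists (Z.to_nat (m - (up x - 1))). rewrite in_seq.
  split; [rewrite Z2Nat.id; lia|]. lia.
Qed.

Lemma length_zrange x y : x <= y -> INR (length (zrange x y)) <= y - x + 2.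
Proof.
  intro H. unfold zrange. rewrite length_map, length_seq.
  destruct (archimed x), (archimed y).
  assert (up x - 1 < up y)%Z by (apply lt_IZR; rewrite minus_IZR; lra).
  rewrite INR_IZR_INZ, Z2Nat.id by lia. rewrite plus_IZR, minus_IZR. lra.
Qed.

Fixpoint prod_lists {A} (n : nat) (opts : nat -> list A) : list (list A) :=
  match n with
  | O => nil :: nil
  | S k => flat_map (fun l => map (fun a => l ++ a :: nil) (opts k)) (prod_lists k opts)
  end.

Lemma length_prod_lists {A} n (opts : nat -> list A) :
  INR (length (prod_lists n opts)) = rprod n (fun i => INR (length (opts i))).
Proof.
  induction n; [simpl; auto|]. cbn [prod_lists rprod].
  rewrite (length_flat_map_const _ (length (opts n))), mult_INR, IHn; auto.
  intros; apply length_map.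
Qed.

Lemma in_prod_lists {A} n (opts : nat -> list A) (m : nat -> A) :
  (forall i, (i < n)%nat -> In (m i) (opts i)) -> In (map m (seq 0 n)) (prod_lists n opts).
Proof.
  induction n; intro H; [left; auto|]. rewrite seq_S, map_app. cbn [prod_lists].
  apply in_flat_map. exists (map m (seq 0 n)). split; [apply IHn; auto|].
  apply (in_map (fun a => map m (seq 0 n) ++ a :: nil)). apply H; lia.
Qed.

(* Grid points on the hyperplanes [x_i0 = m rho], with fine step [eta] in the other coordinates.
   Coordinate [j] is unused; [j >= D] means that all [D] coordinates are used. *)
Definition grid_step (i0 : nat) (rho eta : R) (i : nat) : R :=
  if Nat.eqb i i0 then rho else eta.

Definition grid_coord (rho eta : R) (code : nat * list Z) (i : nat) : R :=
  IZR (nth i (snd code) 0%Z) * grid_step (fst code) rho eta i.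

Definition grid_options (j i0 : nat) (rho eta : R) (c : nat -> R) (B : R) (i : nat) : list Z :=
  if Nat.eqb i j then 0%Z :: nil
  else zrange ((c i - B) / grid_step i0 rho eta i) ((c i + B) / grid_step i0 rho eta i).

(** Multiples are counted from the origin and the centre [c] only cuts out a box, so the lists of
    different points are parts of one common grid. *)
Definition grid_codes (D j : nat) (rho eta : R) (c : nat -> R) (B : R) : list (nat * list Z) :=
  flat_map (fun i0 => map (fun l => (i0, l)) (prod_lists D (grid_options j i0 rho eta c B)))
    (filter (fun i0 => negb (Nat.eqb i0 j)) (seq 0 D)).

Lemma length_grid_options j i0 rho eta c B i :
  0 < rho -> 0 < eta -> 0 <= B ->
  INR (length (grid_options j i0 rho eta c B i)) <=
    if Nat.eqb i j then 1 else if Nat.eqb i i0 then 2 * B / rho + 2 else 2 * B / eta + 2.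
Proof.
  intros Hr He HB. unfold grid_options, grid_step.
  destruct (Nat.eqb i j); [simpl; lra|].
  assert (Hg : forall w, 0 < w -> INR (length (zrange ((c i - B) / w) ((c i + B) / w))) <= 2 * B / w + 2).
  { intros w Hw. eapply Rle_trans; [apply length_zrange|].
    - apply Rmult_le_compat_r; [left; apply Rinv_0_lt_compat; auto|lra].
    - right; field; lra. }
  destruct (Nat.eqb i i0); auto.
Qed.

(** In both cases exactly [d] coordinates are free and one of them has the coarse step, which leaves
    [d - 1] fine ones: the source of the exponent of [eps]. Exceptional factors are traded for the
    fine one by [rprod_update] and cancelled. *)
Lemma length_grid_codes (D d j : nat) rho eta c B :
  0 < rho -> 0 < eta -> 0 <= B -> (1 <= d)%nat ->
  (D = d /\ (D <= j)%nat \/ D = S d /\ (j < D)%nat) ->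
  INR (length (grid_codes D j rho eta c B)) <=
    INR D * ((2 * B / rho + 2) * (2 * B / eta + 2) ^ (d - 1)).
Proof.
  intros Hr He HB Hd HD. unfold grid_codes.
  set (K1 := 2 * B / rho + 2). set (K2 := 2 * B / eta + 2).
  assert (HK1 : 2 <= K1).
  { unfold K1. assert (0 <= 2 * B / rho); [|lra].
    apply Rmult_le_pos; [lra|left; apply Rinv_0_lt_compat; auto]. }
  assert (HK2 : 2 <= K2).
  { unfold K2. assert (0 <= 2 * B / eta); [|lra].
    apply Rmult_le_pos; [lra|left; apply Rinv_0_lt_compat; auto]. }
  assert (HP : 0 < K2 ^ (d - 1)) by (apply pow_lt; lra).
  assert (Hpow : K2 ^ d = K2 * K2 ^ (d - 1)).
  { destruct d; [lia|]. simpl. rewrite Nat.sub_0_r; auto. }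
  eapply Rle_trans; [apply (length_flat_map_le _ (K1 * K2 ^ (d - 1)))|].
  - intros i0 Hi0. apply filter_In in Hi0. destruct Hi0 as [Hi0 Hne].
    apply in_seq in Hi0. apply Bool.negb_true_iff, Nat.eqb_neq in Hne.
    rewrite length_map, length_prod_lists.
    set (f := fun i => INR (length (grid_options j i0 rho eta c B i))).
    assert (Hf : forall i, 0 <= f i <= if Nat.eqb i j then 1 else if Nat.eqb i i0 then K1 else K2).
    { intro i. split; [apply pos_INR|apply length_grid_options; auto]. }
    assert (Hb : Nat.eqb i0 j = false) by (apply Nat.eqb_neq; auto).
    assert (E0 : f i0 <= K1).
    { destruct (Hf i0) as [_ H]. rewrite Hb, Nat.eqb_refl in H. auto. }
    assert (F0 : 0 <= f i0) by apply Hf.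
    destruct HD as [[-> Hj]|[-> Hj]].
    + apply Rmult_le_reg_r with K2; [lra|].
      rewrite (rprod_update d f i0) by lia. rewrite Rmult_assoc.
      apply Rmult_le_compat; auto.
      * apply rprod_nonneg. intros i _. destruct (Nat.eqb i i0); [lra|apply Hf].
      * replace (K2 ^ (d - 1) * K2) with (K2 ^ d)
          by (rewrite Hpow; ring).
        apply rprod_pow_bound. intros i Hi. specialize (Hf i).
        destruct (Nat.eqb_spec i j); [lia|]. destruct (Nat.eqb i i0); lra.
    + apply Rmult_le_reg_r with (K2 * K2); [nra|].
      rewrite <- Rmult_assoc. rewrite (rprod_update (S d) f i0) by lia.
      rewrite Rmult_assoc. rewrite (rprod_update (S d) _ j) by lia.
      replace (K1 * K2 ^ (d - 1) * (K2 * K2)) with (K1 * K2 ^ (S d))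
        by (simpl; rewrite Hpow; ring).
      apply Rmult_le_compat; auto.
      * apply Rmult_le_pos.
        { destruct (Nat.eqb j i0); [lra|apply Hf]. }
        apply rprod_nonneg. intros i _.
        destruct (Nat.eqb i j); [lra|]. destruct (Nat.eqb i i0); [lra|apply Hf].
      * rewrite <- (Rmult_1_l (K2 ^ S d)). apply Rmult_le_compat.
        -- destruct (Nat.eqb j i0); [lra|apply Hf].
        -- apply rprod_nonneg. intros i _.
           destruct (Nat.eqb i j); [lra|]. destruct (Nat.eqb i i0); [lra|apply Hf].
        -- destruct (Nat.eqb_spec j i0); [congruence|]. specialize (Hf j).
           rewrite Nat.eqb_refl in Hf. lra.
        -- apply rprod_pow_bound. intros i _. specialize (Hf i).
           destruct (Nat.eqb i j); [lra|]. destruct (Nat.eqb i i0); lra.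
  - apply Rmult_le_compat_r; [nra|]. apply le_INR.
    eapply Nat.le_trans; [apply filter_length_le|]. rewrite length_seq; auto.
Qed.

Lemma round_to_multiple x w : 0 < w -> exists m : Z, Rabs (IZR m * w - x) <= w.
Proof.
  intro Hw. exists (up (x / w)). destruct (archimed (x / w)) as [H1 H2].
  assert (E : x = x / w * w) by (field; lra).
  rewrite Rabs_right; [|rewrite E at 2]; nra.
Qed.

Lemma crosses_multiple (f : R -> R) a1 a2 rho :
  (forall a, a1 <= a <= a2 -> continuity_pt f a) -> a1 < a2 -> 0 < rho ->
  rho <= Rabs (f a1 - f a2) ->
  exists a (m : Z), a1 <= a <= a2 /\ f a = IZR m * rho.
Proof.
  intros Hc Ha Hr Hd.
  assert (Hm : exists m : Z, Rmin (f a1) (f a2) <= IZR m * rho <= Rmax (f a1) (f a2)).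
  { exists (up (Rmin (f a1) (f a2) / rho)).
    destruct (archimed (Rmin (f a1) (f a2) / rho)) as [H1 H2].
    assert (E : Rmin (f a1) (f a2) = Rmin (f a1) (f a2) / rho * rho) by (field; lra).
    assert (rho <= Rmax (f a1) (f a2) - Rmin (f a1) (f a2)).
    { unfold Rmax, Rmin, Rabs in *. destruct Rle_dec, Rcase_abs; lra. }
    split; nra. }
  destruct Hm as (m & Hm1 & Hm2). set (c := IZR m * rho) in *.
  assert (Hcc : forall a, a1 <= a <= a2 -> continuity_pt (f - fct_cte c)%F a).
  { intros a Ha'. apply continuity_pt_minus; auto.
    apply continuity_pt_const. intros x y; auto. }
  destruct (Req_dec (f a1) c) as [E1|E1]; [exists a1, m; split; auto; lra|].
  destruct (Req_dec (f a2) c) as [E2|E2]; [exists a2, m; split; auto; lra|].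
  destruct (Rlt_le_dec (f a1) c) as [L1|L1].
  - destruct (IVT_interv (f - fct_cte c)%F a1 a2) as (a & Ha' & Hfa); auto;
      unfold minus_fct, fct_cte in *.
    + lra.
    + unfold Rmax, Rmin in *. destruct Rle_dec; lra.
    + exists a, m. split; auto. fold c. lra.
  - destruct (IVT_interv (- (f - fct_cte c))%F a1 a2) as (a & Ha' & Hfa); auto;
      unfold opp_fct, minus_fct, fct_cte in *.
    + intros a Ha'. apply continuity_pt_opp; auto.
    + lra.
    + unfold Rmax, Rmin in *. destruct Rle_dec; lra.
    + exists a, m. split; auto. fold c. lra.
Qed.

(** By the intermediate value theorem coordinate [i0] is met exactly, so only the others are
    rounded, with error [eta]. The code is fixed before the box: it belongs to the list of every
    centre close enough, which is how both ends of a pair come to share a Steiner point. *)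
Lemma grid_point_on_curve (D j i0 : nat) (gam : nat -> R -> R) rho eta a1 a2 :
  0 < rho -> 0 < eta -> a1 < a2 -> (i0 < D)%nat -> i0 <> j ->
  (forall a, a1 <= a <= a2 -> continuity_pt (gam i0) a) ->
  rho <= Rabs (gam i0 a1 - gam i0 a2) ->
  exists a code, a1 <= a <= a2 /\
    (forall i, (i < D)%nat -> i <> j -> Rabs (grid_coord rho eta code i - gam i a) <= eta) /\
    forall c B, (forall i, (i < D)%nat -> i <> j -> Rabs (gam i a - c i) + eta <= B) ->
      In code (grid_codes D j rho eta c B).
Proof.
  intros Hr He Ha Hi0 Hne Hc Hd.
  destruct (crosses_multiple (gam i0) a1 a2 rho) as (a & m0 & Ha' & Hm0); auto.
  assert (Hm : exists m : nat -> Z, forall i, Rabs (IZR (m i) * eta - gam i a) <= eta).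
  { apply (choice (fun i m => Rabs (IZR m * eta - gam i a) <= eta)).
    intro i. apply round_to_multiple; auto. }
  destruct Hm as [m Hm].
  set (m' := fun i => if Nat.eqb i j then 0%Z else if Nat.eqb i i0 then m0 else m i).
  assert (Hstep : forall i, 0 < grid_step i0 rho eta i).
  { intro i. unfold grid_step. destruct (Nat.eqb i i0); auto. }
  assert (Hm' : forall i, i <> j ->
    Rabs (IZR (m' i) * grid_step i0 rho eta i - gam i a) <= eta).
  { intros i Hij. unfold m', grid_step. destruct (Nat.eqb_spec i j); [easy|].
    destruct (Nat.eqb_spec i i0) as [->|]; auto.
    rewrite Hm0. replace (IZR m0 * rho - IZR m0 * rho) with 0 by ring.
    rewrite Rabs_R0; lra. }
  exists a, (i0, map m' (seq 0 D)). split; auto. split.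
  - intros i Hi Hij. unfold grid_coord; simpl.
    rewrite (nth_indep _ 0%Z (m' 0%nat)) by (rewrite length_map, length_seq; auto).
    rewrite map_nth, seq_nth by auto. apply Hm'; auto.
  - intros c B HB. apply in_flat_map. exists i0. split.
    + apply filter_In. rewrite in_seq. split; [lia|].
      apply Bool.negb_true_iff, Nat.eqb_neq; auto.
    + apply (in_map (fun l => (i0, l))). apply in_prod_lists. intros i Hi.
      unfold grid_options. destruct (Nat.eqb_spec i j) as [->|Hij].
      * left. unfold m'. rewrite Nat.eqb_refl; auto.
      * apply in_zrange. specialize (HB i Hi Hij). specialize (Hm' i Hij).
        specialize (Hstep i). set (w := grid_step i0 rho eta i) in *.
        assert (Hx : Rabs (IZR (m' i) * w - c i) <= B).
        { replace (IZR (m' i) * w - c i) with ((IZR (m' i) * w - gam i a) + (gam i a - c i)) by ring.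
          eapply Rle_trans; [apply Rabs_triang|lra]. }
        unfold Rabs in Hx.
        split; apply Rmult_le_reg_r with w; auto; unfold Rdiv;
          rewrite Rmult_assoc, Rinv_l, Rmult_1_r by lra; destruct Rcase_abs; lra.
Qed.

(** * Hyperbolic geodesics *)

Lemma sinh_pos x : 0 < x -> 0 < sinh x.
Proof. intro. pose proof (sinh_lower x). lra. Qed.

Lemma sinh_nonneg x : 0 <= x -> 0 <= sinh x.
Proof. intro. pose proof (sinh_lower x). lra. Qed.

(* The linear relation in the hypothesis is Stewart's theorem for a point at distance
   [arcosh c] from the point dividing a geodesic into [a] and [b]. *)
Lemma hyperbolic_excess a b u v c :
  0 < a -> 0 < b -> sinh (a + b) * c = sinh b * cosh u + sinh a * cosh v ->
  u + v <= a + b + (cosh a / sinh a + cosh b / sinh b) * (c - 1).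
Proof.
  intros Ha Hb E. pose proof (sinh_pos a Ha). pose proof (sinh_pos b Hb).
  pose proof (cosh_tangent a (u - a)) as Hu. replace (a + (u - a)) with u in Hu by ring.
  pose proof (cosh_tangent b (v - b)) as Hv. replace (b + (v - b)) with v in Hv by ring.
  assert (Hu' : u <= a + (cosh u - cosh a) / sinh a).
  { apply Rmult_le_reg_r with (sinh a); auto.
    replace ((a + (cosh u - cosh a) / sinh a) * sinh a) with (a * sinh a + (cosh u - cosh a))
      by (field; lra). lra. }
  assert (Hv' : v <= b + (cosh v - cosh b) / sinh b).
  { apply Rmult_le_reg_r with (sinh b); auto.
    replace ((b + (cosh v - cosh b) / sinh b) * sinh b) with (b * sinh b + (cosh v - cosh b))
      by (field; lra). lra. }
  assert (E2 : (cosh u - cosh a) / sinh a + (cosh v - cosh b) / sinh b =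
     (cosh a / sinh a + cosh b / sinh b) * (c - 1)); [|lra].
  rewrite sinh_plus in E.
  apply Rmult_eq_reg_r with (sinh a * sinh b); [|nra].
  field_simplify; [|lra|lra]. lra.
Qed.

Lemma coth_upper x : 0 < x -> cosh x / sinh x <= 1 + 1 / x.
Proof.
  intro Hx. pose proof (sinh_lower x). pose proof (sinh_pos x Hx).
  assert (cosh x <= sinh x + 1).
  { unfold cosh, sinh. assert (exp (- x) <= 1); [|lra].
    rewrite <- exp_0. left. apply exp_increasing. lra. }
  assert (1 <= sinh x / x).
  { apply Rmult_le_reg_r with x; auto. unfold Rdiv. rewrite Rmult_assoc, Rinv_l; lra. }
  apply Rmult_le_reg_r with (sinh x); auto.
  replace (cosh x / sinh x * sinh x) with (cosh x) by (field; lra).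
  replace ((1 + 1 / x) * sinh x) with (sinh x + sinh x / x) by (field; lra). lra.
Qed.

Lemma log_height_le {X} (d hx : X -> X -> R) yy p q :
  half_space d hx yy -> Rabs (ln (yy q / yy p)) <= d p q.
Proof.
  intros (Hm & _ & Hy & Hc). pose proof (Hy p). pose proof (Hy q).
  apply cosh_le_inv; [apply Hm|].
  assert (E : cosh (Rabs (ln (yy q / yy p))) = cosh (ln (yy q / yy p))).
  { unfold Rabs. destruct Rcase_abs; auto. apply cosh_opp. }
  rewrite E, cosh_ln by (apply Rdiv_lt_0_compat; auto). rewrite Hc.
  replace ((yy q / yy p + / (yy q / yy p)) / 2) with
    ((0 + yy p * yy p + yy q * yy q) / (2 * yy p * yy q)) by (field; lra).
  pose proof (Rle_0_sqr (hx p q)). unfold Rsqr in *.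
  apply Rmult_le_compat_r; [left; apply Rinv_0_lt_compat; nra|]. lra.
Qed.

Lemma dist_of_cosh u v : 0 <= u -> 0 <= v -> cosh u = cosh v -> u = v.
Proof. intros. apply Rle_antisym; apply cosh_le_inv; lra. Qed.

Lemma exp_third : exp (1 / 3) <= 3 / 2.
Proof.
  assert (E : exp (1 / 3) * exp (1 / 3) * exp (1 / 3) = exp 1).
  { rewrite <- !exp_plus. f_equal. field. }
  pose proof exp_le_3. pose proof (exp_pos (1 / 3)).
  apply Rnot_lt_le; intro.
  assert (3/2 * (3/2) < exp (1/3) * exp (1/3)) by nra. nra.
Qed.

(* [geodesic_points] says that hyperboloid points are closed under the linear combinations that
   stay on the hyperboloid. *)
Definition geodesic_points {X : Type} (d : X -> X -> R) (k : nat) (xs : X -> nat -> R)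
  (yy : X -> R) : Prop :=
  forall p q al be, 0 <= al -> 0 <= be ->
    al * al + be * be + 2 * al * be * cosh (d p q) = 1 ->
    exists M, / yy M = al / yy p + be / yy q /\
      (forall i, (i < k)%nat -> xs M i / yy M = al * xs p i / yy p + be * xs q i / yy q) /\
      forall z, cosh (d z M) = al * cosh (d z p) + be * cosh (d z q).

(** The coefficients [sinh (D - a) / sinh D] and [sinh a / sinh D] keep the combination on the
    hyperboloid. The relation for all [z] is the one consumed by [hyperbolic_excess]; at [z = p] and
    [z = q] it yields the two distances. *)
Lemma geodesic_param {X} (d : X -> X -> R) k xs yy p q :
  half_space d (fun p q => edist k (xs p) (xs q)) yy -> geodesic_points d k xs yy ->
  0 < d p q -> forall a, 0 <= a <= d p q ->
  exists M,
    / yy M = (sinh (d p q - a) / yy p + sinh a / yy q) / sinh (d p q) /\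
    (forall i, (i < k)%nat -> xs M i / yy M =
      (sinh (d p q - a) * xs p i / yy p + sinh a * xs q i / yy q) / sinh (d p q)) /\
    (forall z, sinh (d p q) * cosh (d z M) =
      sinh (d p q - a) * cosh (d z p) + sinh a * cosh (d z q)) /\
    d p M = a /\ d q M = d p q - a.
Proof.
  intros (Hm & _ & Hy & _) Hg HD a Ha. set (D := d p q) in *.
  destruct Hm as (Hd0 & Hsym & Hpos & _).
  pose proof (sinh_pos D HD) as HsD.
  pose proof (sinh_nonneg a ltac:(lra)) as Hsa. pose proof (sinh_nonneg (D - a) ltac:(lra)) as Hsb.
  pose proof (Hy p). pose proof (Hy q).
  assert (Hid1 : sinh (D - a) + sinh a * cosh D = sinh D * cosh a).
  { unfold Rminus. rewrite sinh_plus, cosh_opp, sinh_opp. ring. }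
  assert (Hid2 : sinh (D - a) * cosh D + sinh a = sinh D * cosh (D - a)).
  { unfold Rminus. rewrite sinh_plus, cosh_plus, cosh_opp, sinh_opp.
    pose proof (cosh_sinh D) as E.
    replace (sinh a) with (sinh a * (cosh D * cosh D - sinh D * sinh D)) at 2 by (rewrite E; ring).
    ring. }
  destruct (Hg p q (sinh (D - a) / sinh D) (sinh a / sinh D)) as (M & M1 & M2 & M3).
  { apply Rmult_le_pos; auto. left; apply Rinv_0_lt_compat; auto. }
  { apply Rmult_le_pos; auto. left; apply Rinv_0_lt_compat; auto. }
  { fold D. apply Rmult_eq_reg_r with (sinh D * sinh D); [|nra].
    field_simplify; [|lra]. pose proof (cosh_sinh a) as Ea.
    replace (sinh (D - a)) with (sinh D * cosh a - sinh a * cosh D) by lra.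
    pose proof (cosh_sinh D) as ED.
    replace (cosh D ^ 2) with (1 + sinh D ^ 2) by (simpl; lra). ring_simplify.
    replace (cosh a ^ 2) with (1 + sinh a ^ 2) by (simpl; lra).
    replace (cosh D ^ 2) with (1 + sinh D ^ 2) by (simpl; lra). ring. }
  assert (M4 : forall z, sinh D * cosh (d z M) =
      sinh (D - a) * cosh (d z p) + sinh a * cosh (d z q)).
  { intro z. rewrite M3. field. lra. }
  exists M. split; [rewrite M1; field; lra|]. split; [|split; auto; split].
  - intros i Hi. rewrite M2 by auto. field; lra.
  - apply dist_of_cosh; auto; [lra|]. apply Rmult_eq_reg_l with (sinh D); [|lra].
    rewrite M4, Hd0, cosh_0. fold D. lra.
  - apply dist_of_cosh; auto; [lra|]. apply Rmult_eq_reg_l with (sinh D); [|lra].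
    rewrite M4, Hd0, cosh_0, (Hsym q p). fold D. lra.
Qed.

(* With [G = exp a* y_p] and [a*] the parameter of the top of the geodesic, [G^2 = exp D y_p y_q]
   lies between multiples of [T^2], and the heights near the top are comparable to [G]. *)
Lemma height_near_top {X} (d : X -> X -> R) hx yy (p q M : X) T a :
  half_space d hx yy -> 0 < T -> 1 / 2 <= d p q ->
  hx p q <= T -> yy p <= T -> yy q <= T ->
  T * T <= hx p q * hx p q + yy p * yy p + yy q * yy q ->
  0 <= a <= d p q -> Rabs (a - (d p q + ln (yy q / yy p)) / 2) <= 1 / 3 ->
  d p M = a -> / yy M = (sinh (d p q - a) / yy p + sinh a / yy q) / sinh (d p q) ->
  T / 9 <= yy M <= 6 * T.
Proof.
  intros (Hm & Hmx & Hy & Hc) HT HD Hx Hp Hq HS Ha Hclose HpM HM.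
  pose proof (Hy p) as Yp. pose proof (Hy q) as Yq. pose proof (Hy M) as YM.
  set (D := d p q) in *. set (as_ := (D + ln (yy q / yy p)) / 2) in *.
  set (G := exp as_ * yy p).
  assert (HG : G = exp (D - as_) * yy q).
  { unfold G. replace as_ with (D - as_ + ln (yy q / yy p)) at 1 by (unfold as_; field).
    rewrite exp_plus, exp_ln by (apply Rdiv_lt_0_compat; auto). field. lra. }
  assert (HG0 : 0 < G) by (apply Rmult_lt_0_compat; auto; apply exp_pos).
  assert (HGG : G * G = exp D * (yy p * yy q)).
  { rewrite HG at 2. unfold G. replace D with (as_ + (D - as_)) at 2 by ring.
    rewrite exp_plus. ring. }
  assert (HcS : hx p q * hx p q + yy p * yy p + yy q * yy q = 2 * cosh D * (yy p * yy q)).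
  { unfold D. rewrite Hc. field. lra. }
  assert (Hpq : 0 < yy p * yy q) by (apply Rmult_lt_0_compat; auto).
  assert (EmD : exp (- D) <= exp D).
  { left. apply exp_increasing. lra. }
  assert (EmD2 : exp (- D) <= exp D / 2).
  { assert (E : exp D = exp (- D) * exp (2 * D)) by (rewrite <- exp_plus; f_equal; ring).
    assert (2 <= exp (2 * D)) by (pose proof (exp_ineq1_le (2 * D)); lra).
    pose proof (exp_pos (- D)). rewrite E. nra. }
  pose proof (exp_pos D) as ED. pose proof (exp_pos (- D)) as EmD0.
  (* For [D >= 1 / 2] the quantity [2 * cosh D * (yy p * yy q)] is between [G * G] and [3 / 2] of
     it, and it is also between [T * T] and [3 * (T * T)]. *)
  assert (G1 : T * T <= 2 * (G * G)).
  { rewrite HGG. unfold cosh in HcS. nra. }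
  assert (G2 : G * G <= 3 * (T * T)).
  { assert (0 <= hx p q) by apply Hmx. rewrite HGG. unfold cosh in HcS.
    assert (hx p q * hx p q <= T * T) by (apply Rmult_le_compat; lra).
    assert (yy p * yy p <= T * T) by (apply Rmult_le_compat; lra).
    assert (yy q * yy q <= T * T) by (apply Rmult_le_compat; lra). nra. }
  assert (G3 : G <= 2 * T) by (apply Rsqr_le_inv; nra).
  assert (G4 : T <= 3 / 2 * G) by (apply Rsqr_le_inv; nra).
  assert (Ea : exp a <= 3 / 2 * exp as_).
  { replace a with ((a - as_) + as_) by ring. rewrite exp_plus.
    apply Rmult_le_compat_r; [left; apply exp_pos|].
    eapply Rle_trans; [|apply exp_third].
    pose proof (Rle_abs (a - as_)).
    destruct (Rle_lt_or_eq_dec (a - as_) (1 / 3)) as [Hl|Hl]; [lra| |rewrite Hl; lra].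
    left; apply exp_increasing; auto. }
  assert (Eb : exp (D - a) <= 3 / 2 * exp (D - as_)).
  { replace (D - a) with ((as_ - a) + (D - as_)) by ring. rewrite exp_plus.
    apply Rmult_le_compat_r; [left; apply exp_pos|].
    eapply Rle_trans; [|apply exp_third].
    pose proof (Rle_abs (as_ - a)) as Hle. rewrite (Rabs_minus_sym as_ a) in Hle.
    destruct (Rle_lt_or_eq_dec (as_ - a) (1 / 3)) as [Hl|Hl]; [lra| |rewrite Hl; lra].
    left; apply exp_increasing; auto. }
  split.
  - assert (HsD : exp D / 4 <= sinh D) by (unfold sinh; lra).
    assert (Hs0 : 0 < sinh D) by lra.
    assert (Sa : sinh a / yy q <= 3 / 4 * (exp D / G)).
    { apply Rle_trans with (3 / 4 * exp as_ / yy q).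
      - apply Rmult_le_compat_r; [left; apply Rinv_0_lt_compat; auto|].
        unfold sinh. pose proof (exp_pos (- a)). lra.
      - right. rewrite HG. replace D with (as_ + (D - as_)) at 1 by ring.
        rewrite exp_plus. field. pose proof (exp_pos (D - as_)). lra. }
    assert (Sb : sinh (D - a) / yy p <= 3 / 4 * (exp D / G)).
    { apply Rle_trans with (3 / 4 * exp (D - as_) / yy p).
      - apply Rmult_le_compat_r; [left; apply Rinv_0_lt_compat; auto|].
        unfold sinh. pose proof (exp_pos (- (D - a))). lra.
      - right. unfold G. replace D with (as_ + (D - as_)) at 2 by ring.
        rewrite exp_plus. field. pose proof (exp_pos as_). lra. }
    assert (I : / yy M <= 6 / G).
    { rewrite HM. apply Rmult_le_reg_r with (sinh D); auto.
      unfold Rdiv at 1. rewrite Rmult_assoc, Rinv_l, Rmult_1_r by lra.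
      apply Rle_trans with (6 / G * (exp D / 4)).
      - replace (6 / G * (exp D / 4)) with (3 / 4 * (exp D / G) + 3 / 4 * (exp D / G))
          by (field; lra). lra.
      - apply Rmult_le_compat_l; auto. left. apply Rdiv_lt_0_compat; lra. }
    assert (G / 6 <= yy M); [|lra].
    apply Rmult_le_compat_r with (r := G * yy M) in I; [|nra].
    replace (/ yy M * (G * yy M)) with G in I by (field; lra).
    replace (6 / G * (G * yy M)) with (6 * yy M) in I by (field; lra). lra.
  - assert (C : yy M * yy M <= 2 * yy p * yy M * cosh a).
    { rewrite <- HpM, Hc. replace (2 * yy p * yy M * ((hx p M * hx p M + yy p * yy p + yy M * yy M) /
        (2 * yy p * yy M))) with (hx p M * hx p M + yy p * yy p + yy M * yy M) by (field; lra).
      nra. }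
    assert (cosh a <= exp a).
    { unfold cosh. assert (exp (- a) <= exp a); [|lra].
      destruct (proj1 Ha) as [H0|<-]; [left; apply exp_increasing; lra|rewrite Ropp_0; lra]. }
    assert (C2 : yy M <= 2 * yy p * cosh a).
    { apply Rmult_le_reg_r with (yy M); auto. lra. }
    assert (yy p * cosh a <= yy p * (3 / 2 * exp as_)) by (apply Rmult_le_compat_l; lra).
    unfold G in G3. lra.
Qed.

Lemma short_distance {X} (d hx : X -> X -> R) yy u v :
  half_space d hx yy -> d u v <= 1 ->
  hx u v * hx u v + yy u * yy u + yy v * yy v <= 7 / 2 * (yy u * yy v).
Proof.
  intros (Hm & Hmx & Hy & Hc) Huv. pose proof (Hy u). pose proof (Hy v).
  assert (C : cosh (d u v) <= 7 / 4).
  { eapply Rle_trans; [|apply cosh_1_bound]. apply cosh_incr. split; auto. apply Hm. }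
  rewrite Hc in C. apply Rmult_le_compat_r with (r := 2 * yy u * yy v) in C; [|nra].
  replace ((hx u v * hx u v + yy u * yy u + yy v * yy v) / (2 * yy u * yy v) *
    (2 * yy u * yy v)) with (hx u v * hx u v + yy u * yy u + yy v * yy v) in C by (field; lra).
  lra.
Qed.

Lemma height_short {X} (d : X -> X -> R) hx yy (p q M : X) T :
  half_space d hx yy -> 0 < T -> d p q <= 1 ->
  T = hx p q \/ T = yy p \/ T = yy q -> hx p q <= T -> yy p <= T -> yy q <= T ->
  d p M <= 1 -> d q M <= 1 -> T / 9 <= yy M <= 6 * T.
Proof.
  intros (Hm & Hmx & Hy & Hc) HT HD HTe Hx Hp Hq HpM HqM.
  pose proof (Hy p) as Yp. pose proof (Hy q) as Yq. pose proof (Hy M) as YM.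
  assert (H0 := fun u v => short_distance d hx yy u v (conj Hm (conj Hmx (conj Hy Hc)))).
  pose proof (H0 p q HD) as A. pose proof (H0 p M HpM) as B. pose proof (H0 q M HqM) as C.
  assert (B1 : yy p <= 7 / 2 * yy M) by (apply Rmult_le_reg_r with (yy p); nra).
  assert (B2 : yy M <= 7 / 2 * yy p) by (apply Rmult_le_reg_r with (yy M); nra).
  assert (C1 : yy q <= 7 / 2 * yy M) by (apply Rmult_le_reg_r with (yy q); nra).
  split; [|lra].
  destruct HTe as [->|[->| ->]]; [|lra|lra].
  assert (hx p q <= 9 * yy M); [|lra].
  apply Rsqr_le_inv; [lra|].
  assert (yy p * yy q <= (7 / 2 * yy M) * (7 / 2 * yy M)) by (apply Rmult_le_compat; lra).
  nra.
Qed.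

(** Half-space coordinates with the height as coordinate [k], divided by [h]. Such a dilation is an
    isometry of the half-space; it brings the relevant part of a geodesic to height of order 1. *)
Definition chart {X} (k : nat) (xs : X -> nat -> R) (yy : X -> R) (h : R) (p : X) (i : nat) : R :=
  if Nat.eqb i k then yy p / h else xs p i / h.

Lemma half_space_cosh {X} (d hx : X -> X -> R) yy p q :
  half_space d hx yy ->
  2 * yy p * yy q * (cosh (d p q) - 1) = hx p q * hx p q + (yy p - yy q) * (yy p - yy q).
Proof.
  intros (_ & _ & Hy & Hc). pose proof (Hy p). pose proof (Hy q). rewrite Hc. field. lra.
Qed.

Lemma chart_sqr_dist {X} (d : X -> X -> R) k xs yy h p q :
  half_space d (fun p q => edist k (xs p) (xs q)) yy -> 0 < h ->
  rsum (S k) (fun i => (chart k xs yy h p i - chart k xs yy h q i) ^ 2) * (h * h) =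
  2 * yy p * yy q * (cosh (d p q) - 1).
Proof.
  intros HH Hh. rewrite (half_space_cosh _ _ _ _ _ HH), edist_sqr. cbn [rsum].
  unfold chart at 3 4. rewrite Nat.eqb_refl.
  rewrite (rsum_ext k _ (fun i => / (h * h) * (xs p i - xs q i) ^ 2)).
  - rewrite rsum_scal. field. lra.
  - intros i Hi. unfold chart. destruct (Nat.eqb_spec i k); [lia|]. field. lra.
Qed.

(** At short range the chart displacement is controlled by [cosh (d e M) - 1], and [111] exceeds the
    square root of [12288]. At long range the distance may be arbitrarily large, but then
    [r = 1 / 2], and the coordinates differ by a bounded multiple of [T <= 4 * h]. *)
Lemma chart_box {X} (d : X -> X -> R) k xs yy h r T (e M : X) :
  half_space d (fun p q => edist k (xs p) (xs q)) yy -> 0 < h -> 0 < T -> T <= 4 * h ->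
  0 < r -> yy e <= T -> T / 9 <= yy M <= 6 * T ->
  (d e M <= 1 /\ d e M <= 8 * r) \/
    (r = 1 / 2 /\ forall i, (i < k)%nat -> Rabs (xs M i - xs e i) <= T) ->
  forall i, (i <= k)%nat -> Rabs (chart k xs yy h M i - chart k xs yy h e i) <= 111 * r.
Proof.
  intros HH Hh HT HTh Hr He HM Hcase i Hi.
  pose proof HH as (Hm & _ & Hy & _). pose proof (Hy e) as Ye. pose proof (Hy M) as YM.
  destruct Hcase as [[H1 H2]|[Hr2 Hx]].
  - apply Rsqr_le_inv; [lra|].
    rewrite <- Rabs_mult, Rabs_right by apply Rle_ge, Rle_0_sqr.
    assert (Hd0 : 0 <= d e M) by apply Hm.
    pose proof (cosh_upper (d e M) (conj Hd0 H1)) as Hc.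
    assert (Hc2 : cosh (d e M) - 1 <= 64 * (r * r)).
    { assert (d e M * d e M <= (8 * r) * (8 * r)) by (apply Rmult_le_compat; lra). lra. }
    pose proof (rsum_term (S k) (fun i => (chart k xs yy h e i - chart k xs yy h M i) ^ 2) i) as Ht.
    cbv beta in Ht. specialize (Ht ltac:(intros; apply pow2_ge_0) ltac:(lia)).
    pose proof (chart_sqr_dist d k xs yy h e M HH Hh) as E.
    assert (B : 2 * yy e * yy M * (cosh (d e M) - 1) <= 12288 * (r * r) * (h * h)).
    { pose proof (cosh_ge_1 (d e M)).
      assert (yy e * yy M <= T * (6 * T)) by (apply Rmult_le_compat; lra).
      assert (T * T <= (4 * h) * (4 * h)) by (apply Rmult_le_compat; lra).
      apply Rle_trans with (2 * (T * (6 * T)) * (64 * (r * r))).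
      - apply Rmult_le_compat; nra.
      - assert (0 <= r * r) by nra. nra. }
    assert (Hhh : 0 < h * h) by (apply Rmult_lt_0_compat; auto).
    assert (Hs : rsum (S k) (fun i => (chart k xs yy h e i - chart k xs yy h M i) ^ 2) <=
      12288 * (r * r)) by (apply Rmult_le_reg_r with (h * h); auto; lra).
    assert (0 <= r * r) by nra. lra.
  - assert (HThh : T / h <= 4).
    { apply Rmult_le_reg_r with h; auto. unfold Rdiv. rewrite Rmult_assoc, Rinv_l; lra. }
    unfold chart. destruct (Nat.eqb_spec i k) as [->|Hne].
    + replace (yy M / h - yy e / h) with ((yy M - yy e) / h) by (field; lra).
      unfold Rdiv. rewrite Rabs_mult, (Rabs_right (/ h)) by (left; apply Rinv_0_lt_compat; auto).
      assert (Rabs (yy M - yy e) <= 6 * T) by (apply Rabs_le; lra).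
      apply Rle_trans with (6 * T * / h).
      * apply Rmult_le_compat_r; auto. left; apply Rinv_0_lt_compat; auto.
      * unfold Rdiv in HThh. lra.
    + replace (xs M i / h - xs e i / h) with ((xs M i - xs e i) / h) by (field; lra).
      unfold Rdiv. rewrite Rabs_mult, (Rabs_right (/ h)) by (left; apply Rinv_0_lt_compat; auto).
      apply Rle_trans with (T * / h).
      * apply Rmult_le_compat_r; [left; apply Rinv_0_lt_compat; auto|]. apply Hx; lia.
      * unfold Rdiv in HThh. lra.
Qed.

(** A piece of geodesic of length [r / 3] moves the chart point by at least [r / 108], and some one
    of the [S k] coordinates by at least [rho]. The radius [120 * r] is the [111 * r] of [chart_box]
    plus room for rounding. *)
Definition half_space_steiner {X} (k : nat) (xs : X -> nat -> R) (yy : X -> R)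
  (mk : (nat -> R) -> R -> X) (eps r h : R) (p : X) : list X :=
  let rho := r / (108 * INR (S k)) in
  let eta := sqrt eps * r / (108 * INR (S k)) in
  map (fun code => mk (fun i => h * grid_coord rho eta code i) (h * grid_coord rho eta code k))
    (grid_codes (S k) (S k) rho eta (chart k xs yy h p) (120 * r)).

(** A window near the top of the geodesic keeps heights comparable with [h], so chart and hyperbolic
    errors agree up to constants; staying [r / 3] away from both ends bounds the two [coth] terms of
    the excess by [7 / r] in total. The case [r = 1 / 2] covers all longer distances, since the
    scale of the chart is then carried by [h] alone. *)
Theorem half_space_two_hop {X} (d : X -> X -> R) k xs yy mk eps r h (p q : X) :
  half_space d (fun p q => edist k (xs p) (xs q)) yy -> geodesic_points d k xs yy ->
  (forall x y, 0 < y -> yy (mk x y) = y /\ forall i, (i < k)%nat -> xs (mk x y) i = x i) ->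
  0 < eps <= 1 -> 0 < r <= 1 / 2 -> 0 < h -> r <= d p q ->
  (d p q <= 1 /\ d p q <= 8 * r) \/ r = 1 / 2 ->
  edist k (xs p) (xs q) <= 4 * h -> yy p <= 4 * h -> yy q <= 4 * h ->
  (h <= 4 * edist k (xs p) (xs q) \/ h <= 4 * yy p \/ h <= 4 * yy q) ->
  exists z, In z (half_space_steiner k xs yy mk eps r h p) /\
    In z (half_space_steiner k xs yy mk eps r h q) /\ d p z + d z q <= (1 + eps) * d p q.
Proof.
  intros HH Hgeo Hmk He Hr Hh HrD Hcase Bx Bp Bq Bh.
  pose proof HH as (Hm & Hmx & Hy & Hc). pose proof Hm as (Hd0 & Hsym & Hpos & Htri).
  set (hx := fun p q : X => edist k (xs p) (xs q)) in *.
  change (edist k (xs p) (xs q)) with (hx p q) in *.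
  pose proof (Hy p) as Yp. pose proof (Hy q) as Yq.
  assert (Hx0 : 0 <= hx p q) by apply Hmx.
  destruct (max_of_three (hx p q) (yy p) (yy q)) as (T & T1 & T2 & T3 & T4).
  assert (T5 : T <= 4 * h) by (destruct T4 as [->|[->| ->]]; auto).
  assert (T6 : h <= 4 * T) by (destruct Bh as [?|[?|?]]; lra).
  assert (T0 : 0 < T) by lra.
  assert (TT : T * T <= hx p q * hx p q + yy p * yy p + yy q * yy q).
  { destruct T4 as [->|[->| ->]]; nra. }
  assert (HTT : 0 < T * T) by (apply Rmult_lt_0_compat; auto).
  assert (HhT : h * h <= 16 * (T * T)).
  { replace (16 * (T * T)) with (4 * T * (4 * T)) by ring. apply Rmult_le_compat; lra. }
  set (D := d p q) in *. assert (HD : 0 < D) by lra.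
  set (N := INR (S k)). assert (HN : 1 <= N).
  { unfold N. rewrite S_INR. pose proof (pos_INR k). lra. }
  set (rho := r / (108 * N)). set (eta := sqrt eps * r / (108 * N)).
  assert (Hrt : sqrt eps * sqrt eps = eps) by (apply sqrt_def; lra).
  assert (Hrt0 : 0 < sqrt eps) by (apply sqrt_lt_R0; lra).
  assert (Hrt1 : sqrt eps <= 1) by nra.
  assert (Hrho : 0 < rho) by (apply Rdiv_lt_0_compat; lra).
  assert (Heta : 0 < eta) by (apply Rdiv_lt_0_compat; nra).
  assert (HrhoN : rho * N = r / 108) by (unfold rho; field; lra).
  assert (Hetarho : eta = sqrt eps * rho) by (unfold eta, rho; field; lra).
  assert (Hetar : eta <= rho) by (rewrite Hetarho; nra).
  assert (Hrhor : rho <= r / 108) by nra.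
  set (top := (D + ln (yy q / yy p)) / 2).
  assert (Htop : 0 <= top <= D).
  { pose proof (log_height_le d hx yy p q HH) as Hl. fold D in Hl.
    apply Rabs_le_inv in Hl. unfold top. lra. }
  (* [top], which balances the two leading exponentials of the inverse height, is clamped so that
     [r / 3] remains on either side of the window. As [r <= 1 / 2], the window stays within [1 / 3]
     of [top]. *)
  set (a1 := Rmax (r / 3) (Rmin top (D - 2 * r / 3))). set (a2 := a1 + r / 3).
  assert (Ha : r / 3 <= a1 /\ a2 <= D - r / 3 /\ top - 2 * r / 3 <= a1 /\ a1 <= top + r / 3).
  { unfold a2, a1, Rmax, Rmin. destruct Rle_dec, Rle_dec; lra. }
  assert (Hpt : forall a, a1 <= a <= a2 -> exists M, (T / 9 <= yy M <= 6 * T) /\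
    / yy M = (sinh (D - a) / yy p + sinh a / yy q) / sinh D /\
    (forall i, (i < k)%nat -> xs M i / yy M =
      (sinh (D - a) * xs p i / yy p + sinh a * xs q i / yy q) / sinh D) /\
    (forall z, sinh D * cosh (d z M) = sinh (D - a) * cosh (d z p) + sinh a * cosh (d z q)) /\
    d p M = a /\ d q M = D - a).
  { intros a Haa.
    destruct (geodesic_param d k xs yy p q HH Hgeo HD a) as (M & M1 & M2 & M3 & M4 & M5).
    { fold D. unfold a2 in *. lra. }
    fold D in M1, M2, M3, M5. exists M. split; [|auto 6].
    assert (Hab : 0 <= a <= D) by (unfold a2 in *; lra).
    destruct Hcase as [[C1 C2]|C].
    - apply (height_short d hx yy p q M T); auto; lra.
    - apply (height_near_top d hx yy p q M T a); auto; try (fold D; lra).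
      fold D top. apply Rabs_le. unfold a2 in *. lra. }
  set (den := fun a => sinh (D - a) / yy p + sinh a / yy q).
  assert (HsD : 0 < sinh D) by (apply sinh_pos; auto).
  set (gam := fun i a => if Nat.eqb i k then sinh D / h / den a else
     (sinh (D - a) * (xs p i / yy p / h) + sinh a * (xs q i / yy q / h)) / den a).
  assert (Hden : forall a, a1 <= a <= a2 -> 0 < den a).
  { intros a Haa. unfold den. unfold a2 in *.
    pose proof (sinh_pos a ltac:(lra)). pose proof (sinh_pos (D - a) ltac:(lra)).
    apply Rplus_lt_0_compat; apply Rdiv_lt_0_compat; auto. }
  assert (Hgam : forall a M i, a1 <= a <= a2 -> (i <= k)%nat ->
    / yy M = (sinh (D - a) / yy p + sinh a / yy q) / sinh D ->
    (forall i, (i < k)%nat -> xs M i / yy M =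
      (sinh (D - a) * xs p i / yy p + sinh a * xs q i / yy q) / sinh D) ->
    chart k xs yy h M i = gam i a).
  { intros a M i Haa Hi M1 M2. pose proof (Hy M) as YM. specialize (Hden a Haa).
    fold (den a) in M1.
    assert (YE : yy M = sinh D / den a).
    { rewrite <- (Rinv_inv (yy M)), M1. field. lra. }
    unfold chart, gam. destruct (Nat.eqb_spec i k).
    - rewrite YE. field. lra.
    - specialize (M2 i ltac:(lia)).
      replace (xs M i) with (xs M i / yy M * yy M) by (field; lra).
      rewrite M2, YE. field. lra. }
  assert (Hcont : forall i a, a1 <= a <= a2 -> continuity_pt (gam i) a).
  { intros i a Haa. specialize (Hden a Haa). unfold gam.
    unfold den in *. destruct (Nat.eqb i k); reg; lra. }
  assert (Ha12 : a1 < a2) by (unfold a2; lra).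
  assert (Hcross : exists i0, (i0 < S k)%nat /\ rho <= Rabs (gam i0 a1 - gam i0 a2)).
  { destruct (Hpt a1 ltac:(lra)) as (M1 & A1 & A2 & A3 & A4 & A5 & A6).
    destruct (Hpt a2 ltac:(lra)) as (M2 & B1 & B2 & B3 & B4 & B5 & B6).
    assert (Hcd : 1 + r / 3 * (r / 3) / 2 <= cosh (d M1 M2)).
    { assert (r / 3 <= d M1 M2).
      { pose proof (Htri p M1 M2). rewrite A5, B5 in *. unfold a2 in *. lra. }
      eapply Rle_trans; [apply cosh_lower; lra|]. apply cosh_incr. lra. }
    pose proof (chart_sqr_dist d k xs yy h M1 M2 HH Hh) as E.
    assert (Hyy : T / 9 * (T / 9) <= yy M1 * yy M2) by (apply Rmult_le_compat; lra).
    assert (Hlow : (r / 108) * (r / 108) <=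
      rsum (S k) (fun i => (chart k xs yy h M1 i - chart k xs yy h M2 i) ^ 2)).
    { apply Rmult_le_reg_r with (h * h); [apply Rmult_lt_0_compat; auto|]. rewrite E.
      assert (0 <= r * r) by apply Rle_0_sqr.
      apply Rle_trans with (2 * (T / 9 * (T / 9)) * (r / 3 * (r / 3) / 2)).
      - apply Rle_trans with (r / 108 * (r / 108) * (16 * (T * T))); [|right; field].
        apply Rmult_le_compat_l; lra.
      - rewrite (Rmult_assoc 2 (yy M1)). apply Rmult_le_compat; lra. }
    destruct (rsum_large_term (S k) _ ((r / 108) * (r / 108) / N) ltac:(lia)
      ltac:(fold N; replace (N * (r / 108 * (r / 108) / N)) with (r / 108 * (r / 108))
        by (field; lra); exact Hlow)) as (i0 & Hi0 & Hbig).
    exists i0. split; auto.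
    rewrite <- (Hgam a1 M1 i0), <- (Hgam a2 M2 i0) by (auto; lra || lia).
    apply le_Rabs_of_sqr.
    eapply Rle_trans; [|eapply Rle_trans; [exact Hbig|right; ring]].
    rewrite <- HrhoN. replace (rho * N * (rho * N) / N) with (rho * rho * N) by (field; lra).
    rewrite <- (Rmult_1_r (rho * rho)) at 1.
    apply Rmult_le_compat_l; [apply Rle_0_sqr|auto]. }
  destruct Hcross as (i0 & Hi0 & Hcross).
  destruct (grid_point_on_curve (S k) (S k) i0 gam rho eta a1 a2) as (a & code & Haa & Hclose & Hcode);
    auto; [lia|].
  destruct (Hpt a Haa) as (M & A1 & A2 & A3 & A4 & A5 & A6).
  assert (Hab : 0 < a /\ 0 < D - a /\ r / 3 <= a /\ r / 3 <= D - a) by (unfold a2 in *; lra).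
  assert (HMc : forall i, (i <= k)%nat -> chart k xs yy h M i = gam i a) by (intros; apply Hgam; auto).
  (* Horizontally the dividing point is a convex combination of the two ends, with weights [wp] and
     [wq]; this gives the box for long distances. *)
  assert (Hweight : forall i, (i < k)%nat ->
    Rabs (xs M i - xs p i) <= hx p q /\ Rabs (xs M i - xs q i) <= hx p q).
  { intros i Hi. pose proof (Hy M) as YM.
    set (wp := yy M * (sinh (D - a) / yy p / sinh D)). set (wq := yy M * (sinh a / yy q / sinh D)).
    assert (W1 : wp + wq = 1).
    { unfold wp, wq. rewrite <- Rmult_plus_distr_l.
      replace (sinh (D - a) / yy p / sinh D + sinh a / yy q / sinh D) with (/ yy M)
        by (rewrite A2; field; lra). field; lra. }
    assert (W2 : xs M i = wp * xs p i + wq * xs q i).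
    { replace (xs M i) with (yy M * (xs M i / yy M)) by (field; lra).
      rewrite A3 by auto. unfold wp, wq. field. lra. }
    assert (W3 : 0 <= wp).
    { unfold wp. apply Rmult_le_pos; [lra|].
      left. apply Rdiv_lt_0_compat; auto. apply Rdiv_lt_0_compat; auto. apply sinh_pos; lra. }
    assert (W4 : 0 <= wq).
    { unfold wq. apply Rmult_le_pos; [lra|].
      left. apply Rdiv_lt_0_compat; auto. apply Rdiv_lt_0_compat; auto. apply sinh_pos; lra. }
    pose proof (edist_coord k (xs p) (xs q) i Hi) as Hco. fold (hx p q) in Hco.
    pose proof (Rabs_pos (xs p i - xs q i)).
    split.
    - replace (xs M i - xs p i) with (wq * - (xs p i - xs q i))
        by (rewrite W2; replace wp with (1 - wq) by lra; ring).
      rewrite Rabs_mult, Rabs_Ropp, (Rabs_right wq) by lra.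
      apply Rle_trans with (1 * Rabs (xs p i - xs q i)); [apply Rmult_le_compat_r|]; lra.
    - replace (xs M i - xs q i) with (wp * (xs p i - xs q i))
        by (rewrite W2; replace wq with (1 - wp) by lra; ring).
      rewrite Rabs_mult, (Rabs_right wp) by lra.
      apply Rle_trans with (1 * Rabs (xs p i - xs q i)); [apply Rmult_le_compat_r|]; lra. }
  set (z := mk (fun i => h * grid_coord rho eta code i) (h * grid_coord rho eta code k)).
  assert (Hin : forall e, (e = p \/ e = q) -> In z (half_space_steiner k xs yy mk eps r h e)).
  { intros e Hpq. unfold half_space_steiner. fold N rho eta.
    apply (in_map (fun code => mk (fun i => h * grid_coord rho eta code i)
      (h * grid_coord rho eta code k))).
    apply Hcode. intros i Hi _. rewrite <- HMc by lia.
    assert (Rabs (chart k xs yy h M i - chart k xs yy h e i) <= 111 * r); [|lra].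
    apply (chart_box d k xs yy h r T); auto; try lra; try lia.
    - destruct Hpq as [-> | ->]; auto.
    - destruct Hcase as [[C1 C2]|C].
      + left. destruct Hpq as [-> | ->]; lra.
      + right. split; auto. intros i' Hi'. destruct (Hweight i' Hi').
        destruct Hpq as [-> | ->]; lra. }
  exists z. split; [apply Hin; auto|]. split; [apply Hin; auto|].
  pose proof (Hy M) as YM.
  (* Rounding leaves the height well above zero, so [mk] returns the intended point and [yy z] can
     serve as a denominator. *)
  assert (Hvk : T / 18 <= h * grid_coord rho eta code k).
  { pose proof (Hclose k ltac:(lia) ltac:(lia)) as Hk. rewrite <- HMc in Hk by lia.
    unfold chart in Hk. rewrite Nat.eqb_refl in Hk. apply Rabs_le_inv in Hk.
    assert (E1 : h * (yy M / h - eta) <= h * grid_coord rho eta code k)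
      by (apply Rmult_le_compat_l; lra).
    replace (h * (yy M / h - eta)) with (yy M - h * eta) in E1 by (field; lra).
    assert (h * eta <= 4 * T * (1 / 216)) by (apply Rmult_le_compat; lra). lra. }
  destruct (Hmk (fun i => h * grid_coord rho eta code i) (h * grid_coord rho eta code k)) as [Z1 Z2];
    [lra|]. fold z in Z1, Z2.
  pose proof (chart_sqr_dist d k xs yy h z M HH Hh) as E.
  assert (Hs : rsum (S k) (fun i => (chart k xs yy h z i - chart k xs yy h M i) ^ 2) <=
    N * (eta * eta)).
  { unfold N. rewrite <- rsum_const. apply rsum_le. intros i Hi.
    assert (Hzi : chart k xs yy h z i = grid_coord rho eta code i).
    { unfold chart. destruct (Nat.eqb_spec i k) as [->|].
      - rewrite Z1. field; lra.
      - rewrite Z2 by lia. field; lra. }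
    rewrite Hzi, HMc by lia. pose proof (Hclose i Hi ltac:(lia)) as Hk.
    apply Rabs_le_inv in Hk. clear - Hk. nra. }
  set (c := cosh (d z M)) in *.
  assert (Hc1 : 1 <= c) by apply cosh_ge_1.
  assert (Hcb : c - 1 <= 1296 * (N * (eta * eta))).
  { assert (Hyy : T / 18 * (T / 9) <= yy z * yy M) by (apply Rmult_le_compat; lra).
    assert (H1 : 2 * (T / 18 * (T / 9)) * (c - 1) <= N * (eta * eta) * (h * h)).
    { apply Rle_trans with (2 * yy z * yy M * (c - 1)).
      - apply Rmult_le_compat_r; lra.
      - rewrite <- E. apply Rmult_le_compat_r; [apply Rle_0_sqr|auto]. }
    assert (H2 : N * (eta * eta) * (h * h) <= N * (eta * eta) * (16 * (T * T))).
    { apply Rmult_le_compat_l; auto. apply Rmult_le_pos; [lra|apply Rle_0_sqr]. }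
    apply Rmult_le_reg_l with (T * T); [auto|]. lra. }
  pose proof (hyperbolic_excess a (D - a) (d z p) (d z q) c) as Hex.
  replace (a + (D - a)) with D in Hex by ring. specialize (Hex ltac:(lra) ltac:(lra) (A4 z)).
  assert (Hct : forall x, r / 3 <= x -> cosh x / sinh x <= 7 / 2 / r).
  { intros x Hxx. eapply Rle_trans; [apply coth_upper; lra|].
    assert (1 / x <= 1 / (r / 3)).
    { apply Rmult_le_compat_l; [lra|]. apply Rinv_le_contravar; lra. }
    assert (E1 : 1 / (r / 3) = 3 / r) by (field; lra).
    assert (1 <= 1 / 2 / r).
    { apply Rmult_le_reg_r with r; [lra|]. unfold Rdiv. rewrite (Rmult_assoc _ (/ r)), Rinv_l; lra. }
    assert (7 / 2 / r = 3 / r + 1 / 2 / r) by (field; lra). lra. }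
  pose proof (Hct a ltac:(lra)) as C1. pose proof (Hct (D - a) ltac:(lra)) as C2.
  assert (Hexc : (cosh a / sinh a + cosh (D - a) / sinh (D - a)) * (c - 1) <= eps * r).
  { apply Rle_trans with (7 / r * (1296 * (N * (eta * eta)))).
    - assert (7 / 2 / r + 7 / 2 / r = 7 / r) by (field; lra).
      apply Rmult_le_compat; try lra.
      pose proof (sinh_pos a ltac:(lra)). pose proof (sinh_pos (D - a) ltac:(lra)).
      pose proof (cosh_ge_1 a). pose proof (cosh_ge_1 (D - a)).
      assert (0 <= cosh a / sinh a) by (left; apply Rdiv_lt_0_compat; lra).
      assert (0 <= cosh (D - a) / sinh (D - a)) by (left; apply Rdiv_lt_0_compat; lra). lra.
    - replace (7 / r * (1296 * (N * (eta * eta)))) with (9072 / 11664 * (eps * r) / N).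
      + apply Rmult_le_reg_r with N; [lra|].
        replace (9072 / 11664 * (eps * r) / N * N) with (9072 / 11664 * (eps * r)) by (field; lra).
        assert (0 <= eps * r) by (apply Rmult_le_pos; lra).
        apply Rle_trans with (eps * r * 1); [|apply Rmult_le_compat_l]; lra.
      + unfold eta. rewrite <- Hrt at 1. field. lra. }
  rewrite (Hsym p z). assert (eps * r <= eps * D) by (apply Rmult_le_compat_l; lra). lra.
Qed.

(** * The hyperboloid *)

Definition minkowski (d : nat) (x y : nat -> R) : R :=
  x 0%nat * y 0%nat - rsum d (fun i => x (S i) * y (S i)).

Lemma minkowski_dot d x y :
  minkowski d x y = x 0%nat * y 0%nat - dot d (fun i => x (S i)) (fun i => y (S i)).
Proof. reflexivity. Qed.

Lemma minkowski_sym d x y : minkowski d x y = minkowski d y x.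
Proof. rewrite !minkowski_dot, dot_sym. ring. Qed.

Lemma minkowski_comb d a b x y z :
  minkowski d (fun i => a * x i + b * y i) z = a * minkowski d x z + b * minkowski d y z.
Proof. rewrite !minkowski_dot, (dot_comb d a b (fun i => x (S i)) (fun i => y (S i))). ring. Qed.

Lemma minkowski_comb_r d a b x y z :
  minkowski d z (fun i => a * x i + b * y i) = a * minkowski d z x + b * minkowski d z y.
Proof. rewrite minkowski_sym, minkowski_comb, !(minkowski_sym d z); auto. Qed.

Definition hyperboloid (d : nat) (x : nat -> R) : Prop := 0 < x 0%nat /\ minkowski d x x = 1.

Lemma model_hyperboloid d x : model_pt Hyperbolic d x -> hyperboloid d x.
Proof.
  intros (_ & H1 & H2). split; auto. rewrite <- H2. unfold minkowski.
  rewrite (rsum_ext d (fun i => x (S i) * x (S i)) (fun i => x (S i) ^ 2)) by (intros; ring). ring.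
Qed.

Lemma hyperboloid_minkowski_ge_1 d x y :
  hyperboloid d x -> hyperboloid d y -> 1 <= minkowski d x y.
Proof.
  rewrite !minkowski_dot. unfold hyperboloid. rewrite !minkowski_dot.
  intros [X0 X1] [Y0 Y1].
  set (u := fun i => x (S i)) in *. set (v := fun i => y (S i)) in *.
  pose proof (cauchy_schwarz d u v). pose proof (dot_self d u). pose proof (dot_self d v).
  assert (1 <= x 0%nat) by nra. assert (1 <= y 0%nat) by nra.
  assert (dot d u v <= x 0%nat * y 0%nat - 1); [|lra].
  apply Rsqr_le_inv; [nra|].
  eapply Rle_trans; [eassumption|].
  replace (dot d u u) with (x 0%nat * x 0%nat - 1) by lra.
  replace (dot d v v) with (y 0%nat * y 0%nat - 1) by lra.
  pose proof (Rle_0_sqr (x 0%nat - y 0%nat)). unfold Rsqr in *. lra.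
Qed.

(** Reverse Cauchy-Schwarz: the form is negative semidefinite on the complement of a timelike
    vector. It replaces [dot_self] in the hyperbolic triangle inequality. *)
Lemma minkowski_orthogonal d w y :
  hyperboloid d y -> minkowski d w y = 0 -> minkowski d w w <= 0.
Proof.
  unfold hyperboloid. rewrite !minkowski_dot. intros [Y0 Y1] H.
  set (u := fun i => w (S i)) in *. set (v := fun i => y (S i)) in *.
  pose proof (cauchy_schwarz d u v). pose proof (dot_self d u).
  assert (E : dot d u v * dot d u v = (w 0%nat * w 0%nat) * (y 0%nat * y 0%nat)).
  { replace (dot d u v) with (w 0%nat * y 0%nat) by lra. ring. }
  assert (dot d v v = y 0%nat * y 0%nat - 1) by lra.
  assert (Hy : 0 < y 0%nat * y 0%nat) by nra.
  assert (w 0%nat * w 0%nat <= dot d u u); [|lra].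
  apply Rmult_le_reg_r with (y 0%nat * y 0%nat); auto. nra.
Qed.

Lemma cosh_arcosh t : 1 <= t -> cosh (arcosh t) = t.
Proof.
  intro Ht. unfold arcosh.
  assert (E : sqrt (t ^ 2 - 1) * sqrt (t ^ 2 - 1) = t ^ 2 - 1) by (apply sqrt_def; nra).
  pose proof (sqrt_pos (t ^ 2 - 1)). set (s := sqrt (t ^ 2 - 1)) in *.
  rewrite cosh_ln by lra.
  assert (I : / (t + s) = t - s).
  { apply Rmult_eq_reg_l with (t + s); [|lra]. rewrite Rinv_r by lra.
    replace ((t + s) * (t - s)) with (t ^ 2 - s * s) by ring. rewrite E. ring. }
  rewrite I. field.
Qed.

Lemma arcosh_nonneg t : 1 <= t -> 0 <= arcosh t.
Proof. intro. apply ln_nonneg. pose proof (sqrt_pos (t ^ 2 - 1)). lra. Qed.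

Lemma arcosh_1 : arcosh 1 = 0.
Proof. unfold arcosh. replace (1 ^ 2 - 1) with 0 by ring. rewrite sqrt_0, Rplus_0_r. apply ln_1. Qed.

(** Projecting [x + t z] off [y] gives a vector of nonpositive square for every [t]; the
    discriminant of this quadratic bounds [cxz - cxy * cyz] by the product of the two [sinh], which
    is the addition formula for [cosh]. *)
Lemma arcosh_minkowski_triangle d x y z :
  hyperboloid d x -> hyperboloid d y -> hyperboloid d z ->
  arcosh (minkowski d x z) <= arcosh (minkowski d x y) + arcosh (minkowski d y z).
Proof.
  intros Hx Hy Hz.
  pose proof (hyperboloid_minkowski_ge_1 d x y Hx Hy) as A1.
  pose proof (hyperboloid_minkowski_ge_1 d y z Hy Hz) as B1.
  pose proof (hyperboloid_minkowski_ge_1 d x z Hx Hz) as C1.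
  pose proof (arcosh_nonneg _ A1) as A2. pose proof (arcosh_nonneg _ B1) as B2.
  pose proof (cosh_arcosh _ A1) as A3. pose proof (cosh_arcosh _ B1) as B3.
  pose proof (cosh_arcosh _ C1) as C3.
  set (a := arcosh (minkowski d x y)) in *. set (b := arcosh (minkowski d y z)) in *.
  apply cosh_le_inv; [lra|]. rewrite cosh_plus, A3, B3, C3.
  pose proof (sinh_nonneg a A2) as Sa. pose proof (sinh_nonneg b B2) as Sb.
  pose proof (cosh_sinh a) as Ea. pose proof (cosh_sinh b) as Eb. rewrite A3 in Ea. rewrite B3 in Eb.
  assert (H : minkowski d x z - minkowski d x y * minkowski d y z <= sinh a * sinh b); [|lra].
  apply Rsqr_le_inv; [nra|].
  replace (sinh a * sinh b * (sinh a * sinh b)) with ((sinh a * sinh a) * (sinh b * sinh b)) by ring.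
  replace (sinh a * sinh a) with (minkowski d x y * minkowski d x y - 1) by lra.
  replace (sinh b * sinh b) with (minkowski d y z * minkowski d y z - 1) by lra.
  set (cxy := minkowski d x y) in *. set (cyz := minkowski d y z) in *.
  set (cxz := minkowski d x z) in *.
  apply discriminant_bound; [nra|]. intro t.
  pose proof (minkowski_orthogonal d
    (fun i => 1 * (1 * x i + t * z i) + (- (cxy + t * cyz)) * y i) y Hy) as Ho.
  rewrite !minkowski_comb, !minkowski_comb_r in Ho.
  rewrite (minkowski_sym d z y), (minkowski_sym d z x), (minkowski_sym d y x) in Ho.
  fold cxy cyz cxz in Ho.
  rewrite (proj2 Hx), (proj2 Hy), (proj2 Hz) in Ho.
  specialize (Ho ltac:(ring)). lra.
Qed.

(** Half-space coordinates with the ideal point [(1, 0, ..., 0, 1)] at infinity: the light-cone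
    coordinate [x 0 - x (S k)] is the inverse height. *)
Definition hx_coord (k : nat) (x : nat -> R) : nat -> R := fun i => x (S i) / (x 0%nat - x (S k)).
Definition hy_coord (k : nat) (x : nat -> R) : R := / (x 0%nat - x (S k)).

Lemma hyperboloid_lightcone k x : hyperboloid (S k) x ->
  0 < x 0%nat - x (S k) /\
  ((x 0%nat - x (S k)) * (x 0%nat + x (S k)) = 1 + rsum k (fun i => x (S i) * x (S i))).
Proof.
  intros [H0 H1]. unfold minkowski in H1. cbn [rsum] in H1.
  assert (0 <= rsum k (fun i => x (S i) * x (S i))) by (apply rsum_nonneg; intros; nra).
  split; [nra|lra].
Qed.

Lemma minkowski_half_space k x y : hyperboloid (S k) x -> hyperboloid (S k) y ->
  minkowski (S k) x y =
  (edist k (hx_coord k x) (hx_coord k y) * edist k (hx_coord k x) (hx_coord k y) +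
   hy_coord k x * hy_coord k x + hy_coord k y * hy_coord k y) / (2 * hy_coord k x * hy_coord k y).
Proof.
  intros Hx Hy. destruct (hyperboloid_lightcone k x Hx) as [W1 W2].
  destruct (hyperboloid_lightcone k y Hy) as [V1 V2].
  rewrite edist_expand. unfold hx_coord, hy_coord, minkowski, dot. cbn [rsum].
  set (w := x 0%nat - x (S k)) in *. set (v := y 0%nat - y (S k)) in *.
  rewrite (rsum_ext k (fun i => x (S i) / w * (x (S i) / w))
    (fun i => / (w * w) * (x (S i) * x (S i)))) by (intros; field; lra).
  rewrite (rsum_ext k (fun i => y (S i) / v * (y (S i) / v))
    (fun i => / (v * v) * (y (S i) * y (S i)))) by (intros; field; lra).
  rewrite (rsum_ext k (fun i => x (S i) / w * (y (S i) / v))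
    (fun i => / (w * v) * (x (S i) * y (S i)))) by (intros; field; lra).
  rewrite !rsum_scal.
  replace (rsum k (fun i => x (S i) * x (S i))) with (w * (x 0%nat + x (S k)) - 1) by lra.
  replace (rsum k (fun i => y (S i) * y (S i))) with (v * (y 0%nat + y (S k)) - 1) by lra.
  replace (x 0%nat) with (w + x (S k)) by (unfold w; ring).
  replace (y 0%nat) with (v + y (S k)) by (unfold v; ring).
  field. lra.
Qed.

(** Inverse of the half-space coordinates: [w'] is the other light-cone coordinate, the sum of
    coordinates [0] and [S k], determined by the hyperboloid equation; their difference is [/ h]. *)
Definition hmodel_coords (k : nat) (x : nat -> R) (h : R) (i : nat) : R :=
  let w' := (h * h + dot k x x) / h in
  if Nat.eqb i 0 then (/ h + w') / 2
  else if Nat.eqb i (S k) then (w' - / h) / 2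
  else if Nat.ltb i (S k) then x (i - 1)%nat / h else 0.

Lemma hmodel_coords_spec k x h : 0 < h ->
  model_pt Hyperbolic (S k) (hmodel_coords k x h) /\
  hy_coord k (hmodel_coords k x h) = h /\
  forall i, (i < k)%nat -> hx_coord k (hmodel_coords k x h) i = x i.
Proof.
  intro Hh. set (w' := (h * h + dot k x x) / h).
  pose proof (dot_self k x).
  assert (Hw' : 0 < w') by (apply Rdiv_lt_0_compat; nra).
  assert (Hh' : 0 < / h) by (apply Rinv_0_lt_compat; auto).
  assert (E0 : hmodel_coords k x h 0 = (/ h + w') / 2) by reflexivity.
  assert (Ek : hmodel_coords k x h (S k) = (w' - / h) / 2).
  { unfold hmodel_coords. rewrite Nat.eqb_refl. reflexivity. }
  assert (Ei : forall i, (i < k)%nat -> hmodel_coords k x h (S i) = x i / h).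
  { intros i Hi. unfold hmodel_coords.
    destruct (Nat.eqb_spec (S i) 0); [lia|]. destruct (Nat.eqb_spec (S i) (S k)); [lia|].
    destruct (Nat.ltb_spec (S i) (S k)); [|lia]. simpl. rewrite Nat.sub_0_r; auto. }
  assert (Ew : hmodel_coords k x h 0 - hmodel_coords k x h (S k) = / h) by (rewrite E0, Ek; field; lra).
  split; [|split].
  - split; [|split].
    + intros i Hi. unfold hmodel_coords.
      destruct (Nat.eqb_spec i 0); [lia|]. destruct (Nat.eqb_spec i (S k)); [lia|].
      destruct (Nat.ltb_spec i (S k)); [lia|auto].
    + rewrite E0. lra.
    + cbn [rsum]. rewrite E0, Ek.
      rewrite (rsum_ext k (fun i => hmodel_coords k x h (S i) ^ 2)
        (fun i => / (h * h) * (x i * x i))) by (intros; rewrite Ei by auto; field; lra).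
      rewrite rsum_scal. fold (dot k x x). unfold w'. field. lra.
  - unfold hy_coord. rewrite Ew. apply Rinv_inv.
  - intros i Hi. unfold hx_coord. rewrite Ew, Ei by auto. field. lra.
Qed.

Lemma hyperboloid_comb d x y a b :
  hyperboloid d x -> hyperboloid d y -> 0 <= a -> 0 <= b ->
  a * a + b * b + 2 * a * b * minkowski d x y = 1 ->
  vanish_from (S d) x -> vanish_from (S d) y ->
  model_pt Hyperbolic d (fun i => a * x i + b * y i).
Proof.
  intros Hx Hy Ha Hb E Vx Vy. split; [|split].
  - intros i Hi. rewrite Vx, Vy by auto. ring.
  - destruct Hx as [X0 _], Hy as [Y0 _].
    destruct (Rle_lt_or_eq_dec 0 a Ha) as [Ha'|<-]; [nra|].
    destruct (Rle_lt_or_eq_dec 0 b Hb) as [Hb'|<-]; [nra|lra].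
  - assert (H : minkowski d (fun i => a * x i + b * y i) (fun i => a * x i + b * y i) = 1).
    { rewrite minkowski_comb, !minkowski_comb_r, (proj2 Hx), (proj2 Hy), (minkowski_sym d y x). lra. }
    unfold minkowski in H.
    rewrite (rsum_ext d (fun i => (a * x (S i) + b * y (S i)) * (a * x (S i) + b * y (S i)))
      (fun i => (a * x (S i) + b * y (S i)) ^ 2)) in H by (intros; ring).
    lra.
Qed.

Definition hx_model (k : nat) (p : model_space Hyperbolic (S k)) := hx_coord k (proj1_sig p).
Definition hy_model (k : nat) (p : model_space Hyperbolic (S k)) := hy_coord k (proj1_sig p).

(* Junk value for [h <= 0]: the point at height 1. *)
Definition half_space_point (k : nat) (x : nat -> R) (h : R) : model_space Hyperbolic (S k) :=
  match Rlt_dec 0 h with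
  | left H => exist _ (hmodel_coords k x h) (proj1 (hmodel_coords_spec k x h H))
  | right _ => exist _ (hmodel_coords k x 1) (proj1 (hmodel_coords_spec k x 1 Rlt_0_1))
  end.

Lemma half_space_point_spec k x h : 0 < h ->
  hy_model k (half_space_point k x h) = h /\
  forall i, (i < k)%nat -> hx_model k (half_space_point k x h) i = x i.
Proof.
  intro Hh. unfold half_space_point, hy_model, hx_model.
  destruct (Rlt_dec 0 h); [simpl|lra]. apply hmodel_coords_spec; auto.
Qed.

Lemma hyperbolic_metric d : pseudo_metric (model_dist Hyperbolic d).
Proof.
  assert (Hh : forall p : model_space Hyperbolic d, hyperboloid d (proj1_sig p)).
  { intros [x Hx]; apply model_hyperboloid; auto. }
  change (pseudo_metric (fun p q : model_space Hyperbolic d =>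
    arcosh (minkowski d (proj1_sig p) (proj1_sig q)))).
  split; [|split; [|split]].
  - intro x. rewrite (proj2 (Hh x)). apply arcosh_1.
  - intros x y. rewrite minkowski_sym; auto.
  - intros x y. apply arcosh_nonneg, hyperboloid_minkowski_ge_1; auto.
  - intros x y z. apply arcosh_minkowski_triangle; auto.
Qed.

Lemma cosh_hyperbolic_dist d (p q : model_space Hyperbolic d) :
  cosh (model_dist Hyperbolic d p q) = minkowski d (proj1_sig p) (proj1_sig q).
Proof.
  apply cosh_arcosh, hyperboloid_minkowski_ge_1; apply model_hyperboloid, proj2_sig.
Qed.

Lemma hyperbolic_half_space k :
  half_space (model_dist Hyperbolic (S k)) (fun p q => edist k (hx_model k p) (hx_model k q))
    (hy_model k).
Proof.
  split; [apply hyperbolic_metric|]. split; [|split].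
  - apply (pseudo_metric_pullback (hx_model k) (edist k)), edist_metric.
  - intros [x Hx]. apply Rinv_0_lt_compat, hyperboloid_lightcone, model_hyperboloid; auto.
  - intros p q. rewrite cosh_hyperbolic_dist.
    apply minkowski_half_space; apply model_hyperboloid, proj2_sig.
Qed.

Lemma hyperbolic_geodesic_points k :
  geodesic_points (model_dist Hyperbolic (S k)) k (hx_model k) (hy_model k).
Proof.
  intros p q a b Ha Hb E. rewrite cosh_hyperbolic_dist in E.
  pose proof (model_hyperboloid _ _ (proj2_sig p)) as Hp.
  pose proof (model_hyperboloid _ _ (proj2_sig q)) as Hq.
  pose proof (hyperboloid_comb (S k) _ _ a b Hp Hq Ha Hb E (proj1 (proj2_sig p))
    (proj1 (proj2_sig q))) as HM.
  pose proof (hyperboloid_lightcone k _ (model_hyperboloid _ _ HM)) as [WM _].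
  pose proof (hyperboloid_lightcone k _ Hp) as [Wp _].
  pose proof (hyperboloid_lightcone k _ Hq) as [Wq _].
  cbv beta in WM.
  exists (exist _ _ HM). unfold hy_model, hx_model, hy_coord, hx_coord. cbn [proj1_sig].
  rewrite !Rinv_inv. split; [|split].
  - unfold Rdiv. rewrite !Rinv_inv. ring.
  - intros i Hi. field. repeat split; apply Rgt_not_eq; assumption.
  - intro z. rewrite !cosh_hyperbolic_dist. simpl. apply minkowski_comb_r.
Qed.

(** * The sphere *)

Lemma sin_lipschitz x y : Rabs (sin x - sin y) <= Rabs (x - y).
Proof.
  assert (H : forall x y, x < y -> Rabs (sin y - sin x) <= Rabs (y - x)).
  { intros u v Huv. destruct (MVT_cor2 sin cos u v Huv) as (c & Hc & _).
    { intros; apply derivable_pt_lim_sin. }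
    rewrite Hc, Rabs_mult. pose proof (COS_bound c). pose proof (Rabs_pos (v - u)).
    assert (Rabs (cos c) <= 1) by (apply Rabs_le; lra). nra. }
  destruct (Rtotal_order x y) as [Hl|[->|Hl]].
  - rewrite (Rabs_minus_sym (sin x)), (Rabs_minus_sym x). auto.
  - unfold Rminus. rewrite !Rplus_opp_r. lra.
  - apply H; auto.
Qed.

Lemma sin_abs_le x : Rabs (sin x) <= Rabs x.
Proof. pose proof (sin_lipschitz x 0). rewrite sin_0, !Rminus_0_r in H. auto. Qed.

Lemma one_minus_cos x : 1 - cos x = 2 * (sin (x / 2) * sin (x / 2)).
Proof.
  replace x with (2 * (x / 2)) at 1 by field. rewrite cos_2a_sin. ring.
Qed.

Lemma cos_lower x : 1 - x * x / 2 <= cos x.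
Proof.
  pose proof (one_minus_cos x). pose proof (sin_abs_le (x / 2)).
  assert (sin (x / 2) * sin (x / 2) <= (x / 2) * (x / 2)); [|lra].
  apply Rsqr_le_abs_1; auto.
Qed.

(** [PI <= 4] gives [x * x <= 4], and the Taylor bound [x - x ^ 3 / 6] is then at least [x / 3]. *)
Lemma sin_ge_third x : 0 <= x <= PI / 2 -> x / 3 <= sin x.
Proof.
  intros [H0 H1]. pose proof PI_4.
  destruct (pre_sin_bound x 0 H0) as [Hs _]; [lra|].
  unfold sin_approx, sin_term in Hs. simpl in Hs.
  assert (x * x <= 2 * 2) by (apply Rmult_le_compat; lra).
  assert (x * (x * x) <= x * (2 * 2)) by (apply Rmult_le_compat_l; lra).
  field_simplify in Hs. lra.
Qed.

Lemma cos_upper x : 0 <= x <= PI -> cos x <= 1 - x * x / 18.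
Proof.
  intros Hx. pose proof (one_minus_cos x). pose proof (sin_ge_third (x / 2)).
  assert ((x / 2 / 3) * (x / 2 / 3) <= sin (x / 2) * sin (x / 2)) by (apply Rmult_le_compat; lra).
  lra.
Qed.

(** Substitute for the tangent bound of [cosh], at the price of a quadratic term because [cos] is
    not convex. The difference of the two sides has a derivative with the sign of its argument,
    [sin] being 1-Lipschitz. *)
Lemma cos_taylor a x : cos (a + x) <= cos a - x * sin a + x * x / 2.
Proof.
  set (f := fun x => x * x / 2 - x * sin a - cos (a + x)).
  set (f' := fun x => x - sin a + sin (a + x)).
  assert (Hd : forall c, derivable_pt_lim f c (f' c)).
  { intro c. unfold f, f'.
    replace (c - sin a + sin (a + c)) with
      (((1 * c + c * 1) * / 2 + (c * c) * 0) - (1 * sin a + c * 0) - (- sin (a + c)) * (0 + 1))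
      by field.
    apply (derivable_pt_lim_minus (fun x => x * x / 2 - x * sin a) (fun x => cos (a + x))).
    - apply (derivable_pt_lim_minus (fun x => x * x / 2) (fun x => x * sin a)).
      + apply (derivable_pt_lim_mult (fun x => x * x) (fun _ => / 2)).
        * apply (derivable_pt_lim_mult id id); apply derivable_pt_lim_id.
        * apply derivable_pt_lim_const.
      + apply (derivable_pt_lim_mult id (fun _ => sin a)).
        * apply derivable_pt_lim_id.
        * apply derivable_pt_lim_const.
    - apply (derivable_pt_lim_comp (fun x => a + x) cos).
      + apply (derivable_pt_lim_plus (fun _ => a) id).
        * apply derivable_pt_lim_const.
        * apply derivable_pt_lim_id.
      + apply derivable_pt_lim_cos. }
  assert (Hsign : forall c, 0 <= f' c * c).
  { intro c. unfold f'. pose proof (sin_lipschitz (a + c) a) as H.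
    replace (a + c - a) with c in H by ring.
    unfold Rabs in H. destruct (Rcase_abs c), Rcase_abs; nra. }
  assert (H0 : f 0 = - cos a) by (unfold f; rewrite Rplus_0_r; field).
  assert (Hx : f 0 <= f x).
  { destruct (Rtotal_order 0 x) as [Hl|[<-|Hl]]; [|lra|].
    - destruct (MVT_cor2 f f' 0 x Hl) as (c & Hc & Hc'); auto.
      specialize (Hsign c). assert (0 <= f' c) by nra. nra.
    - destruct (MVT_cor2 f f' x 0 Hl) as (c & Hc & Hc'); auto.
      specialize (Hsign c). assert (f' c <= 0) by nra. nra. }
  unfold f in Hx at 2. lra.
Qed.

(** Stewart's relation is again linearized, but the quadratic term of [cos_taylor] survives; the
    triangle inequalities bounding [u - a] and [v - b] by [h] make it as small as the excess
    itself. *)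
Lemma spherical_excess a b u v h :
  0 < sin a -> 0 < sin b -> sin (a + b) * cos h = sin b * cos u + sin a * cos v ->
  Rabs (u - a) <= h -> Rabs (v - b) <= h ->
  u + v <= a + b + h * h * (/ sin a + / sin b).
Proof.
  intros Ha Hb E Hu Hv.
  pose proof (cos_taylor a (u - a)) as Tu. replace (a + (u - a)) with u in Tu by ring.
  pose proof (cos_taylor b (v - b)) as Tv. replace (b + (v - b)) with v in Tv by ring.
  apply Rabs_le_inv in Hu, Hv.
  assert (Qu : (u - a) * (u - a) <= h * h) by nra.
  assert (Qv : (v - b) * (v - b) <= h * h) by nra.
  pose proof (cos_lower h) as Ch. pose proof (COS_bound a). pose proof (COS_bound b).
  pose proof (COS_bound h).
  rewrite sin_plus in E.
  apply Rmult_le_reg_r with (sin a * sin b); [nra|].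
  replace ((a + b + h * h * (/ sin a + / sin b)) * (sin a * sin b)) with
    ((a + b) * (sin a * sin b) + h * h * (sin a + sin b)) by (field; lra).
  assert (U1 : sin b * ((u - a) * sin a) <= sin b * (cos a - cos u + h * h / 2))
    by (apply Rmult_le_compat_l; lra).
  assert (V1 : sin a * ((v - b) * sin b) <= sin a * (cos b - cos v + h * h / 2))
    by (apply Rmult_le_compat_l; lra).
  assert (C1 : sin b * (cos a * (1 - cos h)) <= sin b * (h * h / 2)).
  { apply Rmult_le_compat_l; [lra|]. nra. }
  assert (C2 : sin a * (cos b * (1 - cos h)) <= sin a * (h * h / 2)).
  { apply Rmult_le_compat_l; [lra|]. nra. }
  lra.
Qed.

(** * Unit vectors, the angular metric and gnomonic charts *)

Definition unit_vector (n : nat) (x : nat -> R) : Prop := dot n x x = 1.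

Lemma model_unit_vector d x : model_pt Spherical d x -> unit_vector (S d) x.
Proof.
  intros [_ H]. unfold unit_vector, dot. rewrite <- H. apply rsum_ext; intros; ring.
Qed.

Lemma unit_vector_dot n x y : unit_vector n x -> unit_vector n y -> -1 <= dot n x y <= 1.
Proof.
  intros Hx Hy. pose proof (cauchy_schwarz n x y) as H. rewrite Hx, Hy in H. nra.
Qed.

Lemma unit_vector_coord n x i : unit_vector n x -> (i < n)%nat -> -1 <= x i <= 1.
Proof.
  intros Hx Hi. assert (x i * x i <= 1); [|nra].
  rewrite <- Hx. apply (rsum_term n (fun i => x i * x i)); auto. intros; nra.
Qed.

Lemma acos_dot_triangle n x y z :
  unit_vector n x -> unit_vector n y -> unit_vector n z ->
  acos (dot n x z) <= acos (dot n x y) + acos (dot n y z).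
Proof.
  intros Hx Hy Hz.
  pose proof (unit_vector_dot n x y Hx Hy) as A1. pose proof (unit_vector_dot n y z Hy Hz) as B1.
  pose proof (unit_vector_dot n x z Hx Hz) as C1.
  pose proof (acos_bound (dot n x y)) as A2. pose proof (acos_bound (dot n y z)) as B2.
  pose proof (acos_bound (dot n x z)) as C2.
  destruct (Rle_lt_dec PI (acos (dot n x y) + acos (dot n y z))) as [Hbig|Hsmall]; [lra|].
  apply cos_decr_0; try lra. rewrite cos_plus, !cos_acos by auto.
  set (sa := sin (acos (dot n x y))). set (sb := sin (acos (dot n y z))).
  assert (Sa : 0 <= sa) by (apply sin_ge_0; lra). assert (Sb : 0 <= sb) by (apply sin_ge_0; lra).
  pose proof (sin2_cos2 (acos (dot n x y))) as Ea. pose proof (sin2_cos2 (acos (dot n y z))) as Eb.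
  rewrite cos_acos in Ea, Eb by auto. unfold Rsqr in Ea, Eb. fold sa in Ea. fold sb in Eb.
  assert (H : dot n x y * dot n y z - dot n x z <= sa * sb); [|lra].
  apply Rsqr_le_inv; [nra|].
  replace (sa * sb * (sa * sb)) with ((sa * sa) * (sb * sb)) by ring.
  replace (sa * sa) with (1 - dot n x y * dot n x y) by lra.
  replace (sb * sb) with (1 - dot n y z * dot n y z) by lra.
  set (cxy := dot n x y) in *. set (cyz := dot n y z) in *. set (cxz := dot n x z) in *.
  apply discriminant_bound; [nra|]. intro t.
  pose proof (dot_self n (fun i => 1 * (1 * x i + t * z i) + (- (cxy + t * cyz)) * y i)) as Ho.
  rewrite !dot_comb, !dot_comb_r in Ho.
  rewrite (dot_sym n z y), (dot_sym n z x), (dot_sym n y x) in Ho.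
  fold cxy cyz cxz in Ho. unfold unit_vector in *. rewrite Hx, Hy, Hz in Ho. lra.
Qed.

Lemma spherical_metric d : pseudo_metric (model_dist Spherical d).
Proof.
  assert (Hh : forall p : model_space Spherical d, unit_vector (S d) (proj1_sig p)).
  { intros [x Hx]; apply model_unit_vector; auto. }
  change (pseudo_metric (fun p q : model_space Spherical d =>
    acos (dot (S d) (proj1_sig p) (proj1_sig q)))).
  split; [|split; [|split]].
  - intro x. rewrite (Hh x). apply acos_1.
  - intros x y. rewrite dot_sym; auto.
  - intros x y. apply acos_bound.
  - intros x y z. apply acos_dot_triangle; auto.
Qed.

(** The right side is [(la - mu)^2 + la * mu * (2 - 2 * dot n x y)]. Gnomonic projection scales by
    factors at least 1, so chart distances dominate chords: this gives both the motion of the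
    geodesic in the chart and the closeness of the rounded point. *)
Lemma rescaled_dist n x y la mu :
  unit_vector n x -> unit_vector n y -> 1 <= la -> 1 <= mu ->
  2 - 2 * dot n x y <= rsum n (fun i => (la * x i - mu * y i) ^ 2).
Proof.
  intros Hx Hy Hl Hm. pose proof (unit_vector_dot n x y Hx Hy).
  assert (E : rsum n (fun i => (la * x i - mu * y i) ^ 2) =
    la * la + mu * mu - 2 * la * mu * dot n x y).
  { rewrite (rsum_ext n _ (fun i => (la * x i + (- mu) * y i) * (la * x i + (- mu) * y i)))
      by (intros; ring).
    fold (dot n (fun i => la * x i + (- mu) * y i) (fun i => la * x i + (- mu) * y i)).
    rewrite dot_comb, !dot_comb_r, (dot_sym n y x).
    unfold unit_vector in *. rewrite Hx, Hy. ring. }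
  rewrite E.
  assert (1 <= la * mu) by nra.
  assert (0 <= (la - mu) * (la - mu)) by apply Rle_0_sqr.
  assert (1 * (2 - 2 * dot n x y) <= la * mu * (2 - 2 * dot n x y))
    by (apply Rmult_le_compat_r; lra).
  lra.
Qed.

Lemma chord_le_angle n x y i :
  unit_vector n x -> unit_vector n y -> (i < n)%nat -> Rabs (x i - y i) <= acos (dot n x y).
Proof.
  intros Hx Hy Hi. apply Rsqr_le_inv; [apply acos_bound|].
  rewrite <- Rabs_mult, Rabs_right by apply Rle_ge, Rle_0_sqr.
  pose proof (cos_lower (acos (dot n x y))) as H.
  rewrite cos_acos in H by (apply unit_vector_dot; auto).
  pose proof (rsum_term n (fun i => (x i - y i) ^ 2) i) as Ht. cbv beta in Ht.
  specialize (Ht ltac:(intros; apply pow2_ge_0) Hi).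
  assert (E : rsum n (fun i => (x i - y i) ^ 2) = 2 - 2 * dot n x y).
  { rewrite <- edist_sqr, edist_expand. unfold unit_vector in *. rewrite Hx, Hy. ring. }
  lra.
Qed.

(** Central projection of the open hemisphere [sg * x j > 0] to the tangent hyperplane where
    coordinate [j] equals [sg]. *)
Definition gnomonic_vector (d j : nat) (sg : R) (v : nat -> R) (i : nat) : R :=
  if Nat.eqb i j then sg else if Nat.ltb i (S d) then v i else 0.

Definition gnomonic_norm d j sg v : R :=
  sqrt (dot (S d) (gnomonic_vector d j sg v) (gnomonic_vector d j sg v)).

Lemma gnomonic_norm_ge_1 d j sg v : (j <= d)%nat -> sg * sg = 1 ->
  1 <= gnomonic_norm d j sg v /\
  gnomonic_norm d j sg v * gnomonic_norm d j sg v =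
    dot (S d) (gnomonic_vector d j sg v) (gnomonic_vector d j sg v).
Proof.
  intros Hj Hs. set (w := gnomonic_vector d j sg v).
  assert (1 <= dot (S d) w w).
  { rewrite <- Hs. replace sg with (w j) by (unfold w, gnomonic_vector; rewrite Nat.eqb_refl; auto).
    apply (rsum_term (S d) (fun i => w i * w i)); [intros; nra|lia]. }
  split.
  - rewrite <- sqrt_1. apply sqrt_le_1_alt; auto.
  - apply sqrt_def. lra.
Qed.

Lemma basepoint_model d : model_pt Spherical d (fun i => if Nat.eqb i 0 then 1 else 0).
Proof.
  split.
  - intros i Hi. destruct (Nat.eqb_spec i 0); [lia|auto].
  - induction d; cbn [rsum] in *; [simpl; ring|]. rewrite IHd. simpl. ring.
Qed.

Lemma gnomonic_point_model d j sg v : (j <= d)%nat -> sg * sg = 1 ->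
  model_pt Spherical d (fun i => / gnomonic_norm d j sg v * gnomonic_vector d j sg v i).
Proof.
  intros Hj Hs. destruct (gnomonic_norm_ge_1 d j sg v Hj Hs) as [H1 H2]. split.
  - intros i Hi. unfold gnomonic_vector. destruct (Nat.eqb_spec i j); [lia|].
    destruct (Nat.ltb_spec i (S d)); [lia|ring].
  - rewrite (rsum_ext (S d) _ (fun i => / (gnomonic_norm d j sg v * gnomonic_norm d j sg v) *
      (gnomonic_vector d j sg v i * gnomonic_vector d j sg v i))) by (intros; field; lra).
    rewrite rsum_scal. fold (dot (S d) (gnomonic_vector d j sg v) (gnomonic_vector d j sg v)).
    rewrite <- H2. field. lra.
Qed.

Definition sphere_basepoint (d : nat) : model_space Spherical d := exist _ _ (basepoint_model d).

(* Junk value outside the range of charts: the base point. *)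
Definition gnomonic_point (d j : nat) (sg : R) (v : nat -> R) : model_space Spherical d :=
  match le_dec j d, Req_dec_T (sg * sg) 1 with
  | left Hj, left Hs => exist _ _ (gnomonic_point_model d j sg v Hj Hs)
  | _, _ => sphere_basepoint d
  end.

(* Off the chart (the case [0]) the scale is at least of order [1 / N^2], and a box of that size
   around the origin contains everything. *)
Definition gnomonic_center (d j : nat) (sg : R) (x : nat -> R) (i : nat) : R :=
  if Rle_dec (1 / (4 * INR (S d))) (sg * x j) then x i / (sg * x j) else 0.

(** Charts for all coordinates and both signs are listed because the one containing the midpoint of
    a geodesic depends on the other end too. The base point serves antipodal pairs. The radius is
    the [128 * (N * N) * r] of [gnomonic_center_close] plus room for rounding. *)
Definition sphere_steiner (d : nat) (eps r : R) (p : model_space Spherical d) :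
  list (model_space Spherical d) :=
  let N := INR (S d) in
  let rho := r / (16 * (N * N)) in
  let eta := sqrt eps * r / (16 * (N * N)) in
  sphere_basepoint d ::
  flat_map (fun j => flat_map (fun sg =>
    map (fun code => gnomonic_point d j sg (grid_coord rho eta code))
      (grid_codes (S d) j rho eta (gnomonic_center d j sg (proj1_sig p)) (129 * (N * N) * r)))
    (1 :: -1 :: nil)) (seq 0 (S d)).

(** Between antipodes every point lies on a shortest path, so one fixed Steiner point serves where
    the interpolation formula would divide by [sin PI = 0]. *)
Lemma antipodal_two_hop d (p q z : nat -> R) :
  unit_vector (S d) p -> unit_vector (S d) q -> acos (dot (S d) p q) = PI ->
  acos (dot (S d) p z) + acos (dot (S d) z q) = PI.
Proof.
  intros Hp Hq Hpi.
  assert (E : dot (S d) p q = -1).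
  { rewrite <- (cos_acos (dot (S d) p q)) by (apply unit_vector_dot; auto).
    rewrite Hpi. apply cos_PI. }
  assert (H0 : rsum (S d) (fun i => (p i + q i) ^ 2) = 0).
  { rewrite (rsum_ext (S d) _ (fun i => (1 * p i + 1 * q i) * (1 * p i + 1 * q i))) by (intros; ring).
    fold (dot (S d) (fun i => 1 * p i + 1 * q i) (fun i => 1 * p i + 1 * q i)).
    rewrite dot_comb, !dot_comb_r, (dot_sym (S d) q p), E.
    unfold unit_vector in *. rewrite Hp, Hq. ring. }
  assert (Hneg : forall i, (i < S d)%nat -> q i = - p i).
  { intros i Hi.
    pose proof (rsum_term (S d) (fun i => (p i + q i) ^ 2) i) as Ht. cbv beta in Ht.
    specialize (Ht ltac:(intros; apply pow2_ge_0) Hi). rewrite H0 in Ht. nra. }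
  assert (Ez : dot (S d) z q = - dot (S d) p z).
  { unfold dot. rewrite (rsum_ext (S d) _ (fun i => -1 * (p i * z i))), rsum_scal; [ring|].
    intros i Hi. rewrite Hneg by auto. ring. }
  rewrite Ez, acos_opp. ring.
Qed.

Lemma spherical_geodesic n (p q : nat -> R) D a :
  unit_vector n p -> unit_vector n q -> dot n p q = cos D -> 0 < sin D ->
  let M := fun i => sin (D - a) / sin D * p i + sin a / sin D * q i in
  unit_vector n M /\ dot n p M = cos a /\ dot n q M = cos (D - a) /\
  forall z, sin D * dot n z M = sin (D - a) * dot n z p + sin a * dot n z q.
Proof.
  intros Hp Hq Hpq HD M.
  assert (I1 : sin (D - a) + sin a * cos D = sin D * cos a) by (rewrite sin_minus; ring).
  pose proof (sin2_cos2 D) as ED. pose proof (sin2_cos2 a) as Ea. unfold Rsqr in ED, Ea.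
  assert (I2 : sin (D - a) * cos D + sin a = sin D * cos (D - a)).
  { rewrite sin_minus, cos_minus.
    replace (sin a) with (sin a * (sin D * sin D + cos D * cos D)) at 2 by (rewrite ED; ring).
    ring. }
  assert (Hz : forall z, sin D * dot n z M = sin (D - a) * dot n z p + sin a * dot n z q).
  { intro z. unfold M. rewrite dot_comb_r. field. lra. }
  assert (HpM : dot n p M = cos a).
  { apply Rmult_eq_reg_l with (sin D); [|lra]. rewrite Hz, Hpq.
    unfold unit_vector in Hp. rewrite Hp. lra. }
  assert (HqM : dot n q M = cos (D - a)).
  { apply Rmult_eq_reg_l with (sin D); [|lra]. rewrite Hz, (dot_sym n q p), Hpq.
    unfold unit_vector in Hq. rewrite Hq. lra. }
  repeat split; auto. unfold unit_vector.
  apply Rmult_eq_reg_l with (sin D); [|lra].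
  rewrite Hz, (dot_sym n M p), (dot_sym n M q), HpM, HqM, Rmult_1_r.
  replace (sin D) with (sin ((D - a) + a)) by (f_equal; ring). rewrite sin_plus. ring.
Qed.

(** On the chart the difference of quotients has numerator at most [16 * r] and inverse denominators
    at most [2 * N] and [4 * N]. Off the chart [e] and [M] differ so much in coordinate [j] that
    [32 * N * r >= 1], and the crude bound [2 * N] suffices. *)
Lemma gnomonic_center_close d j sg (e M : nat -> R) r i :
  unit_vector (S d) e -> unit_vector (S d) M -> (j <= d)%nat -> (i <= d)%nat -> sg * sg = 1 ->
  1 / (2 * INR (S d)) <= sg * M j -> acos (dot (S d) e M) <= 8 * r ->
  Rabs (M i / (sg * M j) - gnomonic_center d j sg e i) <= 128 * (INR (S d) * INR (S d)) * r.
Proof.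
  intros He HM Hj Hi Hs HMj Hr. set (N := INR (S d)) in *.
  assert (HN : 1 <= N) by (unfold N; rewrite S_INR; pose proof (pos_INR d); lra).
  pose proof (chord_le_angle (S d) e M i He HM ltac:(lia)) as Ci.
  pose proof (chord_le_angle (S d) e M j He HM ltac:(lia)) as Cj.
  pose proof (unit_vector_coord (S d) M i HM ltac:(lia)) as Bi.
  pose proof (unit_vector_coord (S d) e i He ltac:(lia)) as Be.
  assert (Hsg : sg = 1 \/ sg = -1).
  { assert ((sg - 1) * (sg + 1) = 0) as H0 by (ring_simplify; simpl; lra).
    apply Rmult_integral in H0. lra. }
  assert (Cj' : Rabs (sg * e j - sg * M j) <= 8 * r).
  { rewrite <- Rmult_minus_distr_l, Rabs_mult.
    replace (Rabs sg) with 1; [lra|]. destruct Hsg as [->| ->]; unfold Rabs; destruct Rcase_abs; lra. }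
  assert (H2N : 1 / (2 * N) = 2 * (1 / (4 * N))) by (field; lra).
  assert (H4N : 0 < 1 / (4 * N)) by (apply Rdiv_lt_0_compat; lra).
  assert (Hinv : forall x, 1 / (4 * N) <= x -> / x <= 4 * N).
  { intros x Hx. rewrite <- (Rinv_inv (4 * N)). apply Rinv_le_contravar; unfold Rdiv in *; lra. }
  assert (Hinv2 : / (sg * M j) <= 2 * N).
  { rewrite <- (Rinv_inv (2 * N)). unfold Rdiv in HMj.
    apply Rinv_le_contravar; [apply Rinv_0_lt_compat; lra|lra]. }
  unfold gnomonic_center. fold N. destruct (Rle_dec (1 / (4 * N)) (sg * e j)) as [Hin|Hout].
  - set (m := sg * M j) in *. set (c := sg * e j) in *.
    replace (M i / m - e i / c) with (((M i - e i) * c + e i * (c - m)) * (/ m * / c))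
      by (field; lra).
    assert (Hcc : -1 <= c <= 1).
    { pose proof (unit_vector_coord (S d) e j He ltac:(lia)). unfold c. destruct Hsg as [->| ->]; lra. }
    assert (Hnum : Rabs ((M i - e i) * c + e i * (c - m)) <= 16 * r).
    { eapply Rle_trans; [apply Rabs_triang|]. rewrite !Rabs_mult, (Rabs_minus_sym (M i)).
      assert (Rabs c <= 1) by (apply Rabs_le; lra). assert (Rabs (e i) <= 1) by (apply Rabs_le; lra).
      pose proof (Rabs_pos (e i - M i)). pose proof (Rabs_pos (c - m)).
      pose proof (Rabs_pos c). pose proof (Rabs_pos (e i)).
      assert (Rabs (e i - M i) * Rabs c <= 8 * r * 1) by (apply Rmult_le_compat; lra).
      assert (Rabs (e i) * Rabs (c - m) <= 1 * (8 * r)) by (apply Rmult_le_compat; lra). lra. }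
    assert (Hm0 : 0 < / m) by (apply Rinv_0_lt_compat; lra).
    assert (Hc0 : 0 < / c) by (apply Rinv_0_lt_compat; lra).
    assert (Hden : 0 <= / m * / c <= 2 * N * (4 * N)).
    { split; [apply Rmult_le_pos; lra|]. apply Rmult_le_compat; try lra. apply Hinv; lra. }
    rewrite Rabs_mult, (Rabs_right (/ m * / c)) by lra.
    apply Rle_trans with (16 * r * (2 * N * (4 * N))); [|right; ring].
    apply Rmult_le_compat; try lra. apply Rabs_pos.
  - assert (Hr1 : 1 / (4 * N) <= 8 * r) by (apply Rabs_le_inv in Cj'; lra).
    rewrite Rminus_0_r. unfold Rdiv at 1. rewrite Rabs_mult.
    assert (0 < / (sg * M j)) by (apply Rinv_0_lt_compat; lra).
    rewrite (Rabs_right (/ (sg * M j))) by lra.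
    assert (Rabs (M i) <= 1) by (apply Rabs_le; lra).
    assert (Rabs (M i) * / (sg * M j) <= 1 * (2 * N)).
    { apply Rmult_le_compat; try lra. apply Rabs_pos. }
    assert (1 <= 32 * (N * r)).
    { apply Rmult_le_compat_l with (r := 4 * N) in Hr1; [|lra].
      replace (4 * N * (1 / (4 * N))) with 1 in Hr1 by (field; lra). lra. }
    assert (2 * N * 1 <= 2 * N * (32 * (N * r))) by (apply Rmult_le_compat_l; lra).
    assert (0 <= N * (N * r)) by (apply Rmult_le_pos; nra). lra.
Qed.

(** The rounded point is at angle [h] from the geodesic with [h * h <= 9 * N * (eta * eta)], and
    both arcs have sine at least [r / 12]; the excess is at most [24 / r] times [h * h], hence below
    [eps * r]. *)
Theorem sphere_two_hop d eps r (p q : model_space Spherical d) :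
  (1 <= d)%nat -> 0 < eps <= 1 -> 0 < r ->
  r <= model_dist Spherical d p q <= 8 * r ->
  exists z, In z (sphere_steiner d eps r p) /\ In z (sphere_steiner d eps r q) /\
    model_dist Spherical d p z + model_dist Spherical d z q <=
      (1 + eps) * model_dist Spherical d p q.
Proof.
  intros Hd He Hr.
  set (dist := model_dist Spherical d).
  assert (Hun : forall x : model_space Spherical d, unit_vector (S d) (proj1_sig x)).
  { intros [x Hx]; apply model_unit_vector; auto. }
  assert (Hdist : forall x y, dist x y = acos (dot (S d) (proj1_sig x) (proj1_sig y)))
    by reflexivity.
  pose proof (spherical_metric d) as (_ & Hsym & Hpos & Htri). fold dist in Hsym, Hpos, Htri.
  set (P := proj1_sig p). set (Q := proj1_sig q).
  assert (HP : unit_vector (S d) P) by apply Hun. assert (HQ : unit_vector (S d) Q) by apply Hun.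
  set (D := dist p q). intros [Hr1 Hr2].
  assert (HDpi : 0 <= D <= PI) by (apply acos_bound).
  pose proof PI_4 as HPI.
  destruct (Req_dec D PI) as [Epi|Npi].
  { exists (sphere_basepoint d). split; [left; auto|]. split; [left; auto|].
    rewrite !Hdist. fold P Q. rewrite antipodal_two_hop by auto. fold D. rewrite Epi.
    assert (0 <= eps * PI) by (apply Rmult_le_pos; lra). lra. }
  assert (HsD : 0 < sin D) by (apply sin_gt_0; lra).
  assert (HcD : dot (S d) P Q = cos D).
  { unfold D. rewrite Hdist. fold P Q. rewrite cos_acos; auto. apply unit_vector_dot; auto. }
  set (N := INR (S d)) in *.
  assert (HN : 2 <= N).
  { unfold N. rewrite S_INR. apply le_INR in Hd. simpl in Hd. lra. }
  assert (HNN : 4 <= N * N) by nra.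
  set (rho := r / (16 * (N * N))). set (eta := sqrt eps * r / (16 * (N * N))).
  assert (Hrt : sqrt eps * sqrt eps = eps) by (apply sqrt_def; lra).
  assert (Hrt0 : 0 < sqrt eps) by (apply sqrt_lt_R0; lra).
  assert (Hrt1 : sqrt eps <= 1) by (clear - Hrt Hrt0 He; nra).
  assert (Hrho : 0 < rho) by (apply Rdiv_lt_0_compat; lra).
  assert (Heta : 0 < eta).
  { apply Rdiv_lt_0_compat; [apply Rmult_lt_0_compat|]; lra. }
  assert (HrhoN : rho * (16 * (N * N)) = r) by (unfold rho; field; lra).
  assert (Hetarho : eta = sqrt eps * rho) by (unfold eta, rho; field; lra).
  assert (Hetar : eta <= r).
  { rewrite Hetarho. clear - Hrho Hrt0 Hrt1 HrhoN HNN. nra. }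
  set (ell := r / (8 * N)).
  assert (HellN : ell * (8 * N) = r) by (unfold ell; field; lra).
  assert (Hell : 0 < ell) by (apply Rdiv_lt_0_compat; lra).
  assert (Hellr : ell <= r / 16) by (clear - HellN Hell HN; nra).
  assert (Hell2 : ell <= 1 / (2 * N)).
  { apply Rmult_le_reg_r with (8 * N); [lra|]. rewrite HellN.
    replace (1 / (2 * N) * (8 * N)) with 4 by (field; lra). lra. }
  set (mid := fun a i => sin (D - a) / sin D * P i + sin a / sin D * Q i).
  assert (Hmid : forall a, unit_vector (S d) (mid a) /\ dot (S d) P (mid a) = cos a /\
      dot (S d) Q (mid a) = cos (D - a) /\
      forall z, sin D * dot (S d) z (mid a) = sin (D - a) * dot (S d) z P + sin a * dot (S d) z Q).
  { intro a. apply spherical_geodesic; auto. }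
  assert (Hmm : forall a b, dot (S d) (mid a) (mid b) = cos (a - b)).
  { intros a b. destruct (Hmid a) as (_ & A1 & A2 & _). destruct (Hmid b) as (_ & _ & _ & B3).
    apply Rmult_eq_reg_l with (sin D); [|lra].
    rewrite B3, (dot_sym _ (mid a) P), (dot_sym _ (mid a) Q), A1, A2.
    rewrite sin_minus, !cos_minus.
    pose proof (sin2_cos2 D) as ED. unfold Rsqr in ED.
    replace (sin D * (cos a * cos b + sin a * sin b)) with
      (sin D * (cos a * cos b) + sin D * (sin a * sin b)) by ring. ring_simplify. ring. }
  destruct (Hmid (D / 2)) as (HuC & _).
  (* Choice of the chart: some coordinate of the unit midpoint has square at least [/ N], so
     absolute value at least [1 / N]; over the window of half-length [ell <= 1 / (2 * N)] it remains
     at least [1 / (2 * N)]. *)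
  destruct (rsum_large_term (S d) (fun i => mid (D / 2) i * mid (D / 2) i) (/ N)) as (j & Hj & Hjbig);
    [lia| |].
  { fold (dot (S d) (mid (D / 2)) (mid (D / 2))). fold N. rewrite HuC. right. field. lra. }
  assert (Hsg : exists sg, In sg (1 :: -1 :: nil) /\ sg * sg = 1 /\ 1 / N <= sg * mid (D / 2) j).
  { assert (Ha : 1 / N <= Rabs (mid (D / 2) j)).
    { apply le_Rabs_of_sqr.
      eapply Rle_trans; [|exact Hjbig].
      replace (1 / N * (1 / N)) with (/ (N * N)) by (field; lra).
      apply Rinv_le_contravar; [lra|]. clear - HN. nra. }
    unfold Rabs in Ha. destruct Rcase_abs.
    - exists (-1). simpl. split; [auto|]. split; lra.
    - exists 1. simpl. split; [auto|]. split; lra. }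
  destruct Hsg as (sg & Hsgin & Hsg2 & Hsgmid).
  set (a1 := D / 2 - ell). set (a2 := D / 2 + ell).
  assert (Hgap : 1 / N = 2 * (1 / (2 * N))) by (field; lra).
  assert (Hsgabs : Rabs sg = 1).
  { destruct Hsgin as [<-|[<-|[]]]; unfold Rabs; destruct Rcase_abs; lra. }
  assert (Hmj : forall a, a1 <= a <= a2 -> 1 / (2 * N) <= sg * mid a j).
  { intros a Ha. destruct (Hmid a) as (Hua & _).
    pose proof (chord_le_angle (S d) (mid a) (mid (D / 2)) j Hua HuC Hj) as C.
    rewrite Hmm in C.
    assert (Hab : acos (cos (a - D / 2)) <= ell).
    { unfold a1, a2 in Ha. destruct (Rle_lt_dec 0 (a - D / 2)).
      - rewrite acos_cos; lra.
      - rewrite <- cos_neg, acos_cos; lra. }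
    assert (C2 : Rabs (sg * mid a j - sg * mid (D / 2) j) <= ell).
    { rewrite <- Rmult_minus_distr_l, Rabs_mult, Hsgabs. lra. }
    apply Rabs_le_inv in C2. lra. }
  assert (HN2 : 0 < 1 / (2 * N)) by (apply Rdiv_lt_0_compat; lra).
  set (den := fun a => sg * (sin (D - a) * P j + sin a * Q j)).
  set (gam := fun i a => (sin (D - a) * P i + sin a * Q i) / den a).
  assert (Hden : forall a, den a = sin D * (sg * mid a j)) by (intro; unfold den, mid; field; lra).
  assert (Hden0 : forall a, a1 <= a <= a2 -> 0 < den a).
  { intros a Ha. rewrite Hden. specialize (Hmj a Ha). apply Rmult_lt_0_compat; lra. }
  assert (Hgam : forall i a, a1 <= a <= a2 -> gam i a = / (sg * mid a j) * mid a i).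
  { intros i a Ha. unfold gam. rewrite Hden. specialize (Hmj a Ha).
    assert (mid a j <> 0) by (intros E; rewrite E in Hmj; lra).
    assert (sg <> 0) by (intros E; rewrite E in Hmj; lra).
    unfold mid at 3. field. repeat split; auto; lra. }
  assert (Hcont : forall i a, a1 <= a <= a2 -> continuity_pt (gam i) a).
  { intros i a Ha. specialize (Hden0 a Ha). unfold gam, den in *. reg. lra. }
  assert (Hcross : exists i0, (i0 < S d)%nat /\ rho <= Rabs (gam i0 a1 - gam i0 a2)).
  { assert (Ha1 : a1 <= a1 <= a2) by (unfold a1, a2; lra).
    assert (Ha2 : a1 <= a2 <= a2) by (unfold a1, a2; lra).
    pose proof (Hmj a1 Ha1) as J1. pose proof (Hmj a2 Ha2) as J2.
    assert (Hinv1 : forall a, a1 <= a <= a2 -> 1 <= / (sg * mid a j)).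
    { intros a Ha. specialize (Hmj a Ha). destruct (Hmid a) as (Hua & _).
      pose proof (unit_vector_coord (S d) (mid a) j Hua Hj).
      rewrite <- Rinv_1. apply Rinv_le_contravar; [lra|].
      destruct Hsgin as [<-|[<-|[]]]; lra. }
    pose proof (rescaled_dist (S d) (mid a1) (mid a2) (/ (sg * mid a1 j)) (/ (sg * mid a2 j))
      (proj1 (Hmid a1)) (proj1 (Hmid a2)) (Hinv1 a1 Ha1) (Hinv1 a2 Ha2)) as Hs.
    rewrite Hmm in Hs.
    replace (a1 - a2) with (- (2 * ell)) in Hs by (unfold a1, a2; ring). rewrite cos_neg in Hs.
    pose proof (cos_upper (2 * ell)) as Hcu.
    assert (HPI2 : 2 * ell <= PI) by lra. specialize (Hcu ltac:(lra)).
    assert (Hs2 : (2 * ell / 3) * (2 * ell / 3) <= rsum (S d) (fun i =>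
      (/ (sg * mid a1 j) * mid a1 i - / (sg * mid a2 j) * mid a2 i) ^ 2)) by lra.
    destruct (rsum_large_term (S d) _ ((2 * ell / 3) * (2 * ell / 3) / N) ltac:(lia)
      ltac:(fold N; replace (N * (2 * ell / 3 * (2 * ell / 3) / N)) with
        (2 * ell / 3 * (2 * ell / 3)) by (field; lra); exact Hs2)) as (i0 & Hi0 & Hbig).
    exists i0. split; auto. rewrite !Hgam by auto.
    apply le_Rabs_of_sqr.
    eapply Rle_trans; [|eapply Rle_trans; [exact Hbig|right; ring]].
    assert (Erho : rho * (2 * N) = ell).
    { apply Rmult_eq_reg_r with (8 * N); [|lra]. rewrite HellN, <- HrhoN. ring. }
    rewrite <- Erho. replace (2 * (rho * (2 * N)) / 3 * (2 * (rho * (2 * N)) / 3) / N) with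
      (16 / 9 * N * (rho * rho)) by (field; lra).
    assert (0 <= rho * rho) by apply Rle_0_sqr.
    apply Rle_trans with (1 * (rho * rho)); [lra|]. apply Rmult_le_compat_r; lra. }
  destruct Hcross as (i0 & Hi0 & Hcross).
  (* In its own chart coordinate [j] is constantly [sg], so it is not the one that varies by
     [rho]. *)
  assert (Hij : i0 <> j).
  { intros ->. rewrite !Hgam in Hcross by (unfold a1, a2; lra).
    pose proof (Hmj a1 ltac:(unfold a1, a2; lra)). pose proof (Hmj a2 ltac:(unfold a1, a2; lra)).
    assert (E : forall a, 1 / (2 * N) <= sg * mid a j -> / (sg * mid a j) * mid a j = sg).
    { intros a Ha. apply Rmult_eq_reg_l with (sg * mid a j); [|lra].
      rewrite <- Rmult_assoc, Rinv_r by lra.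
      replace (sg * mid a j * sg) with (sg * sg * mid a j) by ring. rewrite Hsg2. ring. }
    rewrite !E in Hcross by auto.
    unfold Rminus in Hcross. rewrite Rplus_opp_r, Rabs_R0 in Hcross. lra. }
  destruct (grid_point_on_curve (S d) j i0 gam rho eta a1 a2) as (a & code & Haa & Hclose & Hcode);
    auto; [unfold a1, a2; lra|].
  destruct (Hmid a) as (HuM & HpM & HqM & HzM). pose proof (Hmj a Haa) as Hma.
  assert (Hab : r / 4 <= a /\ r / 4 <= D - a /\ a <= PI / 2 + 1 / 4 /\ D - a <= PI / 2 + 1 / 4).
  { unfold a1, a2 in Haa.
    assert (1 / (2 * N) <= 1 / 4) by (apply Rmult_le_compat_l; [lra|apply Rinv_le_contravar; lra]).
    lra. }
  assert (Hang : acos (dot (S d) P (mid a)) <= 8 * r /\ acos (dot (S d) Q (mid a)) <= 8 * r).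
  { rewrite HpM, HqM, !acos_cos by lra. lra. }
  set (v := grid_coord rho eta code).
  set (z := gnomonic_point d j sg v).
  assert (Hin : forall e, (e = p \/ e = q) -> In z (sphere_steiner d eps r e)).
  { intros e Hpq. unfold sphere_steiner. right. apply in_flat_map. exists j.
    split; [apply in_seq; lia|]. apply in_flat_map. exists sg. split; auto.
    fold N rho eta.
    apply (in_map (fun code => gnomonic_point d j sg (grid_coord rho eta code))).
    apply Hcode. intros i Hi _. rewrite Hgam by auto.
    assert (Rabs (mid a i / (sg * mid a j) - gnomonic_center d j sg (proj1_sig e) i) <=
      128 * (N * N) * r).
    { apply gnomonic_center_close; auto; try lia.
      destruct Hpq as [-> | ->]; [fold P|fold Q]; lra. }
    unfold Rdiv in H. rewrite (Rmult_comm (mid a i)) in H.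
    apply Rle_trans with (128 * (N * N) * r + r); [lra|].
    assert (1 * r <= N * N * r) by (apply Rmult_le_compat_r; lra). lra. }
  exists z. split; [apply Hin; auto|]. split; [apply Hin; auto|].
  destruct (gnomonic_norm_ge_1 d j sg v ltac:(lia) Hsg2) as [Hno1 Hno2].
  assert (Ez : proj1_sig z = fun i => / gnomonic_norm d j sg v * gnomonic_vector d j sg v i).
  { unfold z, gnomonic_point. destruct (le_dec j d); [|lia].
    destruct (Req_dec_T (sg * sg) 1); [reflexivity|lra]. }
  assert (HuZ : unit_vector (S d) (proj1_sig z)) by apply Hun.
  assert (Hinv1 : 1 <= / (sg * mid a j)).
  { pose proof (unit_vector_coord (S d) (mid a) j HuM Hj).
    rewrite <- Rinv_1. apply Rinv_le_contravar; [lra|]. destruct Hsgin as [<-|[<-|[]]]; lra. }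
  set (h := acos (dot (S d) (proj1_sig z) (mid a))).
  assert (Hh0 : 0 <= h <= PI) by apply acos_bound.
  assert (Hch : cos h = dot (S d) (proj1_sig z) (mid a)).
  { unfold h. rewrite cos_acos; auto. apply unit_vector_dot; auto. }
  assert (Hh : h * h <= 9 * N * (eta * eta)).
  { pose proof (rescaled_dist (S d) (proj1_sig z) (mid a) (gnomonic_norm d j sg v) (/ (sg * mid a j))
      HuZ HuM Hno1 Hinv1) as Hs.
    rewrite <- Hch in Hs.
    assert (Hs2 : rsum (S d) (fun i => (gnomonic_norm d j sg v * proj1_sig z i -
      / (sg * mid a j) * mid a i) ^ 2) <= N * (eta * eta)).
    { unfold N. rewrite <- rsum_const. apply rsum_le. intros i Hi. rewrite Ez.
      replace (gnomonic_norm d j sg v * (/ gnomonic_norm d j sg v * gnomonic_vector d j sg v i))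
        with (gnomonic_vector d j sg v i) by (field; lra).
      rewrite <- Hgam by auto. unfold gnomonic_vector.
      destruct (Nat.eqb_spec i j) as [->|Hne].
      - rewrite Hgam by auto.
        replace (sg - / (sg * mid a j) * mid a j) with 0.
        + rewrite pow_i by lia. apply Rle_0_sqr.
        + apply Rmult_eq_reg_l with (sg * mid a j); [|lra].
          rewrite Rmult_minus_distr_l, <- Rmult_assoc, Rinv_r by lra.
          replace (sg * mid a j * sg) with (sg * sg * mid a j) by ring. rewrite Hsg2. ring.
      - destruct (Nat.ltb_spec i (S d)); [|lia].
        pose proof (Hclose i Hi Hne) as Hk. fold v in Hk. apply Rabs_le_inv in Hk.
        clear - Hk. nra. }
    pose proof (cos_upper h Hh0). lra. }
  (* For nearly antipodal ends an arc may pass [PI / 2] by up to [1 / 4]; there the quadratic bound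
     on [cos] takes over from the linear bound on [sin]. *)
  assert (Hsin : forall x, r / 4 <= x -> x <= PI / 2 + 1 / 4 -> 0 < sin x /\ / sin x <= 12 / r).
  { intros x H1 H2. assert (Hs : r / 12 <= sin x).
    { destruct (Rle_lt_dec x (PI / 2)).
      - pose proof (sin_ge_third x). lra.
      - replace x with (PI / 2 + (x - PI / 2)) by ring. rewrite <- cos_sin.
        pose proof (cos_lower (x - PI / 2)).
        assert ((x - PI / 2) * (x - PI / 2) <= (1 / 4) * (1 / 4)) by (apply Rmult_le_compat; lra).
        lra. }
    split; [lra|]. replace (12 / r) with (/ (r / 12)) by (field; lra).
    apply Rinv_le_contravar; lra. }
  destruct (Hsin a ltac:(lra) ltac:(lra)) as [Sa1 Sa2].
  destruct (Hsin (D - a) ltac:(lra) ltac:(lra)) as [Sb1 Sb2].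
  pose proof (spherical_excess a (D - a) (dist p z) (dist z q) h Sa1 Sb1) as Hex.
  replace (a + (D - a)) with D in Hex by ring.
  assert (Hpz : cos (dist p z) = dot (S d) (proj1_sig z) P).
  { rewrite Hdist, cos_acos by (apply unit_vector_dot; auto). apply dot_sym. }
  assert (Hzq : cos (dist z q) = dot (S d) (proj1_sig z) Q).
  { rewrite Hdist, cos_acos by (apply unit_vector_dot; auto). auto. }
  assert (HpMa : acos (dot (S d) P (mid a)) = a) by (rewrite HpM, acos_cos; lra).
  assert (HqMa : acos (dot (S d) Q (mid a)) = D - a) by (rewrite HqM, acos_cos; lra).
  assert (Hdpz : dist p z = acos (dot (S d) P (proj1_sig z))) by reflexivity.
  assert (Hdzq : dist z q = acos (dot (S d) (proj1_sig z) Q)) by reflexivity.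
  assert (Hsymz : forall x y, acos (dot (S d) x y) = acos (dot (S d) y x))
    by (intros; rewrite dot_sym; auto).
  specialize (Hex ltac:(rewrite Hch, HzM, Hpz, Hzq; reflexivity)).
  assert (U : Rabs (dist p z - a) <= h).
  { pose proof (acos_dot_triangle (S d) P (mid a) (proj1_sig z) HP HuM HuZ) as T1.
    pose proof (acos_dot_triangle (S d) P (proj1_sig z) (mid a) HP HuZ HuM) as T2.
    rewrite (Hsymz (mid a)) in T1. fold h in T1, T2. apply Rabs_le. lra. }
  assert (V : Rabs (dist z q - (D - a)) <= h).
  { pose proof (acos_dot_triangle (S d) (proj1_sig z) (mid a) Q HuZ HuM HQ) as T1.
    pose proof (acos_dot_triangle (S d) (mid a) (proj1_sig z) Q HuM HuZ HQ) as T2.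
    rewrite (Hsymz (mid a) Q) in T1, T2. rewrite (Hsymz (mid a) (proj1_sig z)) in T2.
    fold h in T1, T2. apply Rabs_le. lra. }
  specialize (Hex U V).
  assert (Hexc : h * h * (/ sin a + / sin (D - a)) <= eps * r).
  { apply Rle_trans with (9 * N * (eta * eta) * (24 / r)).
    - assert (0 < / sin a) by (apply Rinv_0_lt_compat; auto).
      assert (0 < / sin (D - a)) by (apply Rinv_0_lt_compat; auto).
      assert (24 / r = 12 / r + 12 / r) by (field; lra).
      apply Rmult_le_compat; try lra. apply Rle_0_sqr.
    - replace (9 * N * (eta * eta) * (24 / r)) with (216 / 256 * (eps * r) * / (N * N * N)).
      + assert (0 <= eps * r) by (apply Rmult_le_pos; lra).
        assert (HN3 : 1 <= N * N * N).
        { assert (1 * 1 <= N * N * N) by (apply Rmult_le_compat; lra). lra. }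
        assert (/ (N * N * N) <= 1) by (rewrite <- Rinv_1; apply Rinv_le_contravar; lra).
        apply Rle_trans with (216 / 256 * (eps * r) * 1); [apply Rmult_le_compat_l; lra|lra].
      + unfold eta. rewrite <- Hrt at 1. field. lra. }
  assert (eps * r <= eps * D) by (apply Rmult_le_compat_l; lra).
  fold D. lra.
Qed.

(** * Euclidean space and edge counts *)

(** Here the tangent bound is that of the square, [u <= (u * u / A + A) / 2], which makes Stewart's
    relation applicable term by term. *)
Lemma euclidean_excess A B u v c D :
  0 < A -> 0 < B -> A + B = D -> B * (u * u) + A * (v * v) = D * (c * c) + A * B * D ->
  u + v <= D + c * c * D / (2 * (A * B)).
Proof.
  intros HA HB HD E.
  assert (Hu : u <= (u * u / A + A) / 2).
  { apply Rmult_le_reg_r with (2 * A); [lra|].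
    replace ((u * u / A + A) / 2 * (2 * A)) with (u * u + A * A) by (field; lra).
    pose proof (Rle_0_sqr (u - A)). unfold Rsqr in *. lra. }
  assert (Hv : v <= (v * v / B + B) / 2).
  { apply Rmult_le_reg_r with (2 * B); [lra|].
    replace ((v * v / B + B) / 2 * (2 * B)) with (v * v + B * B) by (field; lra).
    pose proof (Rle_0_sqr (v - B)). unfold Rsqr in *. lra. }
  assert (E2 : u * u / A + v * v / B = c * c * D / (A * B) + D).
  { apply Rmult_eq_reg_r with (A * B); [|nra]. field_simplify; [|lra|lra]. lra. }
  replace (c * c * D / (2 * (A * B))) with (c * c * D / (A * B) / 2) by (field; lra).
  lra.
Qed.

Lemma truncate_model d (x : nat -> R) :
  model_pt Euclidean d (fun i => if Nat.ltb i d then x i else 0).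
Proof. intros i Hi. destruct (Nat.ltb_spec i d); [lia|auto]. Qed.

Definition euclidean_point d (x : nat -> R) : model_space Euclidean d :=
  exist _ _ (truncate_model d x).

(** The bend is placed over the middle third of the segment, hence the factor 3 in the steps; the
    radius [9 * r] is the largest distance [8 * r] plus rounding. *)
Definition euclidean_steiner (d : nat) (eps r : R) (p : model_space Euclidean d) :
  list (model_space Euclidean d) :=
  let rho := r / (3 * INR d) in
  let eta := sqrt eps * r / (3 * INR d) in
  map (fun code => euclidean_point d (grid_coord rho eta code))
    (grid_codes d d rho eta (proj1_sig p) (9 * r)).

Lemma euclidean_metric d : pseudo_metric (model_dist Euclidean d).
Proof. apply (pseudo_metric_pullback (@proj1_sig _ _) (edist d)), edist_metric. Qed.

Theorem euclidean_two_hop d eps r (p q : model_space Euclidean d) :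
  (1 <= d)%nat -> 0 < eps <= 1 -> 0 < r ->
  r <= model_dist Euclidean d p q <= 8 * r ->
  exists z, In z (euclidean_steiner d eps r p) /\ In z (euclidean_steiner d eps r q) /\
    model_dist Euclidean d p z + model_dist Euclidean d z q <=
      (1 + eps) * model_dist Euclidean d p q.
Proof.
  intros Hd He Hr [H1 H2].
  change (model_dist Euclidean d) with
    (fun p q : model_space Euclidean d => edist d (proj1_sig p) (proj1_sig q)) in *. cbv beta in *.
  set (P := proj1_sig p) in *. set (Q := proj1_sig q) in *. set (D := edist d P Q) in *.
  set (N := INR d). assert (HN : 1 <= N) by (apply le_INR in Hd; auto).
  set (rho := r / (3 * N)). set (eta := sqrt eps * r / (3 * N)).
  assert (Hrt : sqrt eps * sqrt eps = eps) by (apply sqrt_def; lra).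
  assert (Hrt0 : 0 < sqrt eps) by (apply sqrt_lt_R0; lra).
  assert (Hrt1 : sqrt eps <= 1) by nra.
  assert (Hrho : 0 < rho) by (apply Rdiv_lt_0_compat; lra).
  assert (Heta : 0 < eta) by (apply Rdiv_lt_0_compat; nra).
  assert (HrhoN : rho * (3 * N) = r) by (unfold rho; field; lra).
  assert (HetaN : eta * (3 * N) = sqrt eps * r) by (unfold eta; field; lra).
  assert (Hetar : eta <= r) by nra.
  pose proof (edist_sqr d P Q) as HDD. fold D in HDD.
  set (gam := fun i a => P i + a * (Q i - P i)).
  destruct (rsum_large_term d (fun i => (P i - Q i) ^ 2) (D * D / N) ltac:(lia)
    ltac:(fold N; replace (N * (D * D / N)) with (D * D) by (field; lra); rewrite HDD; apply Rle_refl))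
    as (i0 & Hi0 & Hbig).
  assert (Hcross : rho <= Rabs (gam i0 (1 / 3) - gam i0 (2 / 3))).
  { unfold gam. replace (P i0 + 1 / 3 * (Q i0 - P i0) - (P i0 + 2 / 3 * (Q i0 - P i0))) with
      (1 / 3 * (P i0 - Q i0)) by field.
    rewrite Rabs_mult, (Rabs_right (1 / 3)) by lra.
    assert (r / N <= Rabs (P i0 - Q i0)).
    { apply le_Rabs_of_sqr.
      eapply Rle_trans; [|eapply Rle_trans; [exact Hbig|right; ring]].
      assert (r * r <= D * D) by (apply Rmult_le_compat; lra).
      replace (r / N * (r / N)) with (r * r * / N * / N) by (field; lra). unfold Rdiv.
      assert (0 < / N) by (apply Rinv_0_lt_compat; lra).
      assert (/ N <= 1) by (rewrite <- Rinv_1; apply Rinv_le_contravar; lra).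
      assert (r * r * / N <= D * D * / N) by (apply Rmult_le_compat_r; lra).
      assert (0 <= r * r * / N) by (apply Rmult_le_pos; nra).
      apply Rle_trans with (r * r * / N * 1); [apply Rmult_le_compat_l|]; lra. }
    unfold rho. replace (r / (3 * N)) with (1 / 3 * (r / N)) by (field; lra).
    apply Rmult_le_compat_l; lra. }
  destruct (grid_point_on_curve d d i0 gam rho eta (1 / 3) (2 / 3)) as (a & code & Haa & Hclose & Hcode);
    auto; try lra; try lia.
  { intros a _. unfold gam. reg. }
  assert (Hco : forall i, (i < d)%nat -> Rabs (gam i a - P i) <= 8 * r /\ Rabs (gam i a - Q i) <= 8 * r).
  { intros i Hi. pose proof (edist_coord d P Q i Hi) as H. fold D in H. unfold gam. split.
    - replace (P i + a * (Q i - P i) - P i) with ((- a) * (P i - Q i)) by ring.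
      rewrite Rabs_mult, Rabs_Ropp, (Rabs_right a) by lra.
      pose proof (Rabs_pos (P i - Q i)). nra.
    - replace (P i + a * (Q i - P i) - Q i) with ((1 - a) * (P i - Q i)) by ring.
      rewrite Rabs_mult, (Rabs_right (1 - a)) by lra.
      pose proof (Rabs_pos (P i - Q i)). nra. }
  set (z := euclidean_point d (grid_coord rho eta code)).
  assert (Hin : forall e, e = p \/ e = q -> In z (euclidean_steiner d eps r e)).
  { intros e Hpq. apply (in_map (fun code => euclidean_point d (grid_coord rho eta code))).
    apply Hcode. intros i Hi _. destruct (Hco i Hi).
    destruct Hpq as [-> | ->]; [fold P|fold Q]; lra. }
  exists z. split; [apply Hin; auto|]. split; [apply Hin; auto|].
  set (Z := proj1_sig z). set (M := fun i => gam i a).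
  set (c := edist d Z M).
  assert (Hc : c * c <= N * (eta * eta)).
  { apply edist_sup_bound. intros i Hi. unfold Z, M. simpl.
    destruct (Nat.ltb_spec i d); [|lia]. apply Hclose; auto; lia. }
  assert (Hst : (1 - a) * (edist d P Z * edist d P Z) + a * (edist d Z Q * edist d Z Q) =
    c * c + a * (1 - a) * (D * D)).
  { unfold c. rewrite HDD, !edist_sqr, <- !rsum_scal, <- !rsum_plus.
    apply rsum_ext. intros i _. unfold M, gam. ring. }
  assert (HD : 0 < D) by lra.
  pose proof (euclidean_excess (a * D) ((1 - a) * D) (edist d P Z) (edist d Z Q) c D) as Hex.
  specialize (Hex ltac:(nra) ltac:(nra) ltac:(ring)).
  assert (Hlin : (1 - a) * D * (edist d P Z * edist d P Z) + a * D * (edist d Z Q * edist d Z Q) =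
    D * (c * c) + a * D * ((1 - a) * D) * D).
  { replace ((1 - a) * D * (edist d P Z * edist d P Z) + a * D * (edist d Z Q * edist d Z Q)) with
      (D * ((1 - a) * (edist d P Z * edist d P Z) + a * (edist d Z Q * edist d Z Q))) by ring.
    rewrite Hst. ring. }
  specialize (Hex Hlin).
  assert (Hexc : c * c * D / (2 * (a * D * ((1 - a) * D))) <= eps * D).
  { replace (c * c * D / (2 * (a * D * ((1 - a) * D)))) with (c * c / (2 * (a * (1 - a)) * D))
      by (field; lra).
    assert (Ha : 2 / 9 <= a * (1 - a)) by nra.
    apply Rmult_le_reg_r with (2 * (a * (1 - a)) * D); [nra|].
    unfold Rdiv at 1. rewrite Rmult_assoc, Rinv_l, Rmult_1_r by nra.
    assert (Hcc : c * c <= eps * (r * r) / 9).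
    { eapply Rle_trans; [exact Hc|].
      assert (E : N * (eta * eta) * (9 * N) = eps * (r * r)).
      { replace (N * (eta * eta) * (9 * N)) with ((eta * (3 * N)) * (eta * (3 * N))) by ring.
        rewrite HetaN. replace (sqrt eps * r * (sqrt eps * r)) with (sqrt eps * sqrt eps * (r * r)) by ring.
        rewrite Hrt. ring. }
      assert (0 <= N * (eta * eta)) by (apply Rmult_le_pos; nra).
      assert (N * (eta * eta) * 9 <= N * (eta * eta) * (9 * N)) by (apply Rmult_le_compat_l; lra).
      lra. }
    assert (r * r <= D * D) by (apply Rmult_le_compat; lra).
    assert (0 <= eps * (D * D)) by (apply Rmult_le_pos; nra).
    assert (eps * (r * r) <= eps * (D * D)) by (apply Rmult_le_compat_l; lra).
    assert (eps * (D * D) * (2 / 9) <= eps * (D * D) * (a * (1 - a))) by (apply Rmult_le_compat_l; lra).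
    lra. }
  lra.
Qed.

(** * Numbers of Steiner points per point and scale *)

Definition steiner_bound (d : nat) (eps : R) : R :=
  INR d ^ (24 * d) * (/ sqrt eps) ^ (d - 1).

Lemma steiner_bound_ge_1 d eps : (2 <= d)%nat -> 0 < eps <= 1 -> 1 <= steiner_bound d eps.
Proof.
  intros Hd He. assert (2 <= INR d) by (apply le_INR in Hd; auto).
  assert (0 < sqrt eps) by (apply sqrt_lt_R0; lra).
  assert (sqrt eps <= 1) by (rewrite <- sqrt_1; apply sqrt_le_1_alt; lra).
  assert (1 <= / sqrt eps) by (rewrite <- Rinv_1; apply Rinv_le_contravar; lra).
  unfold steiner_bound. rewrite <- (Rmult_1_l 1).
  apply Rmult_le_compat; try lra; apply pow_R1_Rle; lra.
Qed.

(** As [d >= 2], numerical constants are absorbed into powers of [INR d]. The exponent [24 * d]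
    comes from [6 + 21 + 21 * (d - 1) <= 24 * d]. *)
Lemma grid_count_bound d eps cc w :
  (2 <= d)%nat -> 0 < eps <= 1 -> 0 <= cc -> cc + 2 <= INR d ^ 21 -> 0 <= w <= INR d ^ 6 ->
  w * ((cc + 2) * (cc / sqrt eps + 2) ^ (d - 1)) <= steiner_bound d eps.
Proof.
  intros Hd He Hcc0 Hcc Hw. assert (HN : 2 <= INR d) by (apply le_INR in Hd; auto).
  assert (Hs0 : 0 < sqrt eps) by (apply sqrt_lt_R0; lra).
  assert (Hs1 : sqrt eps <= 1) by (rewrite <- sqrt_1; apply sqrt_le_1_alt; lra).
  assert (Hi : 1 <= / sqrt eps) by (rewrite <- Rinv_1; apply Rinv_le_contravar; lra).
  set (s := / sqrt eps) in *. unfold Rdiv. fold s.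
  assert (H1 : (cc * s + 2) ^ (d - 1) <= (INR d ^ 21 * s) ^ (d - 1)).
  { apply pow_incr. split; [nra|].
    assert ((cc + 2) * s <= INR d ^ 21 * s) by (apply Rmult_le_compat_r; lra). lra. }
  rewrite Rpow_mult_distr, <- pow_mult in H1.
  assert (P0 : 0 <= (cc * s + 2) ^ (d - 1)) by (apply pow_le; nra).
  assert (Hp : forall k, 0 < INR d ^ k) by (intro; apply pow_lt; lra).
  assert (S0 : 0 < s ^ (d - 1)) by (apply pow_lt; lra).
  unfold steiner_bound. fold s.
  apply Rle_trans with (INR d ^ 6 * (INR d ^ 21 * (INR d ^ (21 * (d - 1)) * s ^ (d - 1)))).
  - apply Rmult_le_compat; try lra.
    + apply Rmult_le_pos; lra.
    + apply Rmult_le_compat; lra.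
  - rewrite <- !Rmult_assoc, <- !pow_add. apply Rmult_le_compat_r; [lra|].
    apply Rle_pow; [lra|lia].
Qed.

Lemma length_euclidean_steiner d eps r p :
  (2 <= d)%nat -> 0 < eps <= 1 -> 0 < r ->
  INR (length (euclidean_steiner d eps r p)) <= steiner_bound d eps.
Proof.
  intros Hd He Hr. assert (HN : 2 <= INR d) by (apply le_INR in Hd; auto).
  assert (Hs0 : 0 < sqrt eps) by (apply sqrt_lt_R0; lra).
  unfold euclidean_steiner. rewrite length_map.
  eapply Rle_trans; [apply (length_grid_codes d d d)|]; auto; try lra; try lia.
  - apply Rdiv_lt_0_compat; lra.
  - apply Rdiv_lt_0_compat; nra.
  - replace (2 * (9 * r) / (r / (3 * INR d)) + 2) with (54 * INR d + 2) by (field; lra).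
    replace (2 * (9 * r) / (sqrt eps * r / (3 * INR d)) + 2) with (54 * INR d / sqrt eps + 2)
      by (field; lra).
    apply grid_count_bound; auto; [lra| |].
    + assert (INR d ^ 7 * 2 ^ 14 <= INR d ^ 7 * INR d ^ 14).
      { apply Rmult_le_compat_l; [apply pow_le; lra|apply pow_incr; lra]. }
      rewrite <- pow_add in H. assert (INR d ^ 1 <= INR d ^ 7) by (apply Rle_pow; [lra|lia]).
      simpl (7 + 14)%nat in H. rewrite pow_1 in *. lra.
    + split; [lra|]. rewrite <- (pow_1 (INR d)) at 1. apply Rle_pow; [lra|lia].
Qed.

Lemma length_half_space_steiner {X} k xs yy (mk : (nat -> R) -> R -> X) eps r h p :
  (1 <= k)%nat -> 0 < eps <= 1 -> 0 < r ->
  3 * INR (length (half_space_steiner k xs yy mk eps r h p)) <= steiner_bound (S k) eps.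
Proof.
  intros Hk He Hr. assert (HN : 2 <= INR (S k)) by (change 2 with (INR 2); apply le_INR; lia).
  assert (Hs0 : 0 < sqrt eps) by (apply sqrt_lt_R0; lra).
  unfold half_space_steiner. rewrite length_map. set (N := INR (S k)) in *.
  apply Rle_trans with (3 * (N * ((2 * (120 * r) / (r / (108 * N)) + 2) *
    (2 * (120 * r) / (sqrt eps * r / (108 * N)) + 2) ^ (S k - 1)))).
  - apply Rmult_le_compat_l; [lra|]. apply length_grid_codes; try lra; try lia.
    + apply Rdiv_lt_0_compat; lra.
    + apply Rdiv_lt_0_compat; nra.
  - replace (2 * (120 * r) / (r / (108 * N)) + 2) with (25920 * N + 2) by (field; lra).
    replace (2 * (120 * r) / (sqrt eps * r / (108 * N)) + 2) with (25920 * N / sqrt eps + 2)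
      by (field; lra).
    rewrite <- Rmult_assoc. apply grid_count_bound; auto; [lia|lra| |].
    + fold N. assert (N ^ 6 * 2 ^ 15 <= N ^ 6 * N ^ 15).
      { apply Rmult_le_compat_l; [apply pow_le; lra|apply pow_incr; lra]. }
      rewrite <- pow_add in H. assert (N ^ 1 <= N ^ 6) by (apply Rle_pow; [lra|lia]).
      simpl (6 + 15)%nat in H. rewrite pow_1 in *. lra.
    + fold N. split; [lra|]. assert (N * 2 ^ 5 <= N * N ^ 5).
      { apply Rmult_le_compat_l; [lra|apply pow_incr; lra]. }
      rewrite tech_pow_Rmult in H. lra.
Qed.

Lemma length_sphere_steiner d eps r p :
  (2 <= d)%nat -> 0 < eps <= 1 -> 0 < r ->
  INR (length (sphere_steiner d eps r p)) <= steiner_bound d eps.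
Proof.
  intros Hd He Hr. assert (HN : 2 <= INR d) by (apply le_INR in Hd; auto).
  assert (Hs0 : 0 < sqrt eps) by (apply sqrt_lt_R0; lra).
  unfold sphere_steiner. cbn [length]. rewrite S_INR.
  set (N := INR (S d)). assert (HNd : N = INR d + 1) by apply S_INR.
  set (g := (4128 * (N * N * N * N) + 2) * (4128 * (N * N * N * N) / sqrt eps + 2) ^ (d - 1)).
  assert (HNN : 0 < N * N * N * N) by (repeat apply Rmult_lt_0_compat; lra).
  assert (Hg : 1 <= g).
  { unfold g. assert (1 <= (4128 * (N * N * N * N) / sqrt eps + 2) ^ (d - 1)).
    { apply pow_R1_Rle. assert (0 < 4128 * (N * N * N * N) / sqrt eps); [|lra].
      apply Rdiv_lt_0_compat; lra. }
    nra. }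
  assert (Hlen : forall j sg, (j < S d)%nat ->
    INR (length (map (fun code => gnomonic_point d j sg
      (grid_coord (r / (16 * (N * N))) (sqrt eps * r / (16 * (N * N))) code))
      (grid_codes (S d) j (r / (16 * (N * N))) (sqrt eps * r / (16 * (N * N)))
        (gnomonic_center d j sg (proj1_sig p)) (129 * (N * N) * r)))) <= N * g).
  { intros j sg Hj. rewrite length_map.
    eapply Rle_trans; [apply (length_grid_codes (S d) d j)|]; auto; try lia.
    - apply Rdiv_lt_0_compat; nra.
    - apply Rdiv_lt_0_compat; nra.
    - apply Rmult_le_pos; nra.
    - fold N. right. unfold g. f_equal. f_equal; [field; lra|]. f_equal. field. lra. }
  match goal with |- INR (length ?l) + 1 <= _ => assert (Hl : INR (length l) <= N * (2 * (N * g))) end.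
  { eapply Rle_trans; [apply (length_flat_map_le _ (2 * (N * g)))|].
    - intros j Hj. apply in_seq in Hj. eapply Rle_trans; [apply (length_flat_map_le _ (N * g))|].
      + intros sg _. apply Hlen; lia.
      + simpl; lra.
    - rewrite length_seq. fold N. lra. }
  assert (Hw : N * (2 * (N * g)) + 1 <= (3 * (N * N)) * g).
  { assert (1 * 1 <= N * N * g) by (apply Rmult_le_compat; nra). lra. }
  eapply Rle_trans; [apply Rplus_le_compat_r, Hl|]. eapply Rle_trans; [exact Hw|].
  assert (HN2 : N <= INR d ^ 2) by (simpl; nra).
  assert (Hp : forall k, 0 <= INR d ^ k) by (intro; apply pow_le; lra).
  assert (HN4 : N * N <= INR d ^ 2 * INR d ^ 2) by (apply Rmult_le_compat; lra).
  assert (HN8 : N * N * N * N <= INR d ^ 8).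
  { rewrite Rmult_assoc. change 8%nat with (2 + 2 + (2 + 2))%nat. rewrite !pow_add.
    apply Rmult_le_compat; nra. }
  apply grid_count_bound; auto; [lra| |].
  - assert (INR d ^ 8 * 2 ^ 13 <= INR d ^ 8 * INR d ^ 13).
    { apply Rmult_le_compat_l; auto. apply pow_incr; lra. }
    rewrite <- pow_add in H. simpl (8 + 13)%nat in H.
    assert (1 <= INR d ^ 8) by (apply pow_R1_Rle; lra). lra.
  - split; [nra|]. assert (INR d ^ 4 * 2 ^ 2 <= INR d ^ 4 * INR d ^ 2).
    { apply Rmult_le_compat_l; auto. apply pow_incr; lra. }
    rewrite <- !pow_add in *. simpl (4 + 2)%nat in H. simpl (2 + 2)%nat in HN4.
    assert (0 <= INR d ^ 4) by auto. lra.
Qed.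

(** * Spanners in the model spaces and their quotients *)

Lemma spanner_stretch_weaken (eps D : R) : 0 < eps -> 0 <= D ->
  (1 + eps) * (1 + eps) * D <= (1 + 12 * eps) * (1 + 4 * eps) * D.
Proof.
  intros He HD. apply Rmult_le_compat_r; auto. apply Rmult_le_compat; lra.
Qed.

(** Distances up to [1 / 2] are left to [local_spanner], longer ones to [horoball_spanner]. In the
    local part both ends must use the same chart height, which is rounded to an integer power of
    [e]; nearby points have levels differing by at most one, so each point lists three charts. *)
Lemma hyperbolic_spanner k eps L (Q : list (model_space Hyperbolic (S k))) :
  (1 <= k)%nat -> 0 < eps <= 1 -> 64 / eps <= 2 ^ L ->
  exists E, INR (length E) <= INR (length Q) * (23 * (INR L + 1) * steiner_bound (S k) eps) /\
    forall p q, In p Q -> In q Q -> 0 < model_dist Hyperbolic (S k) p q ->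
      conn (model_dist Hyperbolic (S k)) E p q
        ((1 + 12 * eps) * (1 + 4 * eps) * model_dist Hyperbolic (S k) p q).
Proof.
  intros Hk He HL. set (d := model_dist Hyperbolic (S k)).
  set (xs := hx_model k). set (yy := hy_model k). set (K := steiner_bound (S k) eps).
  pose proof (hyperbolic_half_space k) as HH. fold d xs yy in HH.
  pose proof (hyperbolic_geodesic_points k) as HG. fold d xs yy in HG.
  pose proof HH as (Hm & Hmx & Hy & Hc).
  set (st := half_space_steiner k xs yy (half_space_point k) eps).
  assert (Hst : forall r h p, 0 < r -> 3 * INR (length (st r h p)) <= K).
  { intros. apply length_half_space_steiner; auto. }
  assert (HK : 1 <= K) by (apply steiner_bound_ge_1; auto; lia).
  set (lev := fun p => up (ln (yy p))).
  assert (Hlev : forall p, yy p < exp (IZR (lev p)) <= 3 * yy p).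
  { intro p. destruct (archimed (ln (yy p))) as [A1 A2]. fold (lev p) in A1, A2. split.
    - rewrite <- (exp_ln (yy p)) at 1 by apply Hy. apply exp_increasing; lra.
    - replace (IZR (lev p)) with ((IZR (lev p) - ln (yy p)) + ln (yy p)) by ring.
      rewrite exp_plus, exp_ln by apply Hy.
      apply Rmult_le_compat_r; [left; apply Hy|]. pose proof exp_le_3.
      destruct (Rle_lt_or_eq_dec _ 1 A2) as [Hlt|Heq]; [|rewrite Heq; auto].
      apply exp_increasing in Hlt. lra. }
  set (Zloc := fun r p => st r (exp (IZR (lev p - 1))) p ++ st r (exp (IZR (lev p))) p ++
    st r (exp (IZR (lev p + 1))) p).
  destruct (local_spanner d eps (1 / 2) K L Zloc Hm He) with (Q := Q) as (E1 & L1 & C1).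
  { eapply Rle_trans; [|exact HL]. apply Rmult_le_compat_r; [left; apply Rinv_0_lt_compat|]; lra. }
  { lra. }
  { intros r p Hr. unfold Zloc. rewrite !length_app, !plus_INR.
    pose proof (Hst r (exp (IZR (lev p - 1))) p Hr). pose proof (Hst r (exp (IZR (lev p))) p Hr).
    pose proof (Hst r (exp (IZR (lev p + 1))) p Hr). lra. }
  { intros r p q Hr Hr2 [D1 D2] D3. set (h := exp (IZR (lev p))).
    destruct (Hlev p) as [P1 P2]. fold h in P1, P2.
    pose proof (Hy p) as Yp. pose proof (Hy q) as Yq.
    assert (Hd1 : d p q <= 1) by lra.
    pose proof (short_distance d _ yy p q HH Hd1) as Hs. cbv beta in Hs.
    assert (B1 : yy q <= 7 / 2 * yy p).
    { apply Rmult_le_reg_r with (yy q); auto.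
      pose proof (Rle_0_sqr (edist k (xs p) (xs q))). unfold Rsqr in *. nra. }
    assert (B2 : edist k (xs p) (xs q) <= 7 / 2 * yy p).
    { apply Rsqr_le_inv; [lra|].
      assert (yy p * yy q <= yy p * (7 / 2 * yy p)) by (apply Rmult_le_compat_l; lra). nra. }
    assert (Hz : (lev q - 1 = lev p \/ lev q = lev p \/ lev q + 1 = lev p)%Z).
    { pose proof (log_height_le d _ yy p q HH) as Hl. rewrite ln_div in Hl by auto.
      apply Rabs_le_inv in Hl. unfold lev.
      destruct (archimed (ln (yy p))) as [A1 A2]. destruct (archimed (ln (yy q))) as [A3 A4].
      assert (up (ln (yy p)) < up (ln (yy q)) + 2)%Z by (apply lt_IZR; rewrite plus_IZR; lra).
      assert (up (ln (yy q)) < up (ln (yy p)) + 2)%Z by (apply lt_IZR; rewrite plus_IZR; lra).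
      lia. }
    destruct (half_space_two_hop d k xs yy (half_space_point k) eps r h p q) as (z & Z1 & Z2 & Z3);
      auto; try lra.
    - intros; apply half_space_point_spec; auto.
    - exists z. split; [|split; auto]; unfold Zloc; rewrite !in_app_iff.
      + right; left; auto.
      + destruct Hz as [Hz|[Hz|Hz]]; rewrite Hz; auto. }
  destruct (horoball_spanner d (fun p q => edist k (xs p) (xs q)) yy
    (fun w h => half_space_point k (xs w) h) eps K L (st (1 / 2)) HH) with (Q := Q)
    as (E2 & L2 & C2); auto; try lra.
  { intros w h Hh. destruct (half_space_point_spec k (xs w) h Hh) as [H1 H2]. split; auto.
    unfold edist. rewrite (rsum_ext k _ (fun _ => 0)), rsum_const, Rmult_0_r; [apply sqrt_0|].
    intros i Hi. unfold xs at 1. rewrite H2 by auto. ring. }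
  { intros h p Hh. pose proof (Hst (1 / 2) h p ltac:(lra)).
    pose proof (pos_INR (length (st (1 / 2) h p))). lra. }
  { intros h p q Hh Hd B1 B2 B3 B4.
    apply (half_space_two_hop d k xs yy (half_space_point k) eps (1 / 2) h p q); auto; try lra.
    intros; apply half_space_point_spec; auto. }
  exists (E1 ++ E2). split.
  - rewrite length_app, plus_INR.
    (* With [K >= 1] and [INR L + 1 >= 1] the two counts are at most [3] and [20] times
       [(INR L + 1) * K]. *)
    assert (H : INR (length Q) * (1 + 2 * (INR L + 1) * K) + INR (length Q) * (10 * (INR L + 1) * (K + 1))
      <= INR (length Q) * (23 * (INR L + 1) * K)).
    { rewrite <- Rmult_plus_distr_l. apply Rmult_le_compat_l; [apply pos_INR|].
      pose proof (pos_INR L). assert (1 * 1 <= (INR L + 1) * K) by (apply Rmult_le_compat; lra).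
      assert ((INR L + 1) * 1 <= (INR L + 1) * K) by (apply Rmult_le_compat_l; lra). lra. }
    lra.
  - intros p q Hp Hq HD. destruct (Rle_lt_dec (d p q) (1 / 2)) as [Hs|Hl].
    + eapply conn_mono; [eapply conn_incl; [apply incl_appl, incl_refl|apply C1; auto]|].
      apply spanner_stretch_weaken; lra.
    + eapply conn_incl; [apply incl_appr, incl_refl|apply C2; auto; lra].
Qed.

(** Two-hop lists valid at every scale allow [R0] to be an upper bound for all distances in [Q], so
    the local construction already serves every pair. *)
Lemma bounded_geometry_spanner {X} (d : X -> X -> R) (eps K : R) (L : nat) (Z : R -> X -> list X) :
  pseudo_metric d -> 0 < eps <= 1 -> 64 / eps <= 2 ^ L -> 1 <= K ->
  (forall r p, 0 < r -> INR (length (Z r p)) <= K) ->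
  (forall r p q, 0 < r -> r <= d p q <= 8 * r ->
     exists z, In z (Z r p) /\ In z (Z r q) /\ d p z + d z q <= (1 + eps) * d p q) ->
  forall Q, exists E, INR (length E) <= INR (length Q) * (23 * (INR L + 1) * K) /\
    forall p q, In p Q -> In q Q -> 0 < d p q ->
      conn d E p q ((1 + 12 * eps) * (1 + 4 * eps) * d p q).
Proof.
  intros Hm He HL HK HZ Hhop Q.
  destruct (finite_upper_bound (fun e : X * X => d (fst e) (snd e)) (list_prod Q Q))
    as (R0 & HR0 & Hmax).
  destruct (local_spanner d eps R0 K L Z Hm He) with (Q := Q) as (E & HE & HC); auto; try lra.
  { eapply Rle_trans; [|exact HL]. apply Rmult_le_compat_r; [left; apply Rinv_0_lt_compat|]; lra. }
  exists E. split.
  - eapply Rle_trans; [exact HE|]. apply Rmult_le_compat_l; [apply pos_INR|].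
    pose proof (pos_INR L). assert (1 * 1 <= (INR L + 1) * K) by (apply Rmult_le_compat; lra). lra.
  - intros p q Hp Hq HD. eapply conn_mono; [apply HC; auto|apply spanner_stretch_weaken; lra].
    split; auto. apply (Hmax (p, q)). apply in_prod; auto.
Qed.

Theorem model_space_spanner g d eps L (Q : list (model_space g d)) :
  (2 <= d)%nat -> 0 < eps <= 1 -> 64 / eps <= 2 ^ L ->
  exists E, INR (length E) <= INR (length Q) * (23 * (INR L + 1) * steiner_bound d eps) /\
    forall p q, In p Q -> In q Q -> 0 < model_dist g d p q ->
      conn (model_dist g d) E p q ((1 + 12 * eps) * (1 + 4 * eps) * model_dist g d p q).
Proof.
  intros Hd He HL. pose proof (steiner_bound_ge_1 d eps Hd He) as HK.
  destruct g.
  - apply (bounded_geometry_spanner _ eps _ L (sphere_steiner d eps)); auto.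
    + apply spherical_metric.
    + intros; apply length_sphere_steiner; auto.
    + intros; apply sphere_two_hop; auto; lia.
  - apply (bounded_geometry_spanner _ eps _ L (euclidean_steiner d eps)); auto.
    + apply euclidean_metric.
    + intros; apply length_euclidean_steiner; auto.
    + intros; apply euclidean_two_hop; auto; lia.
  - destruct d as [|k]; [lia|]. apply hyperbolic_spanner; auto; lia.
Qed.

Lemma model_metric g d : pseudo_metric (model_dist g d).
Proof. destruct g; [apply spherical_metric|apply euclidean_metric|apply hyperbolic_metric]. Qed.

(** * Passing to the quotient *)

Lemma quot_dist_le {X} (dist : X -> X -> R) (G : list (X -> X)) f x y :
  In f G -> quot_dist dist G x y <= dist x (f y).
Proof.
  unfold quot_dist. induction G as [|g G IH]; [easy|]. intros [->|Hf]; simpl.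
  - apply Rmin_l.
  - eapply Rle_trans; [apply Rmin_r|auto].
Qed.

Lemma quot_dist_attained {X} (dist : X -> X -> R) (G : list (X -> X)) x y :
  In (fun x => x) G -> exists f, In f G /\ quot_dist dist G x y = dist x (f y).
Proof.
  intro Hid. unfold quot_dist.
  assert (H : forall G', incl G' G -> exists f, In f G /\
    fold_right (fun f acc => Rmin (dist x (f y)) acc) (dist x y) G' = dist x (f y)).
  { induction G' as [|g G' IH]; intro Hi; simpl.
    - exists (fun x => x); auto.
    - destruct IH as (f & Hf & E); [intros a Ha; apply Hi; right; auto|]. rewrite E.
      unfold Rmin. destruct Rle_dec; [exists g|exists f]; split; auto. apply Hi; left; auto. }
  apply H, incl_refl.
Qed.

Lemma group_inverse {X} (dist : X -> X -> R) (G : list (X -> X)) f :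
  finite_isometry_group dist G -> In f G ->
  exists h, In h G /\ (forall x, h (f x) = x) /\ forall x, f (h x) = x.
Proof.
  intros (_ & _ & Hiso & _ & Hinv) Hf.
  destruct (Hinv f Hf) as (h & Hh & H1). exists h. split; [auto|]. split; [auto|].
  intro x. destruct (proj2 (Hiso f Hf) x) as [y <-]. rewrite H1; auto.
Qed.

Lemma quot_dist_orbit {X} (dist : X -> X -> R) (G : list (X -> X)) f h x y :
  finite_isometry_group dist G -> In f G -> In h G ->
  quot_dist dist G (f x) (h y) <= dist x y.
Proof.
  intros HG Hf Hh. destruct (group_inverse dist G h HG Hh) as (k & Hk & K1 & K2).
  pose proof HG as (_ & _ & Hiso & Hcomp & _).
  eapply Rle_trans; [apply (quot_dist_le dist G (fun z => f (k z))); auto|].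
  rewrite K1. right. apply Hiso; auto.
Qed.

(** Every vertex may be replaced by any point of its orbit: the quotient distance of the new ends of
    an edge is at most the old distance, and no edge is added. *)
Lemma conn_quotient {X} (dist : X -> X -> R) (G : list (X -> X)) (rep : X -> X) E u v c :
  finite_isometry_group dist G ->
  (forall x, exists f, In f G /\ rep x = f x) ->
  conn dist E u v c ->
  conn (quot_dist dist G) (map (fun e => (rep (fst e), rep (snd e))) E) (rep u) (rep v) c.
Proof.
  intros HG Hrep [l [Hl Wl]]. exists (map rep l).
  revert u c Hl Wl; induction l as [|w l IH]; simpl; intros u c Hl Wl.
  - subst; auto.
  - destruct Hl as [He Hl]. destruct (IH w (c - dist u w) Hl) as [I1 I2]; [lra|].
    split.
    + split; auto. destruct He as [He|He]; [left|right];
        apply (in_map (fun e => (rep (fst e), rep (snd e)))) in He; auto.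
    + destruct (Hrep u) as (f & Hf & ->). destruct (Hrep w) as (h & Hh & Ew). rewrite Ew in *.
      pose proof (quot_dist_orbit dist G f h u w HG Hf Hh). lra.
Qed.

(** [1280] is [64 * 20], from [64 / (eps / 20)]. With [1280 <= 2 ^ 11] and [1 / 2 <= ln 2 <= ln x],
    the largest [k] with [2 ^ k <= 1280 * x] is at most [24 * ln x]; the two further units cost
    [4 * ln x]. *)
Lemma pow2_exponent (x : R) : 2 <= x ->
  exists L : nat, 1280 * x <= 2 ^ L /\ INR L + 1 <= 28 * ln x.
Proof.
  intro Hx. pose proof ln_lt_2 as Hln2. pose proof (ln_le_compat 2 x ltac:(lra) Hx).
  destruct (exists_pow2_ge (1280 * x)) as [n0 Hn0].
  destruct (dyadic_level 1 (1280 * x) (S n0)) as (k & _ & K1 & K2); [lra| |].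
  { split; [lra|]. rewrite Rmult_1_l. simpl. lra. }
  rewrite Rmult_1_l in K1, K2. exists (S k). split; [lra|].
  assert (E1 : ln (2 ^ k) <= ln (1280 * x)) by (apply ln_le_compat; auto; apply pow_lt; lra).
  rewrite ln_mult, ln_pow in E1 by lra.
  assert (E2 : ln 1280 <= ln (2 ^ 11)) by (apply ln_le_compat; lra).
  rewrite ln_pow in E2 by lra. replace (INR 11) with 11 in E2 by (simpl; ring).
  assert (INR k * (1 / 2) <= INR k * ln 2) by (apply Rmult_le_compat_l; [apply pos_INR|lra]).
  rewrite S_INR. lra.
Qed.

(** Replacing [eps] by [eps / 20] costs [sqrt 20 ^ (d - 1)], at most [INR d ^ (3 * (d - 1))], and
    [23 * 28 <= 2 ^ 10]; the exponents [24 * d], [3 * (d - 1)] and [10] add up to at most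
    [32 * d]. *)
Lemma final_count d eps : (2 <= d)%nat -> 0 < eps <= 1 / 2 ->
  23 * 28 * steiner_bound d (eps / 20) <=
  Rpower (INR d) (32 * INR d) * Rpower eps ((1 - INR d) / 2).
Proof.
  intros Hd He. assert (HN : 2 <= INR d) by (apply le_INR in Hd; auto).
  assert (Hs0 : 0 < sqrt eps) by (apply sqrt_lt_R0; lra).
  assert (E1 : / sqrt (eps / 20) = sqrt 20 * / sqrt eps).
  { rewrite sqrt_div_alt by lra. field. split; [lra|].
    assert (0 < sqrt 20) by (apply sqrt_lt_R0; lra). lra. }
  assert (E2 : Rpower (INR d) (32 * INR d) = INR d ^ (32 * d)).
  { replace (32 * INR d) with (INR (32 * d)) by (rewrite mult_INR; simpl; ring).
    apply Rpower_pow; lra. }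
  assert (E3 : (/ sqrt eps) ^ (d - 1) = Rpower eps ((1 - INR d) / 2)).
  { rewrite <- Rpower_sqrt by lra. rewrite <- Rpower_Ropp.
    rewrite <- Rpower_pow by (unfold Rpower; apply exp_pos). rewrite Rpower_mult.
    f_equal. rewrite minus_INR by lia. simpl. field. }
  unfold steiner_bound. rewrite E1, E2, <- E3, Rpow_mult_distr.
  assert (H20 : 0 <= sqrt 20 <= INR d ^ 3).
  { split; [apply sqrt_pos|]. apply Rle_trans with (2 ^ 3); [|apply pow_incr; lra].
    apply Rsqr_le_inv; [lra|]. rewrite sqrt_def by lra. lra. }
  assert (P1 : sqrt 20 ^ (d - 1) <= INR d ^ (3 * (d - 1))).
  { rewrite pow_mult. apply pow_incr; auto. }
  assert (P2 : 23 * 28 <= INR d ^ 10).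
  { apply Rle_trans with (2 ^ 10); [lra|apply pow_incr; lra]. }
  assert (Hp : forall k, 0 < INR d ^ k) by (intro; apply pow_lt; lra).
  assert (S0 : 0 < (/ sqrt eps) ^ (d - 1)) by (apply pow_lt, Rinv_0_lt_compat; auto).
  rewrite <- !Rmult_assoc. apply Rmult_le_compat_r; [lra|].
  apply Rle_trans with (INR d ^ 10 * INR d ^ (24 * d) * INR d ^ (3 * (d - 1))).
  - apply Rmult_le_compat; auto.
    + apply Rmult_le_pos; [lra|left; auto].
    + apply pow_le, sqrt_pos.
    + apply Rmult_le_compat_r; [left; auto|auto].
  - rewrite <- !pow_add. apply Rle_pow; [lra|lia].
Qed.

Theorem mainTheorem15 :
  exists C : R, 0 < C /\
  forall (g : geometry) (d : nat) (eps : R)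
         (G : list (model_space g d -> model_space g d))
         (P : list (model_space g d)),
    (2 <= d)%nat ->
    0 < eps <= 1 / 2 ->
    finite_isometry_group (model_dist g d) G ->
    acts_freely G ->
    NoDup P ->
    (forall p q, In p P -> In q P -> p <> q ->
       0 < quot_dist (model_dist g d) G p q) ->
    exists (S : list (model_space g d)) (E : list (model_space g d * model_space g d)),
      is_steiner_spanner (quot_dist (model_dist g d) G) (1 + eps) P S E /\
      INR (length E) <=
        Rpower (INR d) (C * INR d) * Rpower eps ((1 - INR d) / 2) * ln (1 / eps)
        * INR (length P) * INR (length G).
Proof.
  exists 32. split; [lra|]. intros g d eps G P Hd He HG _ _ Hsep.
  set (dist := model_dist g d) in *.
  pose proof (model_metric g d) as Hm. fold dist in Hm.
  destruct Hm as (Hd0 & Hsym & Hpos & Htri).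
  pose proof HG as (_ & Hid & Hiso & Hcomp & _).
  assert (Hx2 : 2 <= 1 / eps).
  { apply Rmult_le_reg_r with eps; [lra|]. field_simplify; lra. }
  destruct (pow2_exponent (1 / eps) Hx2) as (L & HL1 & HL2).
  set (Q := flat_map (fun f => map f P) G).
  assert (HQ : forall f p, In f G -> In p P -> In (f p) Q).
  { intros f p Hf Hp. apply in_flat_map. exists f; split; auto. apply in_map; auto. }
  assert (HQlen : INR (length Q) = INR (length G) * INR (length P)).
  { unfold Q. rewrite (length_flat_map_const _ (length P)), mult_INR; auto.
    intros; apply length_map. }
  (* For [e = eps / 20 <= 1 / 40] the stretch [(1 + 12 * e) * (1 + 4 * e)] is at most [1 + eps]. *)
  destruct (model_space_spanner g d (eps / 20) L Q Hd) as (E & HE & HC); [lra| |].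
  { replace (64 / (eps / 20)) with (1280 * (1 / eps)) by (field; lra). auto. }
  fold dist in HC.
  (* [rep] sends a point to a member of its orbit, and into [P] when the orbit meets [P]. That
     member is unique, since distinct points of [P] have positive quotient distance, so walks
     between points of [P] keep their ends. *)
  assert (Hrep : forall x, exists y, (exists f, In f G /\ y = f x) /\
    ((exists p f, In p P /\ In f G /\ x = f p) -> In y P)).
  { intro x. destruct (classic (exists p f, In p P /\ In f G /\ x = f p)) as [(p & f & Hp & Hf & ->)|Hn].
    - destruct (group_inverse dist G f HG Hf) as (h & Hh & H1 & _).
      exists p. split; auto. exists h; auto.
    - exists x. split; [|tauto]. exists (fun x => x); auto. }
  apply choice in Hrep. destruct Hrep as [rep Hrep].
  assert (Hrepid : forall f p, In f G -> In p P -> rep (f p) = p).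
  { intros f p Hf Hp. destruct (Hrep (f p)) as [(h & Hh & Eh) Hin].
    assert (Hy : In (rep (f p)) P) by (apply Hin; exists p, f; auto).
    apply NNPP; intro Hne. specialize (Hsep _ _ Hy Hp Hne).
    pose proof (quot_dist_le dist G (fun x => h (f x)) (rep (f p)) p (Hcomp h f Hh Hf)) as Hle.
    rewrite Eh, Hd0 in Hle. rewrite Eh in Hsep. lra. }
  set (E' := map (fun e => (rep (fst e), rep (snd e))) E).
  exists (flat_map (fun e => fst e :: snd e :: nil) E'), E'. split; [split|].
  - intros e Hin. rewrite !in_app_iff, !in_flat_map.
    split; right; exists e; simpl; auto.
  - intros p q Hp Hq.
    destruct (classic (p = q)) as [<-|Hne].
    + exists nil. simpl. split; auto. apply Rmult_le_pos; [lra|].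
      destruct (quot_dist_attained dist G p p Hid) as (f & _ & ->). apply Hpos.
    + specialize (Hsep p q Hp Hq Hne).
      destruct (quot_dist_attained dist G p q Hid) as (f & Hf & Eq). rewrite Eq in *.
      assert (Hc : conn dist E p (f q) ((1 + eps) * dist p (f q))).
      { eapply conn_mono; [apply HC; auto|].
        - apply (HQ (fun x => x)); auto.
        - apply Rmult_le_compat_r; auto. nra. }
      apply (conn_quotient dist G rep E) in Hc; auto; [|intro x; apply (Hrep x)].
      rewrite (Hrepid f q Hf Hq) in Hc.
      assert (Ep : rep p = p) by (apply (Hrepid (fun x => x)); auto).
      rewrite Ep in Hc. exact Hc.
  - unfold E'. rewrite length_map. eapply Rle_trans; [exact HE|]. rewrite HQlen.
    pose proof (final_count d eps Hd He) as HF.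
    pose proof (steiner_bound_ge_1 d (eps / 20) Hd ltac:(lra)) as HB.
    assert (Hln : 0 <= ln (1 / eps)) by (apply ln_nonneg; lra).
    assert (A : 23 * (INR L + 1) * steiner_bound d (eps / 20) <=
      23 * (28 * ln (1 / eps)) * steiner_bound d (eps / 20)).
    { apply Rmult_le_compat_r; lra. }
    assert (B : 23 * 28 * steiner_bound d (eps / 20) * ln (1 / eps) <=
      Rpower (INR d) (32 * INR d) * Rpower eps ((1 - INR d) / 2) * ln (1 / eps))
      by (apply Rmult_le_compat_r; auto).
    pose proof (pos_INR (length P)). pose proof (pos_INR (length G)).
    assert (HPG : 0 <= INR (length G) * INR (length P)) by (apply Rmult_le_pos; auto).
    apply Rle_trans with (INR (length G) * INR (length P) *
      (Rpower (INR d) (32 * INR d) * Rpower eps ((1 - INR d) / 2) * ln (1 / eps))); [|right; ring].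
    apply Rmult_le_compat_l; auto. lra.
Qed.
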